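(* Let $(R,\mathfrak m)$ be a Noetherian local ring and $M$ a finite $R$-module of dimension $d>0$. Let $\mathbf x=x_1,\ldots,x_r$ be an amenable partial system of parameters of $M$ that is a $d$-sequence relative to $M$. Suppose that either (a) $r\ge2$ and $\operatorname{depth}M\ge r-1$, or (b) $r=3$ and $M$ is unmixed. Then $\mathrm j_1(\mathbf x;M)=0$ if and only if $\mathbf x=x_1,\ldots,x_r$ is an $M$-regular sequence.
   Context: ''Finite'' module means finitely generated; $\lambda(-)$ is length. $M$ is unmixed if $\dim\widehat R/P=\dim M$ for every associated prime $P$ of the $\mathfrak m$-adic completion $\widehat M$ over $\widehat R$. A partial system of parameters of $M$ is a sequence $x_1,\ldots,x_r\in\mathfrak m$ with $\dim M=r+\dim M/(x_1,\ldots,x_r)M$; it is amenable to $M$ if the Koszul homology $\mathrm H_i(\mathbf x;M)$ has finite length for all $i>0$. A sequence $x_1,\ldots,x_n$ is a $d$-sequence relative to $M$ if $(x_1,\ldots,x_{i-1})M:_M x_ix_j=(x_1,\ldots,x_{i-1})M:_M x_j$ for all $1\le i\le j\le n$. For $I=(\mathbf x)$ let $\operatorname{gr}_I(M)=\bigoplus_{n\ge0}I^nM/I^{n+1}M$ and $\mathrm H^0_{\mathfrak m}(\operatorname{gr}_I(M))=\bigoplus_{k\ge0}\mathrm H_k$. For $n\gg0$ the function $\sum_{k\le n}\lambda(\mathrm H_k)$ agrees with a polynomial written $\sum_{i=0}^r(-1)^i\mathrm j_i(\mathbf x;M)\binom{n+r-i}{r-i}$; this defines the $\mathbf j$-coefficients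 $\mathrm j_i(\mathbf x;M)$. *)

(* Defs.v *)
From HB Require Import structures.
From mathcomp Require Import all_boot all_order all_algebra.
From mathcomp Require Import generic_quotient ring_quotient.
From mathcomp Require Import boolp classical_sets functions.

Set Implicit Arguments.
Unset Strict Implicit.
Unset Printing Implicit Defensive.

Import GRing.Theory.

Local Open Scope classical_set_scope.
Local Open Scope ring_scope.
Local Open Scope quotient_scope.

(* Submodules and ideals are classical sets; a quotient V / N of a module (or *)
(* a subquotient N / N') is represented by the submodules themselves, and its *)
(* submodules by the submodules of V lying over N (and inside the numerator). *)

Definition submod (A : comPzRingType) (V : lmodType A) (N : set V) : Prop :=
  N 0 /\ forall (a : A) (u v : V), N u -> N v -> N (a *: u + v).

Definition ideal (A : comPzRingType) (I : set A) : Prop :=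
  submod (I : set A^o).

Definition span (A : comPzRingType) (V : lmodType A) (S : set V) : set V :=
  smallest (@submod A V) S.

Definition ideal_gen (A : comPzRingType) (s : seq A) : set A :=
  span ([set` s] : set A^o).

Definition prime_ideal (A : comPzRingType) (P : set A) : Prop :=
  [/\ ideal P, ~ P 1 & forall a b : A, P (a * b) -> P a \/ P b].

Definition maximal_ideal (A : comPzRingType) (m : set A) : Prop :=
  [/\ ideal m, ~ m 1 &
      forall J : set A, ideal J -> ~ J 1 -> m `<=` J -> J = m].

Definition local_ring (A : comPzRingType) (m : set A) : Prop :=
  maximal_ideal m /\ forall n : set A, maximal_ideal n -> n = m.

Definition noetherian (A : comPzRingType) : Prop :=
  forall I : set A, ideal I -> exists s : seq A, I = ideal_gen s.

Definition finite_module (A : comPzRingType) (V : lmodType A) : Prop :=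
  exists s : seq V, span [set` s] = setT.

(* I N, for an ideal I and a submodule N *)
Definition idmul (A : comPzRingType) (V : lmodType A) (I : set A) (N : set V) :
  set V := span [set w | exists a v, [/\ I a, N v & w = a *: v]].

(* I ^ n V *)
Definition idpow (A : comPzRingType) (V : lmodType A) (I : set A) (n : nat) :
  set V := iter n (@idmul A V I) setT.

Arguments idpow {A} V I n.

(* (s) V *)
Definition seqmul (A : comPzRingType) (V : lmodType A) (s : seq A) : set V :=
  idmul (ideal_gen s) setT.

Arguments seqmul {A} V s.

(* N :_V a *)
Definition colon (A : comPzRingType) (V : lmodType A) (N : set V) (a : A) :
  set V := [set v | N (a *: v)].

(* Ann (V / N) *)
Definition annq (A : comPzRingType) (V : lmodType A) (N : set V) : set A :=
  [set a | forall v : V, N (a *: v)].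

Definition strict_chain (T : Type) (C : set (set T)) (n : nat) : Prop :=
  exists c : nat -> set T,
    (forall i, (i <= n)%N -> C (c i)) /\
    (forall i, (i < n)%N -> c i `<` c i.+1).

(* n is the supremum of the lengths of the strict chains in C (the length of  *)
(* c_0 < ... < c_n being n)                                                   *)
Definition chain_length (T : Type) (C : set (set T)) (n : nat) : Prop :=
  strict_chain C n /\ ~ strict_chain C n.+1.

(* dim (V / N) = d, the Krull dimension of the ring A / Ann (V / N) *)
Definition dimq (A : comPzRingType) (V : lmodType A) (N : set V) (d : nat) :
  Prop :=
  chain_length [set P : set A | prime_ideal P /\ annq N `<=` P] d.

Definition has_dim (A : comPzRingType) (V : lmodType A) (d : nat) : Prop :=
  dimq ([set 0] : set V) d.

(* lambda (N / N') = l, for submodules N' <= N *)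
Definition has_length (A : comPzRingType) (V : lmodType A) (N N' : set V)
    (l : nat) : Prop :=
  chain_length [set L : set V | [/\ submod L, N' `<=` L & L `<=` N]] l.

Definition ass_prime (A : comPzRingType) (V : lmodType A) (P : set A) : Prop :=
  prime_ideal P /\ exists v : V, P = [set a | a *: v = 0].

Definition regular_seq (A : comPzRingType) (V : lmodType A) (s : seq A) :
  Prop :=
  (forall i, (i < size s)%N ->
     forall v : V, seqmul V (take i s) (s`_i *: v) -> seqmul V (take i s) v) /\
  seqmul V s <> setT.

Definition has_depth (A : comPzRingType) (m : set A) (V : lmodType A)
    (e : nat) : Prop :=
  (exists s : seq A, [/\ [set` s] `<=` m, regular_seq V s & size s = e]) /\
  (forall s : seq A, [set` s] `<=` m -> regular_seq V s -> (size s <= e)%N).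

Definition partial_sop (A : comPzRingType) (m : set A) (V : lmodType A)
    (s : seq A) : Prop :=
  [set` s] `<=` m /\
  exists e, has_dim V (size s + e) /\ dimq (seqmul V s) e.

(* With indices counted from 0, (x_1, ..., x_{i-1}) is take i s. *)
Definition d_sequence (A : comPzRingType) (V : lmodType A) (s : seq A) : Prop :=
  forall i j, (i <= j < size s)%N ->
    colon (seqmul V (take i s)) (s`_i * s`_j) =
    colon (seqmul V (take i s)) s`_j.

Section Koszul.
Variables (A : comPzRingType) (V : lmodType A) (r : nat) (x : r.-tuple A).

(* f stands for the sum over J of the elements f(J) e_J of the Koszul complex *)
(* K(x; V), where e_J is the wedge of the e_j for j in J, in increasing order. *)
(* The differential maps v e_J, where J = {j_1 < ... < j_k}, to the sum over l *)
(* of (-1)^(l-1) x_{j_l} v e_{J \ j_l}.                                       *)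
Definition koszul : lmodType A := {ffun {set 'I_r} -> V}.

Definition koszul_diff (f : koszul) : koszul :=
  [ffun J : {set 'I_r} =>
     \sum_(j : 'I_r | j \notin J)
        ((-1) ^+ #|[set k in J | (k < j)%N]%SET| * tnth x j) *: f (j |: J)%SET].

Definition koszul_chains (i : nat) : set koszul :=
  [set f | forall J : {set 'I_r}, #|J| <> i -> f J = 0].

Definition koszul_cycles (i : nat) : set koszul :=
  [set f | koszul_chains i f /\ koszul_diff f = 0].

Definition koszul_boundaries (i : nat) : set koszul :=
  koszul_diff @` koszul_chains i.+1.

Definition amenable : Prop :=
  forall i, (0 < i)%N ->
    exists l, has_length (koszul_cycles i) (koszul_boundaries i) l.

End Koszul.

Section JCoefficients.
Variables (A : comPzRingType) (m : set A) (V : lmodType A).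

(* H^0_m (gr_I V) consists of the elements killed by a power of m; as R acts  *)
(* degreewise, its component of degree k is the quotient of [gr_torsion I k]  *)
(* by I^(k+1) V.                                                              *)
Definition gr_torsion (I : set A) (k : nat) : set V :=
  [set v | idpow V I k v /\
     exists t, forall a : A, idpow (A^o) m t a -> idpow V I k.+1 (a *: v)].

Definition is_j_coefs (s : seq A) (j : nat -> int) : Prop :=
  exists h : nat -> nat,
    (forall k, has_length (gr_torsion (ideal_gen s) k)
                          (idpow V (ideal_gen s) k.+1) (h k)) /\
    exists n0 : nat, forall n : nat, (n0 <= n)%N ->
      (\sum_(k < n.+1) h k)%N%:Z =
      \sum_(i < (size s).+1)
         (-1) ^+ i * j i * 'C(n + size s - i, size s - i)%:Z.

(* Only the values for i <= size s are meaningful: those are unique. *)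
Definition j_coef (s : seq A) (i : nat) : int :=
  xget (fun=> 0) [set j | is_j_coefs s j] i.

End JCoefficients.

Arguments j_coef {A} m V s i.

Lemma submodT (A : comPzRingType) (W : lmodType A) : submod ([set: W] : set W).
Proof. by []. Qed.

Lemma submod_span (A : comPzRingType) (W : lmodType A) (S : set W) :
  submod (span S).
Proof.
split=> [N [[]] //|a u v Su Sv N [subN SN]].
by apply: (subN.2); [exact: Su | exact: Sv].
Qed.

Section IdpowTheory.
Variables (A : comPzRingType) (I : set A) (V : lmodType A).

Lemma submod_idpow (W : lmodType A) n : submod (idpow W I n).
Proof. by case: n => [|n]; [exact: submodT | exact: submod_span]. Qed.

Lemma idpow0 n : idpow V I n 0.
Proof. exact: (submod_idpow V n).1. Qed.

Lemma idpowZD n a u v : idpow V I n u -> idpow V I n v ->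
  idpow V I n (a *: u + v).
Proof. exact: (submod_idpow V n).2. Qed.

Lemma idpowD n u v : idpow V I n u -> idpow V I n v -> idpow V I n (u + v).
Proof. by move=> nu nv; rewrite -[u]scale1r; exact: idpowZD. Qed.

Lemma idpowZ n a u : idpow V I n u -> idpow V I n (a *: u).
Proof. by move=> nu; rewrite -[_ *: _]addr0; apply/idpowZD/idpow0. Qed.

Lemma idpowN n u : idpow V I n u -> idpow V I n (- u).
Proof. by move=> nu; rewrite -scaleN1r; exact: idpowZ. Qed.

Lemma idpow_scale n a (v : V) : idpow (A^o) I n a -> idpow V I n (a *: v).
Proof.
elim: n a v => // n IHn a v na.
have : [set b : A^o | idpow V I n.+1 ((b : A) *: v)] a; last by [].
apply: na; split.
  split=> [|c b b' Nb Nb'].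
    by suff : idpow V I n.+1 ((0 : A) *: v) by []; rewrite scale0r; exact: idpow0.
  suff : idpow V I n.+1 ((c * b + b' : A) *: v) by [].
  by rewrite scalerDl -scalerA; exact: idpowZD.
move=> _ [b [c [Ib nc ->]]] L [subL sL].
apply: sL; exists b, ((c : A) *: v); split=> //; first exact: IHn.
by rewrite scalerA.
Qed.

End IdpowTheory.

(* The I-adic completion, i.e. the inverse limit of the modules V / I^n V: a  *)
(* compatible family of classes is represented by a sequence u of elements of *)
(* V with u (n + 1) = u n modulo I^n V, and two sequences are identified when *)
(* they agree modulo I^n V for every n.                                       *)
Section Coherent.
Variables (A : comPzRingType) (I : set A) (V : lmodType A).

Definition coherent : {pred nat -> V} :=
  fun u => `[< forall n, idpow V I n (u n.+1 - u n) >].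

Lemma coherent_zmod_closed : zmod_closed coherent.
Proof.
split=> [|u v /asboolP cu /asboolP cv]; apply/asboolP => n.
  suff : idpow V I n (0 - 0) by []; rewrite subr0; exact: idpow0.
suff : idpow V I n ((u n.+1 - v n.+1) - (u n - v n)) by [].
rewrite opprD addrACA -opprD.
by apply: idpowD => //; exact: idpowN.
Qed.

HB.instance Definition _ :=
  GRing.isZmodClosed.Build (nat -> V) coherent coherent_zmod_closed.

Definition coh_seq : Type := {u : nat -> V | coherent u}.

HB.instance Definition _ := SubChoice.on coh_seq.
HB.instance Definition _ := [SubChoice_isSubZmodule of coh_seq by <:].

Definition null_seq : {pred coh_seq} :=
  fun u => `[< forall n, idpow V I n (val u n) >].

Lemma null_zmod_closed : zmod_closed null_seq.
Proof.
split=> [|u v /asboolP cu /asboolP cv]; apply/asboolP => n.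
  exact: idpow0.
by rewrite raddfB; apply: idpowD => //; exact: idpowN.
Qed.

HB.instance Definition _ :=
  GRing.isZmodClosed.Build coh_seq null_seq null_zmod_closed.

Lemma null_seqE u : (u \in null_seq) = `[< forall n, idpow V I n (val u n) >].
Proof. by []. Qed.

Definition completion : Type := Quotient.quot null_seq.

HB.instance Definition _ := GRing.Zmodule.on completion.
HB.instance Definition _ := EqQuotient.on completion.

End Coherent.

Section CompletionAction.
Variables (A : comPzRingType) (I : set A) (V : lmodType A).
Implicit Types (a b : coh_seq I A^o) (u v : coh_seq I V).

Fact coh_scale_subproof a u : coherent I (fun n => (val a n : A) *: val u n).
Proof.
have /asboolP ca := valP a; have /asboolP cu := valP u; apply/asboolP => n.
rewrite -(subrKA ((val a n : A) *: val u n.+1)) -scalerBl -scalerBr.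
by apply: idpowD; [exact: idpow_scale | exact: idpowZ].
Qed.

Definition coh_scale a u : coh_seq I V :=
  Sub (fun n => (val a n : A) *: val u n) (coh_scale_subproof a u).

Definition compl_scale (a : completion I A^o) (u : completion I V) :
    completion I V :=
  \pi_(completion I V) (coh_scale (repr a) (repr u)).

Lemma pi_coh_eq u v :
  \pi_(completion I V) u = \pi v <->
  (forall n, idpow V I n (val u n - val v n)).
Proof.
have uvE n : val (u - v) n = val u n - val v n by rewrite raddfB.
split=> [/eqP e n|uv].
  move: e; rewrite -Quotient.idealrBE null_seqE => /asboolP/(_ n).
  by rewrite uvE.
apply/eqP; rewrite -Quotient.idealrBE null_seqE; apply/asboolP => n.
by rewrite uvE.
Qed.

Lemma repr_pi_coh u n :
  idpow V I n (val (repr (\pi_(completion I V) u)) n - val u n).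
Proof. by apply: (pi_coh_eq _ _).1; rewrite reprK. Qed.

Lemma pi_cohD u v :
  \pi_(completion I V) u + \pi_(completion I V) v = \pi_(completion I V) (u + v).
Proof. by rewrite raddfD. Qed.

Lemma val_cohD u v n : val (u + v) n = val u n + val v n.
Proof. by rewrite raddfD. Qed.

End CompletionAction.

Section CompletionActionTheory.
Variables (A : comPzRingType) (I : set A) (V : lmodType A).
Implicit Types (a b : coh_seq I A^o) (u v : coh_seq I V).

Lemma pi_scale a u :
  compl_scale (\pi a) (\pi u) = \pi_(completion I V) (coh_scale a u).
Proof.
apply/pi_coh_eq => n.
set a' := repr _; set u' := repr _.
suff : idpow V I n ((val a' n : A) *: val u' n - (val a n : A) *: val u n) by [].
rewrite -(subrKA ((val a' n : A) *: val u n)) -scalerBr -scalerBl.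
apply: idpowD; first exact/idpowZ/repr_pi_coh.
apply: idpow_scale; exact: (repr_pi_coh a n).
Qed.

End CompletionActionTheory.

Section CompletionActionLaws.
Variables (A : comPzRingType) (I : set A) (V : lmodType A).
Implicit Types (a b : coh_seq I A^o) (u v : coh_seq I V).

Fact coh_one_subproof : coherent I (fun=> 1 : A^o).
Proof. by apply/asboolP => n; rewrite subrr; exact: idpow0. Qed.

Definition coh_one : coh_seq I A^o := Sub (fun=> 1 : A^o) coh_one_subproof.

Definition compl_one : completion I A^o := \pi coh_one.

Lemma coh_pi (W : lmodType A) (p q : coh_seq I W) :
  (forall n, val p n = val q n) ->
  \pi_(completion I W) p = \pi_(completion I W) q.
Proof. by move=> pq; apply/pi_coh_eq => n; rewrite pq subrr; exact: idpow0. Qed.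

Lemma compl_scaleA (a b : completion I A^o) (u : completion I V) :
  compl_scale a (compl_scale b u) = compl_scale (compl_scale a b) u.
Proof.
elim/quotW: a => a; elim/quotW: b => b; elim/quotW: u => u.
rewrite (pi_scale b u) (pi_scale a b) (pi_scale a) (pi_scale (coh_scale a b) u).
by apply: coh_pi => n; exact: scalerA.
Qed.

Lemma compl_scale1 (u : completion I V) : compl_scale compl_one u = u.
Proof.
elim/quotW: u => u.
by rewrite pi_scale; apply: coh_pi => n; exact: scale1r.
Qed.

Lemma compl_scaleDr (a : completion I A^o) (u v : completion I V) :
  compl_scale a (u + v) = compl_scale a u + compl_scale a v.
Proof.
elim/quotW: a => a; elim/quotW: u => u; elim/quotW: v => v.
rewrite pi_cohD !pi_scale pi_cohD; apply: coh_pi => n.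
rewrite [RHS]val_cohD.
suff : (val a n : A) *: val (u + v) n =
  (val a n : A) *: val u n + (val a n : A) *: val v n by [].
by rewrite val_cohD scalerDr.
Qed.

Lemma compl_scaleDl (u : completion I V) (a b : completion I A^o) :
  compl_scale (a + b) u = compl_scale a u + compl_scale b u.
Proof.
elim/quotW: a => a; elim/quotW: u => u; elim/quotW: b => b.
rewrite pi_cohD !pi_scale pi_cohD; apply: coh_pi => n.
rewrite [RHS]val_cohD.
suff : (val (a + b) n : A) *: val u n =
  (val a n : A) *: val u n + (val b n : A) *: val u n by [].
by rewrite val_cohD -scalerDl.
Qed.

Lemma compl_mulC (a b : completion I A^o) : compl_scale a b = compl_scale b a.
Proof.
elim/quotW: a => a; elim/quotW: b => b.
by rewrite !pi_scale; apply: coh_pi => n; exact: mulrC.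
Qed.

End CompletionActionLaws.

Section CompletionRing.
Variables (A : comPzRingType) (I : set A).

Definition completion_ring : Type := completion I A^o.

HB.instance Definition _ := GRing.Zmodule.on completion_ring.

Let mulA : associative (@compl_scale A I A^o) := @compl_scaleA A I A^o.
Let mulC : commutative (@compl_scale A I A^o) := @compl_mulC A I.
Let mul1 : left_id (compl_one I) (@compl_scale A I A^o) :=
  @compl_scale1 A I A^o.
Let mulr1 : right_id (compl_one I) (@compl_scale A I A^o).
Proof. by move=> a; rewrite compl_mulC compl_scale1. Qed.
Let mulDl : left_distributive (@compl_scale A I A^o) +%R.
Proof. by move=> a b c; exact: compl_scaleDl. Qed.
Let mulDr : right_distributive (@compl_scale A I A^o) +%R.
Proof. by move=> a b c; exact: compl_scaleDr. Qed.

HB.instance Definition _ := GRing.Zmodule_isPzRing.Build completion_ring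
  mulA mul1 mulr1 mulDl mulDr.
HB.instance Definition _ :=
  GRing.PzRing_hasCommutativeMul.Build completion_ring mulC.

Variable V : lmodType A.

HB.instance Definition _ :=
  GRing.Zmodule_isLmodule.Build completion_ring (completion I V)
    (@compl_scaleA A I V) (@compl_scale1 A I V) (@compl_scaleDr A I V)
    (@compl_scaleDl A I V).

End CompletionRing.

Definition unmixed (A : comPzRingType) (m : set A) (V : lmodType A) : Prop :=
  forall P : set (completion_ring m),
    ass_prime (completion m V : lmodType (completion_ring m)) P ->
    exists e,
      dimq (P : set (completion_ring m)^o) e /\ has_dim V e.

(* Main.v *)
From mathcomp Require Import all_boot all_order all_algebra.
From mathcomp Require Import zify ring generic_quotient ring_quotient.
From mathcomp Require Import boolp classical_sets functions.
Require Import Defs.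

Set Implicit Arguments.
Unset Strict Implicit.
Unset Printing Implicit Defensive.

Import GRing.Theory.

Local Open Scope classical_set_scope.
Local Open Scope ring_scope.
Local Open Scope quotient_scope.

(** Write $Q_i = (x_1, \dots, x_i) M$, $U_i = Q_i :_M x_{i+1}$ and
    $u_i = \lambda(U_i / Q_i)$ for $0 \le i < r$. The proof rests on the formula
    $j_1(x; M) = u_{r-2} - u_{r-1}$ for $r \ge 2$ ([j_coef1E]).

    To begin with, the $u_i$ are finite: an element of $U_i$ gives a Koszul
    1-cycle, and the finite length of $H_1(x; M)$ forces a power of $m$ to kill
    $U_i / Q_i$ ([amenable_colon_torsion]). Let $I = (x)$ and
    $G_i = \mathrm{gr}_I(M / Q_i)$. For a $d$-sequence the initial form of
    $x_{i+1}$ acts on $G_i$ with kernel $U_i / Q_i$, in degree zero, and with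
    cokernel $G_{i+1}$; this follows from $U_i \cap IM = Q_i$
    ([dseq_colon_meet]) and $I^{k+1} M \cap Q_i = (x_1, \dots, x_i) I^k M$
    ([dseq_artin_rees]). The functor $H^0_m$ keeps this exact, because
    $H^0_m(G_i)$ is generated by its component $H^0_m(M / IM)$ of degree zero,
    which is the same for all $i$ ([grT_generated]). The resulting recursion for
    the lengths has the solution
    $$\sum_{k \le n} \lambda(H_k) = c \binom{n + r}{r} -
      \sum_{i < r} u_i \Bigl[\binom{n + i + 1}{i + 1} - \binom{n + i}{i}\Bigr]$$
    with $c = \lambda(H^0_m(M / IM))$, and $j_1$ can be read off.

    As $IM \ne M$ by Nakayama's lemma, the sequence is regular if and only if
    all $u_i$ vanish; then $j_1 = 0$. Conversely, let $j_1 = 0$.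

    If $\mathrm{depth}\, M \ge r - 1$, then $M / Q_i$ has no $m$-torsion for
    $i \le r - 2$ ([depth_colon]). Thus $u_i = 0$ for these $i$, and
    $u_{r-1} = u_{r-2} = 0$.

    If $r = 3$ and $M$ is unmixed, then $M$ has no $m$-torsion, so $x_1$ is
    regular. Now $j_1 = 0$ says that $u_1 = u_2$, which means that the torsion
    of $M / (x_1, x_2) M$ comes from that of $M / x_1 M$. In terms of local
    cohomology, $H^1_m(M / x_1 M) = 0$, so $x_1$ is surjective on $H^1_m(M)$
    ([torsion_class_lift]). For an unmixed module of dimension at
    least two $H^1_m(M)$ has finite length, and Nakayama's lemma would give
    $H^1_m(M) = 0$. Instead of that finiteness theorem the argument is direct: a
    nonzero torsion class modulo $x_1$ lifts successively to all powers of
    $x_1$, and the limit lies in a submodule $K$ of the completion such that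
    $K / x_1 K$ has finite length ([divK_chain]). On such a module some element
    has a prime annihilator $P$ with $\dim \widehat R / P \le 1$
    ([one_dimensional_prime]), which contradicts unmixedness. Hence
    $u_1 = u_2 = 0$. *)

Reserved Notation "M :+ N" (at level 50, left associativity).

(** * Submodules *)

Section Submodules.
Variables (A : comPzRingType) (V : lmodType A).
Implicit Types (N L X Y : set V) (a b : A) (u v w : V) (S : set V).

Definition addm N L : set V :=
  [set w | exists u v, [/\ N u, L v & w = u + v]].

Definition dilate a N : set V := [set w | exists2 v, N v & w = a *: v].

Local Notation "M :+ N" := (addm M N).

Lemma sub0 N : submod N -> N 0. Proof. by case. Qed.

Lemma subZ N a u : submod N -> N u -> N (a *: u).
Proof.
by move=> sN Nu; rewrite -[_ *: _]addr0; apply: sN.2 => //; case: sN.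
Qed.

Lemma subD N u v : submod N -> N u -> N v -> N (u + v).
Proof. by move=> sN Nu Nv; rewrite -[u]scale1r; apply: sN.2. Qed.

Lemma subN N u : submod N -> N u -> N (- u).
Proof. by move=> sN Nu; rewrite -scaleN1r; apply: subZ. Qed.

Lemma subB N u v : submod N -> N u -> N v -> N (u - v).
Proof. by move=> sN Nu Nv; apply: subD => //; apply: subN. Qed.

Lemma submod_intro N : (forall a u, N u -> N (a *: u)) ->
  (forall u v, N u -> N v -> N (u + v)) -> (exists u, N u) -> submod N.
Proof.
move=> NZ ND [u Nu]; split=> [|a v w Nv Nw]; last by apply: ND => //; apply: NZ.
by rewrite -(scale0r u); apply: NZ.
Qed.

Lemma submod_set0 : submod ([set 0] : set V).
Proof. by split=> // a u v -> ->; rewrite scaler0 addr0. Qed.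

Lemma submod_addm N L : submod N -> submod L -> submod (N :+ L).
Proof.
move=> sN sL; split=> [|a _ _ [u [v [Nu Lv ->]]] [u' [v' [Nu' Lv' ->]]]].
  by exists 0, 0; split; rewrite ?addr0 //; apply: sub0.
exists (a *: u + u'), (a *: v + v'); split; first exact: sN.2.
  exact: sL.2.
by rewrite scalerDr addrACA.
Qed.

Lemma submod_dilate a N : submod N -> submod (dilate a N).
Proof.
move=> sN; split=> [|b _ _ [u Nu ->] [v Nv ->]].
  by exists 0; rewrite ?scaler0 //; apply: sub0.
exists (b *: u + v); first exact: sN.2.
by rewrite scalerDr !scalerA mulrC.
Qed.

Lemma submod_setI N L : submod N -> submod L -> submod (N `&` L).
Proof.
move=> sN sL; split=> [|a u v [Nu Lu] [Nv Lv]]; first by split; apply: sub0.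
by split; [apply: sN.2 | apply: sL.2].
Qed.

Lemma submod_colon N a : submod N -> submod (colon N a).
Proof.
move=> sN; split=> [|b u v /= Nu Nv].
  by rewrite /colon/= scaler0; apply: sub0.
rewrite /colon/= scalerDr scalerA mulrC -scalerA.
exact: sN.2.
Qed.

Lemma addml N L : submod L -> N `<=` N :+ L.
Proof.
by move=> sL u Nu; exists u, 0; rewrite addr0; split=> //; apply: sub0.
Qed.

Lemma addmr N L : submod N -> L `<=` N :+ L.
Proof.
by move=> sL u Nu; exists 0, u; rewrite add0r; split=> //; apply: sub0.
Qed.

Lemma addm_sub N L X : submod X -> N `<=` X -> L `<=` X -> N :+ L `<=` X.
Proof.
by move=> sX NX LX _ [u [v [Nu Lv ->]]]; apply: subD => //;
  [apply: NX|apply: LX].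
Qed.

Lemma addmS N N' L L' : N `<=` N' -> L `<=` L' -> N :+ L `<=` N' :+ L'.
Proof.
by move=> NN LL _ [u [v [Nu Lv ->]]]; exists u, v; split=> //;
  [apply: NN|apply: LL].
Qed.

Lemma addmP N L u v : N u -> L v -> (N :+ L) (u + v).
Proof. by move=> Nu Lv; exists u, v. Qed.

Lemma addmA N L X : (N :+ L) :+ X = N :+ (L :+ X).
Proof.
apply/seteqP; split=> w [u [v [H1 H2 ->]]].
  case: H1 => u1 [u2 [N1 L2 ->]]; exists u1, (u2 + v).
  by rewrite addrA; split=> //; exists u2, v.
case: H2 => v1 [v2 [L1 X2 ->]]; exists (u + v1), v2.
by rewrite addrA; split=> //; exists u, v1.
Qed.

Lemma addmC N L : N :+ L = L :+ N.
Proof.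
by apply/seteqP; split=> w [u [v [H1 H2 ->]]]; exists v, u; rewrite addrC.
Qed.

Lemma addm_id N L : submod N -> L `<=` N -> submod L -> N :+ L = N.
Proof.
move=> sN LN sL; apply/seteqP; split; first exact: addm_sub.
exact: addml.
Qed.

Lemma addm0 N : N :+ [set 0] = N.
Proof.
apply/seteqP; split=> [w [u [v [Nu -> ->]]]|w Nw]; first by rewrite addr0.
by exists w, 0; rewrite addr0.
Qed.

Lemma add0m N : [set 0] :+ N = N.
Proof. by rewrite addmC addm0. Qed.

(** ** Spans *)

Lemma sub_span S : S `<=` span S.
Proof. exact: sub_gen_smallest. Qed.

Lemma span_sub S N : submod N -> S `<=` N -> span S `<=` N.
Proof. by move=> sN SN; apply: smallest_sub. Qed.

Lemma spanS S S' : S `<=` S' -> span S `<=` span S'.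
Proof.
by move=> SS; apply: span_sub; [exact: submod_span|apply:
  subset_trans SS (@sub_span _)].
Qed.

Lemma span_nil : span [set` ([::] : seq V)] = [set 0].
Proof.
apply/seteqP; split; first by apply: span_sub => //; exact: submod_set0.
by move=> _ ->; apply: sub0; exact: submod_span.
Qed.

Lemma span_cat (s t : seq V) :
  span [set` s ++ t] = span [set` s] :+ span [set` t].
Proof.
have sp := @submod_span A V.
apply/seteqP; split.
  apply: span_sub; first exact: submod_addm.
  move=> v /=; rewrite mem_cat => /orP[vs|vt].
    by apply: addml => //; apply: sub_span.
  by apply: addmr => //; apply: sub_span.
apply: addm_sub; first exact: sp.
  by apply: spanS => v /= vs; rewrite mem_cat vs.
by apply: spanS => v /= vs; rewrite mem_cat vs orbT.
Qed.

Lemma span_seq1 v : span [set` [:: v]] = [set w | exists a, w = a *: v].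
Proof.
apply/seteqP; split=> [|_ [a ->]].
  apply: span_sub => [|w /=]; last first.
    by rewrite inE => /eqP ->; exists 1; rewrite scale1r.
  split=> [|b _ _ [a ->] [c ->]]; first by exists 0; rewrite scale0r.
  by exists (b * a + c); rewrite scalerDl scalerA.
by apply: (subZ _ (@submod_span _ _ _)); apply: sub_span; rewrite /= inE.
Qed.

Lemma span_cons v (s : seq V) w :
  span [set` v :: s] w <-> exists a u, span [set` s] u /\ w = a *: v + u.
Proof.
rewrite -cat1s span_cat span_seq1; split.
  by move=> [_ [u [[a ->] su ->]]]; exists a, u.
by move=> [a [u [su ->]]]; exists (a *: v), u; split=> //; exists a.
Qed.

(** ** Products of an ideal and a submodule *)

Variable I : set A.

Lemma submod_idmul N : submod (idmul I N).
Proof. exact: submod_span. Qed.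

Lemma idmulP N a v : I a -> N v -> idmul I N (a *: v).
Proof. by move=> Ia Nv; apply: sub_span; exists a, v. Qed.

Lemma idmul_sub N X : submod X ->
  (forall a v, I a -> N v -> X (a *: v)) -> idmul I N `<=` X.
Proof.
by move=> sX IX; apply: span_sub => // _ [a [v [Ia Nv ->]]]; apply: IX.
Qed.

Lemma idmulS N N' : N `<=` N' -> idmul I N `<=` idmul I N'.
Proof.
move=> NN; apply: idmul_sub; first exact: submod_idmul.
by move=> a v Ia Nv; apply: idmulP => //; apply: NN.
Qed.

Lemma idmul_id N : submod N -> idmul I N `<=` N.
Proof. by move=> sN; apply: idmul_sub => // a v _ Nv; apply: subZ. Qed.

Lemma idmul_addm N L : submod N -> submod L ->
  idmul I (N :+ L) = idmul I N :+ idmul I L.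
Proof.
move=> sN sL; have si := submod_idmul; apply/seteqP; split.
  apply: idmul_sub => [|a _ Ia [u [v [Nu Lv ->]]]]; first exact: submod_addm.
  by rewrite scalerDr; apply: addmP; apply: idmulP.
by apply: addm_sub => //; apply: idmulS; [exact: addml|exact: addmr].
Qed.

Lemma idmul_dilate a N : submod N ->
  idmul I (dilate a N) = dilate a (idmul I N).
Proof.
move=> sN; apply/seteqP; split.
  apply: idmul_sub => [|b _ Ib [v Nv ->]].
    by apply/submod_dilate/submod_idmul.
  by exists (b *: v); [exact: idmulP | rewrite !scalerA mulrC].
suff H : idmul I N `<=` [set v | idmul I (dilate a N) (a *: v)].
  by move=> _ [v /H Iv ->].
apply: idmul_sub => [|b v Ib Nv].
  exact/submod_colon/submod_idmul.
rewrite /= scalerA mulrC -scalerA.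
by apply: idmulP => //; exists v.
Qed.

Definition powm k N : set V := iter k (@idmul A V I) N.

Lemma submod_powm k N : submod N -> submod (powm k N).
Proof. by case: k => [//|k] _; exact: submod_idmul. Qed.

Lemma powm_dilate k a N : submod N -> powm k (dilate a N) = dilate a (powm k N).
Proof.
by move=> sN; elim: k => //= k ->; rewrite idmul_dilate //; exact: submod_powm.
Qed.

Lemma powmS k N N' : N `<=` N' -> powm k N `<=` powm k N'.
Proof. by move=> NN; elim: k => //= k IHk; exact: idmulS. Qed.

Lemma powm_decr k l N : submod N -> (k <= l)%N -> powm l N `<=` powm k N.
Proof.
move=> sN; elim: l => [|l IHl]; first by rewrite leqn0 => /eqP->.
rewrite leq_eqVlt => /orP[/eqP-> //|kl].
by apply: subset_trans (IHl kl); apply: idmul_id; exact: submod_powm.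
Qed.

Lemma powmE k : powm k setT = idpow V I k. Proof. by []. Qed.

Lemma idpow_decr k l : (k <= l)%N -> idpow V I l `<=` idpow V I k.
Proof. by rewrite -!powmE; exact: powm_decr. Qed.

End Submodules.

Notation "M :+ N" := (addm M N).

Section IdealGen.
Variables (A : comPzRingType) (V : lmodType A).
Implicit Types (N L X : set V) (s : seq A).

Lemma ideal_gen_mem s a : a \in s -> ideal_gen s a.
Proof. by move=> sa; apply: (@sub_span A A^o). Qed.

Lemma idmul_gen_sub s N X : submod N -> submod X ->
  (forall a v, a \in s -> N v -> X (a *: v)) -> idmul (ideal_gen s) N `<=` X.
Proof.
move=> sN sX sNX; apply: idmul_sub => // a v Ia Nv; move: a Ia.
apply: (@span_sub A A^o _ [set a | X (a *: v)]) => [|a sa]; last exact: sNX.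
split=> [|c a b Xa Xb]; first by rewrite /= scale0r; exact: sub0.
by rewrite /= scalerDl -scalerA; exact: sX.2.
Qed.

Lemma idmul_gen_nil N : submod N -> idmul (ideal_gen [::]) N = [set 0].
Proof.
move=> sN; apply/seteqP; split.
  by apply: idmul_gen_sub => //; exact: submod_set0.
by move=> _ ->; apply: sub0; exact: submod_idmul.
Qed.

Lemma idmul_gen_rcons s a N : submod N ->
  idmul (ideal_gen (rcons s a)) N = dilate a N :+ idmul (ideal_gen s) N.
Proof.
move=> sN; apply/seteqP; split.
  apply: idmul_gen_sub => //.
    by apply: submod_addm; [exact: submod_dilate | exact: submod_idmul].
  move=> b v; rewrite mem_rcons inE => /orP[/eqP->|bs] Nv.
    by apply: addml; [exact: submod_idmul | exists v].
  apply: addmr; first exact: submod_dilate.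
  by apply: idmulP => //; exact: ideal_gen_mem.
apply: addm_sub; first exact: submod_idmul.
  move=> _ [v Nv ->]; apply: idmulP => //; apply: ideal_gen_mem.
  by rewrite mem_rcons inE eqxx.
apply: idmul_gen_sub => //; first exact: submod_idmul.
move=> b v bs Nv; apply: idmulP => //; apply: ideal_gen_mem.
by rewrite mem_rcons inE bs orbT.
Qed.

End IdealGen.

(** * Chains and length *)

Section Chains.
Variables (T U : Type).
Implicit Types (C F : set (set T)) (D : set (set U)).

Lemma strict_chain_le C k n :
  (k <= n)%N -> strict_chain C n -> strict_chain C k.
Proof.
move=> kn [c [Cc lc]]; exists c; split=> i ik.
  by apply: Cc; apply: leq_trans kn.
by apply: lc; apply: leq_trans kn.
Qed.

Lemma chain_length_le C n k : chain_length C n -> strict_chain C k ->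
  (k <= n)%N.
Proof.
by move=> [_ nC] Ck; rewrite leqNgt; apply/negP => nk;
  apply/nC/(strict_chain_le nk).
Qed.

Lemma chain_length_uniq C n k : chain_length C n -> chain_length C k -> n = k.
Proof.
move=> Cn Ck; apply/eqP; rewrite eqn_leq (chain_length_le Ck Cn.1).
by rewrite (chain_length_le Cn Ck.1).
Qed.

Lemma strict_chain0 C X : C X -> strict_chain C 0.
Proof. by move=> CX; exists (fun=> X). Qed.

Lemma chain_length_ex C n : C !=set0 -> ~ strict_chain C n ->
  exists2 l, (l < n)%N & chain_length C l.
Proof.
move=> [X CX]; elim: n => [[]|n IHn nC]; first exact: strict_chain0 CX.
have [Cn|/IHn[l ln Cl]] := pselect (strict_chain C n); first by exists n.
by exists l => //; exact: ltnW.
Qed.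

Lemma strict_chain_map C D (f : set T -> set U) n :
  (forall X, C X -> D (f X)) ->
  (forall X Y, C X -> C Y -> X `<` Y -> f X `<` f Y) ->
  strict_chain C n -> strict_chain D n.
Proof.
move=> CD fS [c [Cc lc]]; exists (f \o c); split=> i ik /=.
  exact/CD/Cc.
by apply: fS; [apply/Cc/ltnW|exact: Cc|exact: lc].
Qed.

(** The strict steps are counted, and the other sets are discarded. *)
Lemma weak_chain C (c : nat -> set T) n :
  (forall i, (i <= n)%N -> C (c i)) ->
  (forall i, (i < n)%N -> c i `<=` c i.+1) ->
  strict_chain C (\sum_(i < n) (`[< c i `<` c i.+1 >] : nat)).
Proof.
move=> Cc lc.
suff: exists c', let k := (\sum_(i < n) (`[< c i `<` c i.+1 >] : nat))%N in
    [/\ forall i, (i <= k)%N -> C (c' i),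
        forall i, (i < k)%N -> c' i `<` c' i.+1 & c' k = c n].
  by move=> [c' [Cc' lc' _]]; exists c'.
elim: n Cc lc => [|n IHn] Cc lc.
  rewrite big_ord0; exists (fun=> c 0%N); split=> // i _; exact: Cc.
have [i ni|i ni|c' /= [Cc' lc' c'n]] := IHn.
- by apply: Cc; exact: leqW.
- by apply: lc; exact: leqW.
rewrite big_ord_recr /=; set k := (\sum_(i < n) _)%N in Cc' lc' c'n *.
have [sn|nsn] := asboolP (c n `<` c n.+1); last first.
  rewrite addn0; exists c'; split=> //.
  rewrite c'n; apply/seteqP; split; first exact: lc.
  by apply: contrapT => nn; apply: nsn; split => //; exact: lc.
rewrite addn1; exists (fun i => if (i <= k)%N then c' i else c n.+1); split.
- by move=> i _; case: leqP => [ik|_]; [exact: Cc' | exact: Cc].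
- move=> i; rewrite ltnS => ik; rewrite ik.
  case: (leqP i.+1 k) => [ki|ki]; first exact: lc'.
  by have -> : i = k; [apply/eqP; rewrite eqn_leq ik -ltnS | rewrite c'n].
by rewrite ltnn.
Qed.

(** The last set of a longest chain in $F$ is maximal, the first one minimal. *)
Lemma bounded_chain_extrema C F n : ~ strict_chain C n -> F `<=` C ->
    F !=set0 ->
  (exists2 X, F X & forall Y, F Y -> X `<=` Y -> Y `<=` X) /\
  (exists2 X, F X & forall Y, F Y -> Y `<=` X -> X `<=` Y).
Proof.
move=> nC FC F0.
have [|l _ [[c [Fc lc]] nF]] := @chain_length_ex F n F0.
  apply: contra_not nC => -[c [Fc lc]]; exists c; split=> // i /Fc; exact: FC.
split.
  exists (c l) => [|Y FY XY]; first exact: Fc.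
  apply: contrapT => YX; apply: nF.
  exists (fun i => if (i <= l)%N then c i else Y); split=> i; rewrite ?ltnS.
    by move=> _; case: leqP => [il|//]; exact: Fc.
  move=> il; rewrite il; case: (leqP i.+1 l) => [il1|li]; first exact: lc.
  by have -> : i = l; [apply/eqP; rewrite eqn_leq il -ltnS|].
exists (c 0%N) => [|Y FY YX]; first exact: Fc.
apply: contrapT => XY; apply: nF.
exists (fun i => if i is j.+1 then c j else Y); split=> [[|i]|[|i]] //.
- by rewrite ltnS => /Fc.
- by rewrite ltnS => /lc.
Qed.

End Chains.

Section Length.
Variables (A : comPzRingType) (V : lmodType A).
Implicit Types (N P L X Y : set V).

Local Notation between N' N :=
  [set L | [/\ submod L, N' `<=` L & L `<=` N]].

Lemma modular_law L X Y : submod L -> submod X -> submod Y ->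
  X `<=` Y -> Y `&` L `<=` X `&` L -> Y :+ L `<=` X :+ L -> Y `<=` X.
Proof.
move=> sL sX sY XY YLX YX y Yy.
have [x [l [Xx Ll yxl]]] : (X :+ L) y by apply: YX; apply: (addml sL).
have [Xl _] : (X `&` L) l.
  apply: YLX; split=> //; have -> : l = y - x by rewrite yxl addrC addKr.
  by apply: subB => //; exact: XY.
by rewrite yxl; exact: subD.
Qed.

(** For a chain between $N_0$ and $N_2$, intersect with $N_1$ and add $N_1$. By
    the modular law each strict step survives in one of the two chains. *)
Lemma has_length_add N0 N1 N2 a b : submod N0 -> submod N1 -> submod N2 ->
  N0 `<=` N1 -> N1 `<=` N2 ->
  has_length N1 N0 a -> has_length N2 N1 b -> has_length N2 N0 (a + b)%N.
Proof.
move=> sN0 sN1 sN2 N01 N12 l1 l2; split.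
  have [c [Cc lc]] := l1.1; have [e [Ce le]] := l2.1.
  exists (fun i => if (i <= a)%N then c i else e (i - a)%N); split=> i ik.
    case: leqP => ia.
      by have [? ? cN1] := Cc i ia; split=> //; exact: subset_trans N12.
    have [|? ? ?] := Ce (i - a)%N; first by rewrite leq_subLR.
    by split=> //; apply: subset_trans N01 _.
  have [ia|ai] := ltnP i a; first by rewrite (ltnW ia); exact: lc.
  move: ai; rewrite leq_eqVlt => /orP[/eqP ai|ai].
    subst i; rewrite leqnn subSnn.
    have b0 : (0 < b)%N by lia.
    have [_ N1e _] := Ce 0%N isT; have [_ _ cN1] := Cc a (leqnn a).
    (* The two chains are glued by dropping the first term of the second one,
       since it may coincide with the last term of the first one. *)
    have [e01 ne01] := le 0%N b0; split.
      by apply: subset_trans e01; exact: subset_trans N1e.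
    by move=> e1c; apply: ne01; apply: subset_trans N1e;
      apply: subset_trans cN1.
  rewrite [(i <= a)%N]leqNgt ai /= subSn; last exact: ltnW.
  by apply: le; lia.
move=> [c [Cc lc]].
pose c1 i := c i `&` N1; pose c2 i := c i :+ N1.
have w1 : strict_chain (between N0 N1)
    (\sum_(i < (a + b).+1) (`[< c1 i `<` c1 i.+1 >] : nat)).
  apply: weak_chain => i ik.
    have [sc Nc _] := Cc i ik; split; first exact: submod_setI.
      by move=> v Nv; split; [exact: Nc|exact: N01].
    by move=> v [].
  by apply: setSI; have [] := lc i ik.
have w2 : strict_chain (between N1 N2)
    (\sum_(i < (a + b).+1) (`[< c2 i `<` c2 i.+1 >] : nat)).
  apply: weak_chain => i ik.
    have [sc Nc cN] := Cc i ik; split; first exact: submod_addm.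
      exact: addmr.
    exact: addm_sub.
  by apply: addmS => //; have [] := lc i ik.
have := leq_add (chain_length_le l1 w1) (chain_length_le l2 w2).
rewrite -big_split /= leqNgt => /negP; apply.
rewrite -[X in (X <= _)%N]card_ord -sum1_card; apply: leq_sum => i _.
have [ci nci] := lc i (ltn_ord i).
have [sc _ _] := Cc i (ltnW (ltn_ord i)); have [sc' _ _] := Cc i.+1 (ltn_ord i).
have [//|n1] := asboolP (c1 i `<` c1 i.+1).
have [//|n2] := asboolP (c2 i `<` c2 i.+1).
exfalso; apply: nci; apply: (modular_law sN1) => //; apply: contrapT => n3.
  by apply: n1; split=> //; apply: setSI.
by apply: n2; split=> //; apply: addmS.
Qed.

Lemma has_length_split N0 N1 N2 l : submod N0 -> submod N1 -> submod N2 ->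
  N0 `<=` N1 -> N1 `<=` N2 -> has_length N2 N0 l ->
  exists a b, [/\ has_length N1 N0 a, has_length N2 N1 b & l = (a + b)%N].
Proof.
move=> sN0 sN1 sN2 N01 N12 [lc nl].
have [||a _ la] := @chain_length_ex _ (between N0 N1) l.+1.
- by exists N1; split.
- apply: contra_not nl; apply: (@strict_chain_map _ _ _ _ id) =>
  // L [sL NL LN].
  by split=> //; exact: subset_trans N12.
have [||b _ lb] := @chain_length_ex _ (between N1 N2) l.+1.
- by exists N2; split.
- apply: contra_not nl; apply: (@strict_chain_map _ _ _ _ id) =>
  // L [sL NL LN].
  by split=> //; exact: subset_trans NL.
exists a, b; split=> //.
have lab : has_length N2 N0 (a + b)%N by exact: (has_length_add sN0 sN1).
by apply: (chain_length_uniq (conj lc nl) lab).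
Qed.

(** The hypotheses say that multiplication by [y] induces an isomorphism from
    [N / N'] to [P / P']; all the isomorphisms that are needed below have this
    form, with [y] equal to 1 or to one of the $x_i$. *)
Lemma has_length_iso (y : A) N N' P P' l :
  submod N -> submod N' -> submod P -> submod P' -> P' `<=` P ->
  (forall v, N v -> P (y *: v)) ->
  (forall p, P p -> exists2 v, N v & P' (p - y *: v)) ->
  (forall v, N v -> (P' (y *: v) <-> N' v)) -> N' `<=` N ->
  has_length N N' l <-> has_length P P' l.
Proof.
move=> sN sN' sP sP' P'P NP PN NP' N'N.
pose f L := dilate y L :+ P'; pose g L := N `&` colon L y.
have fC L : between N' N L -> between P' P (f L).
  move=> [sL N'L LN]; have sd := submod_dilate y sL.
  split; [exact: submod_addm|exact: addmr|apply: addm_sub => // _ [v Lv ->]].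
  exact/NP/LN.
have gC L : between P' P L -> between N' N (g L).
  move=> [sL P'L LP]; split; first by apply: submod_setI => //;
    exact: submod_colon.
    by move=> v N'v; have Nv := N'N v N'v; split=> //; apply/P'L/NP'.
  by move=> v [].
suff NPchain n : strict_chain (between N' N) n <-> strict_chain (between P' P)
  n.
  by split=> -[lc nl]; split; rewrite ?NPchain // -NPchain.
split.
  apply: (strict_chain_map fC) => X Y CX CY [XY nYX]; split.
    by apply: addmS => // _ [v Xv ->]; exists v => //; exact: XY.
  move=> fYX; apply: nYX => v Yv.
  have [sX N'X XN] := CX; have [sY N'Y YN] := CY.
  have : f X (y *: v).
    by apply/fYX/addml => //; exists v.
  move=> [_ [p [[u Xu ->] P'p /eqP]]]; rewrite addrC -subr_eq -scalerBr =>
    /eqP E.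
  have N'vu : N' (v - u).
    by apply/NP'; rewrite ?E //; apply: subB => //; [exact: YN|exact: XN].
  by rewrite -(subrK u v); apply: subD => //; exact: N'X.
apply: (strict_chain_map gC) => X Y CX CY [XY nYX]; split=> [v [Nv Xv]|gYX].
  by split=> //; exact: XY.
apply: nYX => p Yp; have [sX P'X XP] := CX; have [sY P'Y YP] := CY.
have [v Nv P'pv] := PN p (YP p Yp).
have Yv : Y (y *: v).
  rewrite -(subKr p (y *: v)); apply: subB => //; exact: P'Y.
have [_ Xv] : g X v by apply: gYX.
by rewrite -(subrK (y *: v) p); apply: subD => //; exact: P'X.
Qed.

Lemma has_length0 N N' : submod N -> submod N' -> N' `<=` N ->
  has_length N N' 0 <-> N `<=` N'.
Proof.
move=> sN sN' N'N; split=> [[_ n1]|NN'].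
  apply: contrapT => nNN'; apply: n1.
  exists (fun i => if i is 0%N then N' else N); split=> [i _|[|[|i]]] //.
  by case: i => [|i]; split.
split; first by apply: (@strict_chain0 _ _ N); split.
move=> [c [Cc lc]]; have [_ nc] := lc 0%N isT; apply: nc.
have [_ _ cN] := Cc 1%N isT; have [_ Nc _] := Cc 0%N isT.
by apply: subset_trans cN _; apply: subset_trans NN' _.
Qed.

End Length.

(** * Noetherian modules *)

Definition noeth_module (A : comPzRingType) (V : lmodType A) : Prop :=
  forall N : set V, submod N -> exists s : seq V, N = span [set` s].

Section Noetherian.
Variables (A : comPzRingType) (V : lmodType A).
Implicit Types (N L X Y : set V).

(** Induction on the generators: the coefficients of the first generator $v$ in
    elements of $N$ form a finitely generated ideal. Lifts of its generators
    and generators of $N \cap A s$ generate $N$. *)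
Lemma noeth_span (hA : noetherian A) (s : seq V) N :
  submod N -> N `<=` span [set` s] -> exists t : seq V, N = span [set` t].
Proof.
elim: s N => [|v s IHs] N sN Ns.
  exists [::]; rewrite span_nil; apply/seteqP; split;
    first by rewrite -span_nil.
  by move=> _ ->; exact: sub0.
have sp := @submod_span A V.
pose I : set A^o := [set a : A | exists2 u, span [set` s] u & N (a *: v + u)].
have [l Il] : exists l : seq A, I = ideal_gen l.
  apply: hA; split=> [|c a b [u su Nu] [w sw Nw]].
    by exists 0; [exact: sub0 | rewrite scale0r addr0; exact: sub0].
  exists (c *: u + w); first exact: (sp _).2.
  suff -> : (c * a + b) *: v + (c *: u + w) = c *: (a *: v + u) + (b *: v + w).
    exact: sN.2.
  by rewrite scalerDl -scalerA scalerDr addrACA.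
have [g gP] : {g : A -> V & forall a, I a ->
  N (g a) /\ span [set` s] (g a - a *: v)}.
  apply: (choice (P := fun a (w : V) => I a ->
    N w /\ span [set` s] (w - a *: v))).
  move=> a; have [[u su Nu]|nI] := pselect (I a); last by exists 0.
  by exists (a *: v + u) => _; split=> //; rewrite addrC addKr.
have [t Nt] : exists t : seq V, N `&` span [set` s] = span [set` t].
  by apply: IHs => [|? []//]; exact: submod_setI.
exists (map g l ++ t); rewrite span_cat; apply/seteqP; split; last first.
  apply: addm_sub => //; last by rewrite -Nt => ? [].
  apply: span_sub => // _ /mapP[a la ->].
  by have [] : N (g a) /\ span [set` s] (g a - a *: v)
    by apply: gP; rewrite Il; exact: ideal_gen_mem.
move=> n Nn.
have [a [u [su nE]]] := (span_cons v s n).1 (Ns n Nn).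
have Ia : I a by exists u; rewrite -?nE.
have [w [lw sw]] : exists w, span [set` map g l] w /\ span [set` s] (w - a *:
  v).
  move: Ia; rewrite Il; apply: (@span_sub A A^o _ [set a : A | exists w,
     span [set` map g l] w /\ span [set` s] (w - a *: v)]).
    split=> [|c b b' [w [lw sw]] [w' [lw' sw']]].
      by exists 0; rewrite scale0r subr0; split; exact: sub0.
    exists (c *: w + w'); split; first exact: (sp _).2.
    suff -> : c *: w + w' - (c * b + b') *: v =
      c *: (w - b *: v) + (w' - b' *: v) by exact: (sp _).2.
    by rewrite scalerDl opprD addrACA scalerBr scalerA.
  move=> b lb; exists (g b); split.
    by apply: sub_span; apply/mapP; exists b.
  by have [] : N (g b) /\ span [set` s] (g b - b *: v)
    by apply: gP; rewrite Il; exact: ideal_gen_mem.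
rewrite -Nt -(subrK w n) addrC; apply: addmP => //; split.
  apply: (subB sN) => //; move: lw; apply: span_sub => // _ /mapP[b lb ->].
  by have [] : N (g b) /\ span [set` s] (g b - b *: v)
    by apply: gP; rewrite Il; exact: ideal_gen_mem.
have -> : n - w = u - (w - a *: v) by rewrite nE opprB addrA [u + _]addrC.
exact: (subB (sp _)).
Qed.

Lemma noeth_finite : noetherian A -> finite_module V -> noeth_module V.
Proof.
by move=> hA [s sT] N sN; apply: (noeth_span hA (s := s)) => //; rewrite sT.
Qed.

Hypothesis hV : noeth_module V.

(** A finite generating set of the union of a chain lies in one of its terms. *)
Lemma noeth_stationary (c : nat -> set V) :
  (forall n, submod (c n)) -> (forall n, c n `<=` c n.+1) ->
  exists n, forall k, c k `<=` c n.
Proof.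
move=> sc cS.
have cle k n : (k <= n)%N -> c k `<=` c n.
  elim: n => [|n IHn]; first by rewrite leqn0 => /eqP->.
  rewrite leq_eqVlt => /orP[/eqP->//|kn].
  by apply: subset_trans (cS n); exact: IHn.
have [s sU] : exists s : seq V, [set v | exists n, c n v] = span [set` s].
  apply: hV; split=> [|a u v [k ck] [n cn]]; first by exists 0%N; exact: sub0.
  exists (maxn k n); apply: (sc _).2; [apply: cle ck|apply: cle cn].
    exact: leq_maxl.
  exact: leq_maxr.
suff [n sn] : exists n, [set` s] `<=` c n.
  exists n => k v ck; apply: (span_sub (sc n) sn).
  by rewrite -sU; exists k.
have : {in s, forall v, exists n, c n v}.
  by move=> v vs; have : span [set` s] v by [exact: sub_span]; rewrite -sU.
elim: s {sU} => [|v s IHs] H; first by exists 0%N.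
have [|n sn] := IHs; first by move=> u us; apply: H; rewrite inE us orbT.
have [k ck] := H v (mem_head _ _).
exists (maxn k n) => u /=; rewrite inE => /orP[/eqP->|us].
  by apply: cle ck; exact: leq_maxl.
by apply: cle (sn _ us); exact: leq_maxr.
Qed.

Lemma noeth_max (F : set (set V)) : F `<=` @submod A V -> F !=set0 ->
  exists2 X, F X & forall Y, F Y -> X `<=` Y -> Y `<=` X.
Proof.
move=> Fs [X0 FX0]; apply: contrapT => nmax.
have [f fP] : {f : set V -> set V & forall X, F X -> F (f X) /\ X `<` f X}.
  apply: (choice (P := fun X Y => F X -> F Y /\ X `<` Y)) => X.
  have [FX|nF] := pselect (F X); last by exists X.
  apply: contrapT => nY; apply: nmax; exists X => // Y FY XY.
  by apply: contrapT => YX; apply: nY; exists Y.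
have Fc n : F (iter n f X0) by elim: n => //= n IHn; have [] := fP _ IHn.
have [n|n|n cn] := @noeth_stationary (fun n => iter n f X0).
- exact/Fs/Fc.
- by have [_ []] := fP _ (Fc n).
by have [_ [_]] := fP _ (Fc n); apply; exact: (cn n.+1).
Qed.

End Noetherian.

(** * Local rings and torsion with respect to the maximal ideal *)

Section Local.
Variables (A : comPzRingType) (m : set A).

(** Otherwise a maximal element among the proper ideals containing $b$ would be
    a maximal ideal, hence $m$. *)
Lemma local_unit : noetherian A -> local_ring m ->
  forall b, ~ m b -> exists c, c * b = 1.
Proof.
move=> hA [_ mu] b nmb; apply: contrapT => nb.
pose F := [set J : set A^o | [/\ submod J, ~ J 1 & J b]].
have [|||J [sJ J1 Jb] Jmax] := @noeth_max A A^o _ F; first exact: hA.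
- by move=> J [].
- exists [set a : A^o | exists c : A, a = c * b]; split=> /=.
  + split=> [|a _ _ [c ->] [c' ->]]; first by exists 0; rewrite mul0r.
    by exists (a * c + c'); rewrite mulrDl -mulrA.
  + by move=> [c cb]; apply: nb; exists c.
  + by exists 1; rewrite mul1r.
apply: nmb; rewrite -(mu J) //; split=> // K sK K1 JK.
apply/seteqP; split=> //; apply: Jmax => //; split=> //; exact: JK.
Qed.

Hypothesis mI : ideal m.
Hypothesis m1 : ~ m 1.
Hypothesis munit : forall b, ~ m b -> exists c, c * b = 1.

Lemma local_1sub a : m a -> exists c, c * (1 - a) = 1.
Proof.
move=> ma; apply: munit => m1a; apply: m1.
by rewrite -(subrK a 1); apply: (@subD A A^o).
Qed.

Variable V : lmodType A.
Implicit Types (N L X Y : set V).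

(** [mcolon t X] is $X :_V m^t$, so that [sat X / X] is $H^0_m(V / X)$.
    Iterating the colon by $m$ avoids computations with products of elements of
    $m$. *)
Definition mcolon t X : set V :=
  iter t (fun Y => [set v | forall a, m a -> Y (a *: v)]) X.

Definition sat X : set V := [set v | exists t, mcolon t X v].

Lemma submod_mcolon t X : submod X -> submod (mcolon t X).
Proof.
move=> sX; elim: t => //= t IHt; split=> [a _|a u v Hu Hv b mb].
  by rewrite scaler0; exact: sub0.
rewrite scalerDr scalerA mulrC -scalerA.
by apply: IHt.2; [exact: Hu|exact: Hv].
Qed.

Lemma mcolonS t X Y : X `<=` Y -> mcolon t X `<=` mcolon t Y.
Proof. by move=> XY; elim: t => //= t IHt v Xv a ma; apply/IHt/Xv. Qed.

Lemma mcolonD s t X : mcolon (s + t) X = mcolon s (mcolon t X).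
Proof. exact: iterD. Qed.

Lemma sub_mcolon t X : submod X -> X `<=` mcolon t X.
Proof.
move=> sX; elim: t => //= t IHt v Xv a ma; apply: subZ;
  first exact: submod_mcolon.
exact: IHt.
Qed.

Lemma mcolon_le s t X : submod X -> (s <= t)%N -> mcolon s X `<=` mcolon t X.
Proof.
move=> sX st; rewrite -(subnK st) mcolonD.
by apply: sub_mcolon; exact: submod_mcolon.
Qed.

Lemma mcolon_colon t X y : mcolon t (colon X y) = colon (mcolon t X) y.
Proof.
elim: t => //= t ->; apply/seteqP; split=> v H a ma; have := H a ma;
  rewrite /colon/=.
  by rewrite !scalerA mulrC.
by rewrite !scalerA mulrC.
Qed.

Lemma mcolonP t X v : submod X ->
  mcolon t X v <-> forall a, idpow A^o m t a -> X (a *: v).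
Proof.
move=> sX; elim: t v => [|t IHt] v.
  by split=> [Xv a _|/(_ 1 I)]; [exact: subZ | rewrite scale1r].
have sXv : submod ([set a : A | X (a *: v)] : set A^o).
  split=> [|c a b Xa Xb]; first by rewrite /= scale0r; exact: sub0.
  by rewrite /= scalerDl -scalerA; exact: sX.2.
split=> [H a|H a ma].
  apply: (@idmul_sub A A^o m _ [set a | X (a *: v)]) => // b c mb tc.
  rewrite /= [b *: c]mulrC -scalerA.
  by apply: (IHt (b *: v)).1 => //; exact: H.
apply/IHt => b tb; rewrite scalerA mulrC; apply: H.
exact: (@idmulP A A^o).
Qed.

Lemma mcolon_powm t X N : submod X ->
  N `<=` mcolon t X <-> powm m t N `<=` X.
Proof.
elim: t X => [//|t IHt] X sX.
rewrite /mcolon iterSr; have := IHt _ (submod_mcolon 1 sX).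
rewrite /mcolon /= => ->; split=> H.
  by apply: idmul_sub => // a v ma Nv; exact: H.
by move=> v Nv a ma; apply: H; exact: idmulP.
Qed.

Lemma sub_sat X : X `<=` sat X.
Proof. by move=> v Xv; exists 0%N. Qed.

Lemma satS X Y : X `<=` Y -> sat X `<=` sat Y.
Proof. by move=> XY v [t Xv]; exists t; apply: mcolonS Xv. Qed.

Lemma submod_sat X : submod X -> submod (sat X).
Proof.
move=> sX; split=> [|a u v [s Xu] [t Xv]]; first by apply: sub_sat; exact: sub0.
exists (maxn s t); apply: (submod_mcolon _ sX).2.
  by apply: mcolon_le Xu => //; exact: leq_maxl.
by apply: mcolon_le Xv => //; exact: leq_maxr.
Qed.

Lemma sat_mcolon t X Y : Y `<=` mcolon t X -> sat Y `<=` sat X.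
Proof.
by move=> YX v [s Yv]; exists (s + t)%N; rewrite mcolonD; apply: mcolonS Yv.
Qed.

Lemma sat_colon X y v : sat X (y *: v) -> sat (colon X y) v.
Proof. by move=> [t Xv]; exists t; rewrite mcolon_colon. Qed.

Lemma sat_uniform X : noeth_module V -> submod X ->
  exists t, sat X `<=` mcolon t X.
Proof.
move=> hV sX.
have [|n|n Hn] := @noeth_stationary A V hV (fun t => mcolon t X).
- by move=> t; exact: submod_mcolon.
- exact: mcolon_le.
by exists n => v [t]; exact: Hn.
Qed.

(** ** Finite length *)

(** The quotient is a vector space of dimension at most one over $A / m$. *)
Lemma has_length_cyclic C v : submod C -> mcolon 1 C v ->
  exists l, has_length (C :+ span [set` [:: v]]) C l.
Proof.
move=> sC Cv; have sS := @submod_span A V [set` [:: v]].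
have [||l _ Hl] := @chain_length_ex _
   [set L | [/\ submod L, C `<=` L & L `<=` C :+ span [set` [:: v]]]] 2.
- by exists C; split=> //; exact: addml.
- move=> [c [Cc lc]]; have [c01 nc01] := lc 0%N isT;
  have [c12 nc12] := lc 1%N isT.
  have [_ Cc0 _] := Cc 0%N isT; have [sc1 Cc1 c1C] := Cc 1%N isT.
  have [_ _ c2C] := Cc 2%N isT.
  apply: nc12; apply: subset_trans c2C _.
  suff c1v : c 1%N v.
    apply: addm_sub => //; apply: span_sub => // w /=.
    by rewrite inE => /eqP->.
  apply: contrapT => nc1v; apply: nc01 => w c1w.
  have [u [x [Cu]]] := c1C w c1w.
  rewrite span_seq1 => -[a ->] wE.
  have [ma|/munit[b ba]] := pselect (m a).
    rewrite wE; apply: Cc0; apply: subD => //; exact: Cv.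
  exfalso; apply: nc1v.
  have -> : v = b *: (w - u) by rewrite wE addrC addKr scalerA ba scale1r.
  by apply: subZ => //; apply: subB => //; exact: Cc1.
by exists l.
Qed.

Lemma has_length_span C (s : seq V) : submod C ->
  (forall v, v \in s -> mcolon 1 C v) ->
  exists l, has_length (C :+ span [set` s]) C l.
Proof.
move=> sC; have sp := @submod_span A V.
elim: s => [|v s IHs] Cs.
  by rewrite span_nil addm0; exists 0%N; apply/has_length0.
have [|a la] := IHs; first by move=> u us; apply: Cs; rewrite inE us orbT.
have sCs : submod (C :+ span [set` s]) by exact: submod_addm.
have [|b lb] := @has_length_cyclic (C :+ span [set` s]) v sCs.
  by apply: mcolonS (Cs v (mem_head _ _)); exact: addml.
exists (a + b)%N; rewrite -cat1s span_cat [span _ :+ _]addmC -addmA.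
apply: (has_length_add _ sCs) => //; first exact: submod_addm.
  exact: addml.
exact: addml.
Qed.

(** The layers of the filtration by $N \cap (N' : m^k)$ are finitely generated
    and killed by $m$. *)
Lemma has_length_mcolon N N' t : noeth_module V -> submod N -> submod N' ->
  N' `<=` N -> N `<=` mcolon t N' -> exists l, has_length N N' l.
Proof.
move=> hV sN sN' N'N Nt.
suff H k : exists l, has_length (N `&` mcolon k N') N' l.
  by have [l] := H t; have -> : N `&` mcolon t N' = N;
    [apply/seteqP; split=> [v []|v Nv] //; split=> //; exact: Nt | exists l].
elim: k => [|k [a la]].
  exists 0%N; apply/has_length0 => //; first exact: submod_setI.
  by move=> v /= N'v; split=> //; exact: N'N.
have sk j : submod (N `&` mcolon j N').
  by apply: submod_setI => //; exact: submod_mcolon.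
have [s sE] := hV _ (sk k.+1).
have [|b lb] := @has_length_span (N `&` mcolon k N') s (sk k).
  move=> v vs; have : span [set` s] v by exact: sub_span.
  rewrite -sE => -[Nv kv] c mc; split; [exact: subZ|exact: kv].
have sub : N `&` mcolon k N' `<=` N `&` mcolon k.+1 N'.
  by apply: setIS; exact: mcolon_le.
exists (a + b)%N; apply: (has_length_add sN' (sk k)) => //.
  move=> v N'v; split; [exact: N'N|exact: sub_mcolon].
by move: lb; rewrite -sE addmC addm_id.
Qed.

(** If $a v \notin N'$ for some $a \in m$, then simplicity gives
    $v \in N' + A a v$, so $(1 - b a) v \in N'$ with $1 - b a$ invertible. *)
Lemma has_length1_mcolon N N' : submod N -> submod N' -> N' `<=` N ->
  has_length N N' 1 -> N `<=` mcolon 1 N'.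
Proof.
move=> sN sN' N'N l1 v Nv a ma; apply: contrapT => nav.
have sS := @submod_span A V [set` [:: a *: v]].
have av : span [set` [:: a *: v]] (a *: v) by apply: sub_span; rewrite /= inE.
have [w [x [N'w]]] : (N' :+ span [set` [:: a *: v]]) v.
  apply: contrapT => nX; apply: l1.2.
  exists (fun i => if i is i'.+1 then if i' is 0%N then N' :+ span [set` [::
    a *: v]] else N
                   else N').
  have XN : N' :+ span [set` [:: a *: v]] `<=` N.
    apply: addm_sub => //; apply: span_sub => // u /=; rewrite inE => /eqP->.
    exact: subZ.
  split=> [[|[|i]] _|[|[|i]] // _].
  - by split.
  - by split=> //; [exact: submod_addm|exact: addml].
  - by split.
  - split; first exact: addml.
    by move=> H; apply/nav/H/addmr.
  - by split=> // H; apply/nX/H.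
rewrite span_seq1 => -[b ->] vE; apply: nav.
have [|c c1] := local_1sub (a := b * a).
  exact: (@subZ A A^o).
have N'v : N' v.
  rewrite -[v]scale1r -c1 -scalerA scalerBl scale1r -scalerA.
  by rewrite {1}vE addrK; exact: subZ.
exact: subZ.
Qed.

(** Each simple layer of a composition series is killed by $m$. *)
Lemma has_length_nilp N N' l : submod N -> submod N' -> N' `<=` N ->
  has_length N N' l -> N `<=` mcolon l N'.
Proof.
move=> sN sN'; elim: l N sN => [|l IHl] N sN N'N.
  by move/has_length0; apply.
move=> Nl; have [c [Cc lc]] := Nl.1.
have [sY N'Y YN] := Cc l (leqnSn l); have [cY ncY] := lc l (ltnSn l).
have [_ _ cN] := Cc l.+1 (leqnn _).
have [a [b [la lb E]]] := has_length_split sN' sY sN N'Y YN Nl.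
have la1 : (l <= a)%N.
  apply: (chain_length_le la); exists c; split=> i il; last by apply: lc;
    exact: leqW.
  have [sc Nc _] := Cc i (leqW il); split=> //.
  have : forall k, (i + k <= l)%N -> c i `<=` c (i + k)%N.
    elim=> [|k IHk] kl; first by rewrite addn0.
    apply: subset_trans (IHk _) _; first by lia.
    by have [|] := lc (i + k)%N; [lia | rewrite addnS].
  by move/(_ (l - i)%N); rewrite subnKC //; apply.
have b1 : b = 1%N.
  suff : (b != 0)%N by lia.
  apply/eqP => b0; move: lb; rewrite b0 => /(has_length0 sN sY YN) NY.
  by apply: ncY; apply: subset_trans cN NY.
have al : a = l by lia.
rewrite al in la; rewrite b1 in lb.
have := has_length1_mcolon sN sY YN lb.
rewrite /= => H v Nv d md; apply: (IHl _ sY) => //; exact: H.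
Qed.

End Local.

(** * $d$-sequences *)

Section DSequence.
Variables (A : comPzRingType) (V : lmodType A) (s : seq A).

Local Notation r := (size s).
Local Notation I := (ideal_gen s).
Local Notation E := (idpow V I).
Local Notation Q i := (seqmul V (take i s)).

Lemma submod_seqmul (t : seq A) : submod (seqmul V t).
Proof. exact: submod_idmul. Qed.

Lemma seqmul_take0 : Q 0%N = [set 0].
Proof. by rewrite take0; apply: idmul_gen_nil; exact: submodT. Qed.

Lemma seqmul_takeS i : (i < r)%N -> Q i.+1 = dilate s`_i setT :+ Q i.
Proof.
move=> ir; rewrite (take_nth 0) //; apply: idmul_gen_rcons; exact: submodT.
Qed.

Lemma seqmul_take_size : Q r = E 1%N.
Proof. by rewrite take_size. Qed.

Lemma seqmul_take_le i j : (i <= j)%N -> Q i `<=` Q j.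
Proof.
move=> ij; apply: idmul_gen_sub => //; first exact: submod_seqmul.
move=> a v ai _; apply: idmulP => //; apply: ideal_gen_mem.
by rewrite -(subnKC ij) takeD mem_cat ai.
Qed.

Hypothesis hs : d_sequence V s.

Lemma dseq_colon i j v : (i <= j < r)%N -> Q i (s`_i *: v) -> Q i (s`_j *: v).
Proof.
move=> ij Qv; have : colon (Q i) s`_j v; last by [].
rewrite -(hs ij) /colon/= mulrC -scalerA.
exact: (subZ _ (submod_seqmul _)).
Qed.

Lemma dseq_colon_sq i v :
  (i < r)%N -> Q i (s`_i *: (s`_i *: v)) -> Q i (s`_i *: v).
Proof.
move=> ir; rewrite scalerA => Qv; have : colon (Q i) s`_i v; last by [].
by rewrite -(hs (j := i)) ?leqnn.
Qed.

(** Huneke's key property: reducing an element of $IM$ one generator at a time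
    never leaves $(x_1, \dots, x_i) M : x_{i+1}$. *)
Lemma dseq_colon_meet i v : (i < r)%N -> Q i (s`_i *: v) -> E 1 v -> Q i v.
Proof.
move=> ir Qiv; rewrite -seqmul_take_size -(subnKC (ltnW ir)).
have : (i + (r - i) <= r)%N by rewrite subnKC // ltnW.
elim: (r - i)%N => [|k IHk] kr; first by rewrite addn0.
rewrite addnS seqmul_takeS -?addnS // => -[_ [q [[w _ ->] Qq vE]]].
apply: IHk; first by lia.
have sQ := submod_seqmul (take (i + k) s).
rewrite vE; apply: (subD sQ) => //; apply: dseq_colon_sq; first by lia.
have -> : s`_(i + k) *: w = v - q by rewrite vE addrK.
rewrite scalerBr; apply: (subB sQ) => //; last exact: (subZ _ sQ).
apply: (seqmul_take_le (leq_addr k i)); apply: dseq_colon => //.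
by rewrite leq_addr; lia.
Qed.

(** Write $v$ in terms of the first $i + 1$ generators, by induction downwards
    on $i$. The coefficient of the last one lies in $Q_i$ by [dseq_colon_meet],
    so the induction on $k$ applies to it. *)
Lemma dseq_artin_rees i k v : (i <= r)%N -> E k.+1 v -> Q i v ->
  idmul (ideal_gen (take i s)) (E k) v.
Proof.
move=> ir; rewrite -(subKn ir); move: (r - i)%N (leq_subr i r) => l lr.
elim: l k v lr => [|l IHl] k v lr.
  by rewrite subn0 take_size.
have {}IHl k' v' : E k'.+1 v' -> Q (r - l) v' ->
    idmul (ideal_gen (take (r - l) s)) (E k') v' by apply: IHl; exact: ltnW.
have rlE : (r - l)%N = (r - l.+1).+1 by lia.
have ir' : (r - l.+1 < r)%N by lia.
move: (r - l.+1)%N ir' rlE => {}i {}ir rlE; rewrite rlE in IHl.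
elim: k v => [//|k IHk] v Ev Qv.
have := IHl k.+1 v Ev (seqmul_take_le (leqnSn i) Qv).
have sE := @submod_idpow A I V.
rewrite (take_nth 0) // idmul_gen_rcons // => -[_ [b [[a Ea ->] Hb vE]]].
have Qb : Q i b by move: Hb; apply: idmulS.
have Qa : Q i a.
  apply: dseq_colon_meet => //; last by apply: idpow_decr Ea.
  have -> : s`_i *: a = v - b by rewrite vE addrK.
  exact: (subB (submod_seqmul _)).
rewrite vE; apply: (subD (@submod_idmul _ _ _ _)) => //.
have : dilate s`_i (idmul (ideal_gen (take i s)) (E k)) (s`_i *: a).
  by exists a => //; exact: IHk.
rewrite -idmul_dilate //; apply: idmulS => _ [w Ew ->].
by apply: idmulP => //; apply: ideal_gen_mem; exact: mem_nth.
Qed.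

Lemma dseq_artin_rees1 i k v : (i < r)%N -> E k.+1 v -> Q i.+1 v ->
  (dilate s`_i (E k) :+ Q i) v.
Proof.
move=> ir Ev Qv; have := dseq_artin_rees ir Ev Qv.
rewrite (take_nth 0) // idmul_gen_rcons; last exact: submod_idpow.
by apply: addmS => //; exact: idmulS.
Qed.

End DSequence.

(** * The length of the torsion of the associated graded modules *)

Section GradedTorsion.
Variables (A : comPzRingType) (m : set A) (V : lmodType A) (s : seq A).
Hypothesis hs : d_sequence V s.

Local Notation r := (size s).
Local Notation I := (ideal_gen s).
Local Notation E := (idpow V I).
Local Notation Q i := (seqmul V (take i s)).
Local Notation U i := (colon (Q i) s`_i).
Local Notation sat := (sat m).
Local Notation mcolon := (mcolon m).

Hypothesis hU : forall i, (i < r)%N -> exists t, U i `<=` mcolon t (Q i).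

Let sE k : submod (E k). Proof. exact: submod_idpow. Qed.
Let sQ i : submod (Q i). Proof. exact: submod_seqmul. Qed.
Let sU i : submod (U i). Proof. exact: submod_colon. Qed.
Let sT0 : submod (sat (E 1)). Proof. exact: submod_sat. Qed.

(** [grT i k / grB i k] is the degree [k] component of
    $H^0_m(\mathrm{gr}_I(M / (x_1, \dots, x_i) M))$. *)
Definition grB i k : set V := E k.+1 :+ Q i.
Definition grT i k : set V := (E k :+ Q i) `&` sat (grB i k).

Lemma submod_grB i k : submod (grB i k).
Proof. exact: submod_addm. Qed.

Lemma submod_grT i k : submod (grT i k).
Proof.
by apply: submod_setI; [exact: submod_addm|apply: submod_sat;
  exact: submod_grB].
Qed.

Lemma grB_sub i k : grB i k `<=` grT i k.
Proof.
move=> v Bv; split; last exact: sub_sat.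
by move: Bv; apply: addmS => //; exact: idpow_decr.
Qed.

Lemma idmul_idpow a k v : I a -> E k v -> E k.+1 (a *: v).
Proof. exact: idmulP. Qed.

Lemma gen_idpow i k v : (i < r)%N -> E k v -> E k.+1 (s`_i *: v).
Proof.
by move=> ir; apply: idmul_idpow; apply: ideal_gen_mem; exact: mem_nth.
Qed.

Lemma seqmul_take_sub i : (i <= r)%N -> Q i `<=` E 1.
Proof. by move=> ir; rewrite -seqmul_take_size; exact: seqmul_take_le. Qed.

Lemma grB0 i : (i <= r)%N -> grB i 0 = E 1.
Proof. by move=> ir; apply: addm_id => //; exact: seqmul_take_sub. Qed.

Lemma grT0 i : (i <= r)%N -> grT i 0 = sat (E 1).
Proof.
move=> ir; rewrite /grT grB0 //; apply/seteqP; split=> [v []|v Tv] //.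
by split=> //; exact: addml.
Qed.

Lemma grT_size k : grT r k.+1 `<=` grB r k.+1.
Proof.
move=> v [+ _]; apply: addm_sub; first exact: submod_grB.
  apply: subset_trans (addmr (sE _)); rewrite seqmul_take_size.
  exact: idpow_decr.
exact: addmr.
Qed.

Lemma colon_sub_grT0 i : (i < r)%N -> U i `<=` grT i 0.
Proof.
move=> ir v Uv; split; first exact: addml.
have [t Ut] := hU ir; exists t.
by apply: mcolonS (Ut v Uv); exact: addmr.
Qed.

(** In words of graded modules: $x_{i+1}$ acts injectively on
    $\mathrm{gr}_I(M / Q_i)$ up to the classes of $Q_i : x_{i+1}$. *)
Lemma colon_grB i k v : (i < r)%N ->
  grB i k.+1 (s`_i *: v) -> (E k.+1 :+ U i) v.
Proof.
move=> ir [e [q [Ee Qq vE]]].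
have Qe : Q i.+1 e.
  have -> : e = s`_i *: v + - q by rewrite vE addrK.
  rewrite seqmul_takeS //; apply: addmP; first by exists v.
  exact: (subN (sQ _)).
have [_ [q' [[e' Ee' ->] Qq' eE]]] := dseq_artin_rees1 hs ir Ee Qe.
exists e', (v - e'); split=> //; last by rewrite addrC subrK.
rewrite /colon/= scalerBr vE eE -(addrA _ q') addrC addrK.
exact: (subD (sQ _)).
Qed.

Lemma grT_pullback i k v : (i < r)%N ->
  sat (grB i k.+1) (s`_i *: v) -> sat (grB i k) v.
Proof.
move=> ir /sat_colon; have [t Ut] := hU ir.
apply: (@sat_mcolon _ _ _ t) => w /colon_grB -/(_ ir).
apply: addm_sub; first by apply: submod_mcolon; exact: submod_grB.
  apply: (subset_trans _ (@sub_mcolon _ m _ t _ (submod_grB i k))).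
  exact: addml.
by apply: subset_trans Ut _; apply: mcolonS; exact: addmr.
Qed.

(** The torsion in the image of multiplication by $x_{i+1}$ is the image of the
    torsion, because the kernel of the multiplication is itself torsion. *)
Lemma grT_decompose i k v : (i < r)%N -> grT i k.+1 v -> Q i.+1 v ->
  (dilate s`_i (grT i k) :+ grB i k.+1) v.
Proof.
move=> ir [[e [q [Ee Qq vE]]] satv] Qv.
have Qe : Q i.+1 e.
  have -> : e = v - q by rewrite vE addrK.
  by apply: (subB (sQ _)) => //; apply: seqmul_take_le Qq.
have [_ [q' [[e' Ee' ->] Qq' eE]]] := dseq_artin_rees1 hs ir Ee Qe.
have Bqq : grB i k.+1 (q' + q) by apply: addmr => //; exact: (subD (sQ _)).
exists (s`_i *: e'), (q' + q); split=> //; last by rewrite vE eE addrA.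
exists e' => //; split; first exact: addml.
apply: grT_pullback => //.
have -> : s`_i *: e' = v - (q' + q) by rewrite vE eE -(addrA (_ *: _)) addrK.
have sS := submod_sat m (submod_grB i k.+1).
by apply: (subB sS) => //; exact: sub_sat.
Qed.

Lemma dilate_grT i k v : (i < r)%N -> grT i k v -> grT i k.+1 (s`_i *: v).
Proof.
move=> ir [[e [q [Ee Qq ->]]] [t Bv]]; split.
  by rewrite scalerDr; apply: addmP; [exact: gen_idpow | exact:
    (subZ _ (sQ _))].
exists t; have : mcolon t (colon (grB i k.+1) s`_i) (e + q).
  apply: mcolonS Bv => _ [e' [q' [Ee' Qq' ->]]].
  rewrite /colon/= scalerDr.
  by apply: addmP; [exact: gen_idpow | exact: (subZ _ (sQ _))].
by rewrite mcolon_colon.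
Qed.

(** ** The torsion is generated in degree zero *)

Local Notation F k := (powm I k (sat (E 1))).

Lemma gen_torsion_sub k : F k `<=` E k `&` sat (E k.+1).
Proof.
elim: k => [v Fv //|k IHk]; apply: idmul_sub => [|a v Ia /IHk[Ev [t Etv]]].
  by apply: submod_setI => //; exact: submod_sat.
split; first exact: idmul_idpow.
exists t; have : mcolon t (colon (E k.+2) a) v.
  by apply: mcolonS Etv => w Ew; exact: idmul_idpow.
by rewrite mcolon_colon.
Qed.

Lemma gen_torsion_sub_grT i k : F k `<=` grT i k.
Proof.
move=> v /gen_torsion_sub[Ev satv]; split; first exact: addml.
by apply: satS satv; exact: addml.
Qed.

(** The induction runs downwards on [i], where $M / (x_1, \dots, x_r) M$ is the
    trivial case, and upwards on [k]: an element of [grT i k.+1] is, modulo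
    $x_{i+1}$, generated by the induction on [i], and the multiple of $x_{i+1}$
    that remains has its cofactor in [grT i k]. *)
Lemma grT_generated i k : (i <= r)%N -> grT i k `<=` F k :+ grB i k.
Proof.
move=> ir; rewrite -(subKn ir); move: (r - i)%N (leq_subr i r) => l lr.
elim: l k lr => [|l IHl] k lr.
  rewrite subn0; case: k => [|k].
    by rewrite grT0 //; apply: addml; exact: submod_grB.
  apply: subset_trans (@grT_size _) _; apply: addmr.
  exact: (submod_powm I k.+1 sT0).
have {}IHl k' := IHl k' (ltnW lr).
have rlE : (r - l)%N = (r - l.+1).+1 by lia.
have ir' : (r - l.+1 < r)%N by lia.
move: (r - l.+1)%N ir' rlE => {}i {}ir rlE; rewrite rlE in IHl.
have sF j : submod (F j) := submod_powm I j sT0.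
elim: k => [|k IHk].
  by rewrite grT0 ?(ltnW ir) //; apply: addml; exact: submod_grB.
move=> v Tv; have [Ev satv] := Tv.
have Tv' : grT i.+1 k.+1 v.
  have BB : grB i k.+1 `<=` grB i.+1 k.+1.
    by apply: addmS => //; exact: seqmul_take_le.
  split; last exact: satS satv.
  by apply: addmS Ev => //; exact: seqmul_take_le.
have [f [_ [Ff [e [q [Ee Qq ->]]] vE]]] := IHl _ _ Tv'.
have sT := submod_grT i k.+1.
have Tq : grT i k.+1 q.
  have -> : q = v - f - e by rewrite vE [f + _]addrC addrK [e + q]addrC addrK.
  apply: (subB sT); first apply: (subB sT) => //.
    exact: gen_torsion_sub_grT.
  by apply: grB_sub; exact: addml.
have [_ [b [[w Tw ->] Bb qE]]] := grT_decompose ir Tq Qq.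
have [f' [b' [Ff' Bb' wE]]] := IHk _ Tw.
exists (f + s`_i *: f'), (s`_i *: b' + b + e); split.
- apply: (subD (sF _)) => //; apply: idmulP => //.
  by apply: ideal_gen_mem; exact: mem_nth.
- have sB := submod_grB i k.+1.
  apply: (subD sB); last exact: addml.
  apply: (subD sB) => //.
  case: Bb' => e' [q' [Ee' Qq' ->]]; rewrite scalerDr.
  by apply: addmP; [exact: gen_idpow | exact: (subZ _ (sQ _))].
- rewrite vE qE wE scalerDr -!addrA; congr (_ + _).
  by rewrite [e + _]addrC -!addrA.
Qed.

(** Lifting torsion is possible because it is generated by $H^0_m(M / IM)$,
    which does not depend on $i$; this makes $H^0_m$ right exact here. *)
Lemma grT_surj i k : (i < r)%N -> grT i.+1 k `<=` grT i k :+ Q i.+1.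
Proof.
move=> ir; apply: subset_trans (grT_generated ir) _.
rewrite /grB -addmA; apply: addmS => //.
apply: addm_sub; first exact: submod_grT.
  exact: gen_torsion_sub_grT.
by apply: subset_trans (@grB_sub _ _); exact: addml.
Qed.

Lemma grT_le i k : grT i k `<=` grT i.+1 k.
Proof.
have QQ : Q i `<=` Q i.+1 by exact: seqmul_take_le.
by move=> v [Ev satv]; split; [apply: addmS Ev|apply: satS satv; exact: addmS].
Qed.

(** ** The recursion for the lengths *)

(** Multiplication by $x_{i+1}$ from degree $k$ to degree $k + 1$ of the torsion
    has the torsion for $i + 1$ as cokernel. *)
Lemma length_gr_step i k a b : (i < r)%N ->
  has_length (grT i.+1 k.+1) (grB i.+1 k.+1) b ->
  has_length (grT i k) (grT i k `&` colon (grB i k.+1) s`_i) a ->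
  has_length (grT i k.+1) (grB i k.+1) (a + b)%N.
Proof.
move=> ir lb la.
have sT := submod_grT; have sB := submod_grB.
have sd := submod_dilate s`_i (sT i k).
have sN : submod (dilate s`_i (grT i k) :+ grB i k.+1) by exact: submod_addm.
have NT : dilate s`_i (grT i k) :+ grB i k.+1 `<=` grT i k.+1.
  apply: addm_sub => //; last exact: grB_sub.
  by move=> _ [v Tv ->]; exact: dilate_grT.
have BN : grB i k.+1 `<=` dilate s`_i (grT i k) :+ grB i k.+1 by exact: addmr.
apply: (has_length_add (sB _ _) sN (sT _ _)) => //.
  apply: (@has_length_iso _ _ s`_i _ _ _ _ _ _ _ _ _ _ _ _ _ _).1 la => //.
  - by apply: submod_setI => //; exact: submod_colon.
  - by move=> v Tv; apply: addml => //; exists v.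
  - move=> _ [_ [b' [[v Tv ->] Bb' ->]]]; exists v => //.
    by rewrite addrC addKr.
  - by move=> v Tv; split=> [//|[]].
apply: (@has_length_iso _ _ 1 _ _ _ _ _ _ _ _ _ _ _ _ _ _).2 lb => //.
- exact: grB_sub.
- by move=> v Tv; rewrite scale1r; exact: grT_le.
- move=> p /(grT_surj ir)[v [q [Tv Qq ->]]]; exists v => //.
  by rewrite scale1r addrC addKr; exact: addmr.
- move=> v Tv; rewrite scale1r; split=> [[e [q [Ee Qq vE]]]|].
    have : (dilate s`_i (grT i k) :+ grB i k.+1) q.
      apply: grT_decompose => //.
      have -> : q = v - e by rewrite vE addrC addKr.
      by apply: (subB (sT _ _)) => //; apply: grB_sub; exact: addml.
    move=> Nq; rewrite vE; apply: (subD sN) => //; apply: BN; exact: addml.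
  move: v {Tv}; apply: addm_sub => //; last first.
    by apply: addmS => //; exact: seqmul_take_le.
  move=> _ [v _ ->]; apply: addmr => //.
  by rewrite seqmul_takeS //; apply: addml => //; exists v.
Qed.

(** In positive degree the multiplication by $x_{i+1}$ is injective, by
    [dseq_colon_meet]. *)
Lemma grT_colonS i k : (i < r)%N ->
  grT i k.+1 `&` colon (grB i k.+2) s`_i = grB i k.+1.
Proof.
move=> ir; apply/seteqP; split=> [v [Tv /(colon_grB ir)[e [u [Ee Uu vE]]]]|].
  exists e, u; split=> //; apply: (dseq_colon_meet hs) => //.
  have -> : u = v - e by rewrite vE addrC addKr.
  apply: (subB (sE _)); last by apply: idpow_decr Ee.
  have [] := Tv; move=> + _; apply: addm_sub => //; first exact: idpow_decr.
  by apply: seqmul_take_sub; exact: ltnW.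
move=> v Bv; split; first exact: grB_sub.
case: Bv => e [q [Ee Qq ->]]; rewrite /colon/= scalerDr.
by apply: addmP; [exact: gen_idpow | exact: (subZ _ (sQ _))].
Qed.

Lemma grT_colon0 i : (i < r)%N ->
  grT i 0 `&` colon (grB i 1) s`_i = E 1 :+ U i.
Proof.
move=> ir; apply/seteqP; split=> [v [_ /(colon_grB ir)]//|].
apply: addm_sub.
- by apply: submod_setI; [exact: submod_grT|apply: submod_colon;
  exact: submod_grB].
- move=> v Ev; split; first by apply: grB_sub; exact: addml.
  by apply: addml => //; exact: gen_idpow.
- move=> v Uv; split; first exact: colon_sub_grT0.
  exact: addmr.
Qed.

Lemma length_colon0 i u : (i < r)%N -> has_length (U i) (Q i) u ->
  has_length (E 1 :+ U i) (E 1) u.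
Proof.
move=> ir; have QU : Q i `<=` U i by move=> v Qv; exact: (subZ _ (sQ _)).
apply: (@has_length_iso _ _ 1 _ _ _ _ _ _ _ _ _ _ _ _ _ _).1 => //.
- exact: submod_addm.
- exact: addml.
- by move=> v Uv; rewrite scale1r; exact: addmr.
- by move=> _ [e [v [Ee Uv ->]]]; exists v => //; rewrite scale1r addrK.
- move=> v Uv; rewrite scale1r; split=> [|Qv]; first exact: dseq_colon_meet.
  by apply: seqmul_take_sub Qv; exact: ltnW.
Qed.

Variables (u : nat -> nat) (c : nat).
Hypothesis hu : forall i, (i < r)%N -> has_length (U i) (Q i) (u i).
Hypothesis hc : has_length (sat (E 1)) (E 1) c.

Lemma length_gr_ex i : (i <= r)%N ->
  exists h : nat -> nat, forall k, has_length (grT i k) (grB i k) (h k).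
Proof.
move=> ir; rewrite -(subKn ir); move: (r - i)%N (leq_subr i r) => l lr.
have l0 j : (j <= r)%N -> has_length (grT j 0) (grB j 0) c.
  by move=> jr; rewrite grT0 // grB0.
elim: l lr => [|l IHl] lr.
  rewrite subn0; exists (fun k => if k is 0%N then c else 0%N) => -[|k].
    exact: l0.
  by apply/has_length0;
    [exact: submod_grT|exact: submod_grB|exact: grB_sub|exact: grT_size].
have {IHl} [h hP] := IHl (ltnW lr).
have rlE : (r - l)%N = (r - l.+1).+1 by lia.
have ir' : (r - l.+1 < r)%N by lia.
move: (r - l.+1)%N ir' rlE => {}i {}ir rlE; rewrite rlE in hP.
suff H k : exists a, has_length (grT i k) (grB i k) a.
  by have [g gP] := choice H; exists g.
have sB := submod_grB; have sT := submod_grT.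
case: k => [|k]; first by exists c; apply: l0; exact: ltnW.
elim: k => [|k [a la]].
  have sUE : submod (E 1 :+ U i) by exact: submod_addm.
  have [||a [b [_ lb _]]] := has_length_split (sE 1) sUE sT0 _ _ hc.
  - exact: addml.
  - apply: addm_sub => //; first exact: sub_sat.
    by rewrite -(@grT0 i) ?(ltnW ir) //; exact: colon_sub_grT0.
  exists (b + h 1)%N; apply: length_gr_step => //.
  by rewrite grT_colon0 // grT0 // ltnW.
exists (a + h k.+2)%N; apply: length_gr_step => //.
by rewrite grT_colonS.
Qed.

Lemma length_gr_rec : exists h : nat -> nat -> nat,
  [/\ forall i k, (i <= r)%N -> has_length (grT i k) (grB i k) (h i k),
      forall i, (i <= r)%N -> h i 0%N = c,
      forall k, h r k.+1 = 0%N,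
      forall i, (i < r)%N -> (h i 1 + u i = h i.+1 1 + c)%N &
      forall i k, (i < r)%N -> (h i k.+2 = h i k.+1 + h i.+1 k.+2)%N].
Proof.
have [h hP] : {h : nat -> nat -> nat & forall i, (i <= r)%N -> forall k,
    has_length (grT i k) (grB i k) (h i k)}.
  apply: (choice (P := fun i (h : nat -> nat) => (i <= r)%N -> forall k,
    has_length (grT i k) (grB i k) (h k))) => i.
  have [ir|ri] := leqP i r; last by exists (fun=> 0%N).
  by have [h hP] := length_gr_ex ir; exists h.
exists h; split.
- by move=> i k /hP.
- move=> i ir; apply: (chain_length_uniq (hP i ir 0%N)).
  by rewrite grT0 // grB0.
- move=> k; apply: (chain_length_uniq (hP r (leqnn r) k.+1)).
  by apply/has_length0;
    [exact: submod_grT|exact: submod_grB|exact: grB_sub|exact: grT_size].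
- move=> i ir; have sUE : submod (E 1 :+ U i) by exact: submod_addm.
  have [||a [b [la lb cE]]] := has_length_split (sE 1) sUE sT0 _ _ hc.
  + exact: addml.
  + apply: addm_sub => //; first exact: sub_sat.
    by rewrite -(@grT0 i) ?(ltnW ir) //; exact: colon_sub_grT0.
  have ua := chain_length_uniq la (length_colon0 ir (hu ir)).
  have := @length_gr_step i 0 b _ ir (hP _ ir 1%N).
  rewrite grT_colon0 // grT0 ?(ltnW ir) // => /(_ lb).
  by move/(chain_length_uniq (hP i (ltnW ir) 1%N)) => ->; rewrite cE ua; lia.
- move=> i k ir; apply: (chain_length_uniq (hP i (ltnW ir) _)).
  apply: length_gr_step => //; first exact: hP.
  by rewrite grT_colonS //; apply: hP; exact: ltnW.
Qed.

End GradedTorsion.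

(** * The $j$-coefficients *)

Section Binomial.
Implicit Types (a : nat -> int) (n l r : nat).

Let bin_diag n l : ('C(n.+1 + l.+1, l.+1) = 'C(n + l.+1, l.+1) + 'C(n.+1 + l,
  l))%N.
Proof. by rewrite addSn binS addSnnS. Qed.

(** Taking differences in $n$ lowers the index $l$ by one. *)
Lemma binomial_basis_free a r n0 :
  (forall n, (n0 <= n)%N -> \sum_(l < r.+1) a l * 'C(n + l, l)%:Z = 0) ->
  forall l, (l <= r)%N -> a l = 0.
Proof.
elim: r a n0 => [|r IHr] a n0 H l lr.
  have := H n0 (leqnn _); rewrite big_ord1 addn0 bin0 mulr1.
  by move: lr; rewrite leqn0 => /eqP->.
have aS k : (k <= r)%N -> a k.+1 = 0.
  apply: (IHr (fun k => a k.+1) n0.+1) => -[//|n] n0n.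
  have := etrans (H n.+1 (leqW n0n)) (esym (H n n0n)).
  rewrite big_ord_recl [X in _ = X -> _]big_ord_recl /= !bin0 => /addrI /eqP.
  rewrite -subr_eq0 -sumrB => /eqP E; rewrite -[RHS]E; apply: eq_bigr => i _.
  by rewrite /bump /= !add1n bin_diag PoszD mulrDr addrC addKr.
case: l lr => [_|l]; last by rewrite ltnS; exact: aS.
have := H n0 (leqnn _); rewrite big_ord_recl big1 => [|i _].
  by rewrite bin0 mulr1 addr0.
by rewrite lift0 aS ?mul0r // -ltnS.
Qed.

(** The recursion says that $h_i$ has the generating function
    $c (1 - z)^{-(r - i)} - \sum_{i \le j < r} u_j z (1 - z)^{-(j - i + 1)}$. *)
Lemma hilbert_sum (h : nat -> nat -> nat) (u : nat -> nat) (c r : nat) :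
  (forall i, (i <= r)%N -> h i 0%N = c) ->
  (forall k, h r k.+1 = 0%N) ->
  (forall i, (i < r)%N -> (h i 1 + u i = h i.+1 1 + c)%N) ->
  (forall i k, (i < r)%N -> (h i k.+2 = h i k.+1 + h i.+1 k.+2)%N) ->
  forall i n, (i <= r)%N -> (\sum_(k < n.+1) h i k)%N%:Z =
    c%:Z * 'C(n + (r - i), r - i)%:Z -
    \sum_(j < r - i) (u (i + j)%N)%:Z * 'C(n + j, j.+1)%:Z.
Proof.
move=> h0 hr h1 hS i n ir.
pose H i n : int := (\sum_(k < n.+1) h i k)%N%:Z.
have H0 j : (j <= r)%N -> H j 0%N = c by move=> jr; rewrite /H big_ord1 h0.
have HS j k : H j k.+1 = H j k + (h j k.+1)%:Z by rewrite /H big_ord_recr.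
have hH j k : (j < r)%N -> (h j k.+1)%:Z = H j.+1 k.+1 - (u j)%:Z.
  move=> jr; elim: k => [|k IHk].
    by rewrite HS H0 //; have := h1 j jr; lia.
  by rewrite HS hS // PoszD IHk; lia.
rewrite -/(H i n) -(subKn ir).
move: (r - i)%N (leq_subr i r) => l {i ir}; elim: l n => [|l IHl] n lr.
  rewrite subn0 subnn big_ord0 addn0 bin0 mulr1 subr0.
  by elim: n => [|n IHn]; [rewrite H0 | rewrite HS hr addr0].
have {}IHl n' := IHl n' (ltnW lr).
have rlE : (r - l)%N = (r - l.+1).+1 by lia.
have lE : (r - (r - l.+1))%N = l.+1 by lia.
have lE' : (r - (r - l))%N = l by lia.
rewrite lE; rewrite lE' rlE in IHl.
have ir : (r - l.+1 < r)%N by lia.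
move: (r - l.+1)%N ir IHl => i ir IHl {rlE lE lE'}.
elim: n => [|n IHn].
  rewrite H0 ?(ltnW ir) // add0n binn mulr1 big1 ?subr0 // => j _.
  by rewrite add0n bin_small ?mulr0.
rewrite HS hH // IHl IHn bin_diag.
rewrite [X in _ = _ - X]big_ord_recl [X in _ - X + _]big_ord_recl /= !addn0
  !bin1.
have -> : \sum_(j < l) (u (i + bump 0 j)%N)%:Z * 'C(n.+1 + bump 0 j,
  (bump 0 j).+1)%:Z =
   \sum_(j < l) (u (i + bump 0 j)%N)%:Z * 'C(n + bump 0 j, (bump 0 j).+1)%:Z +
   \sum_(j < l) (u (i.+1 + j)%N)%:Z * 'C(n.+1 + j, j.+1)%:Z.
  rewrite -big_split /=; apply: eq_bigr => j _.
  by rewrite /bump /= add1n addSn binS PoszD mulrDr !addSnnS.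
rewrite PoszD [n.+1%:Z]intS; ring.
Qed.

(** The coefficient of $\binom{n + l}{l}$ in the sum of the lengths; see
    [torsion_coefE]. *)
Definition torsion_coef (u : nat -> nat) (c r l : nat) : int :=
  (if l == r then c else u l)%:Z - (if l is l'.+1 then u l' else 0%N)%:Z.

Lemma torsion_coefE (u : nat -> nat) (c r n : nat) :
  c%:Z * 'C(n + r, r)%:Z - \sum_(j < r) (u j)%:Z * 'C(n + j, j.+1)%:Z =
  \sum_(l < r.+1) torsion_coef u c r l * 'C(n + l, l)%:Z.
Proof.
under [RHS]eq_bigr do rewrite /torsion_coef mulrBl.
rewrite sumrB big_ord_recr [X in _ = _ - X]big_ord_recl /= eqxx mul0r add0r.
have -> : \sum_(i < r) (if i == r :> nat then c else u i)%:Z * 'C(n + i, i)%:Z =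
    \sum_(i < r) (u i)%:Z * 'C(n + i, i)%:Z.
  by apply: eq_bigr => j _; rewrite ltn_eqF.
have -> : \sum_(i < r) (u (0 + i)%N)%:Z * 'C(n + bump 0 i, bump 0 i)%:Z =
   \sum_(i < r) (u i)%:Z * 'C(n + i, i.+1)%:Z + \sum_(i < r) (u i)%:Z * 'C(n +
     i, i)%:Z.
  rewrite -big_split /=; apply: eq_bigr => j _.
  by rewrite /bump /= add1n addnS binS PoszD mulrDr.
by ring.
Qed.

End Binomial.

Section JCoef.
Variables (A : comPzRingType) (m : set A) (V : lmodType A) (s : seq A).
Hypothesis hs : d_sequence V s.

Local Notation r := (size s).
Local Notation I := (ideal_gen s).
Local Notation E := (idpow V I).
Local Notation Q i := (seqmul V (take i s)).
Local Notation U i := (colon (Q i) s`_i).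

Hypothesis hU : forall i, (i < r)%N -> exists t, U i `<=` mcolon m t (Q i).

Lemma gr_torsionE k : gr_torsion m I k = grT m s 0 k :> set V.
Proof.
have sE := submod_idpow I V.
rewrite /gr_torsion /grT /grB seqmul_take0 !addm0.
apply/seteqP; split=> v [Ev [t Ht]]; split=> //; exists t.
  by apply/mcolonP.
by apply/mcolonP.
Qed.

Lemma idpow_grB k : E k.+1 = grB s 0 k.
Proof. by rewrite /grB seqmul_take0 addm0. Qed.

Lemma is_j_coefs_uniq j j' : is_j_coefs m V s j -> is_j_coefs m V s j' ->
  forall i, (i <= r)%N -> j i = j' i.
Proof.
move=> [h [hP [n0 Hn]]] [h' [hP' [n0' Hn']]] i ir.
have hh k : h k = h' k := chain_length_uniq (hP k) (hP' k).
pose a l := (-1) ^+ (r - l) * (j (r - l)%N - j' (r - l)%N).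
have a0 l : (l <= r)%N -> a l = 0.
  apply: (@binomial_basis_free a r (maxn n0 n0')) => n;
    rewrite geq_max => /andP[n1 n2].
  have := Hn' n n2; under eq_bigr do rewrite -hh.
  rewrite (Hn n n1) => /eqP; rewrite -subr_eq0 -sumrB => /eqP E.
  rewrite -[RHS]E (reindex_inj rev_ord_inj) /=; apply: eq_bigr => k _.
  have kr : (k <= r)%N by rewrite -ltnS.
  have -> : (r.+1 - k.+1 = r - k)%N by lia.
  rewrite /a subKn //.
  have -> : (n + (r - k) = n + r - k)%N by lia.
  by rewrite mulrBr mulrBl.
have := a0 (r - i)%N (leq_subr _ _); rewrite /a subKn // => /eqP.
by rewrite mulf_eq0 signr_eq0 /= subr_eq0 => /eqP.
Qed.

Variables (u : nat -> nat) (c : nat).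
Hypothesis hu : forall i, (i < r)%N -> has_length (U i) (Q i) (u i).
Hypothesis hc : has_length (sat m (E 1)) (E 1) c.

(** The recursion of [length_gr_rec] is solved by [hilbert_sum], and
    [torsion_coefE] rewrites the solution in the binomial basis. *)
Lemma is_j_coefs_torsion : is_j_coefs m V s
  (fun i => (-1) ^+ i * torsion_coef u c r (r - i)).
Proof.
have [h [hP h0 hr h1 hS]] := length_gr_rec hs hU hu hc.
exists (h 0%N); split=> [k|].
  by rewrite gr_torsionE idpow_grB; exact: hP.
exists 0%N => n _.
have := hilbert_sum h0 hr h1 hS n (leq0n r); rewrite subn0.
under [X in _ - X]eq_bigr do rewrite add0n.
rewrite torsion_coefE => ->; rewrite (reindex_inj rev_ord_inj) /=.
apply: eq_bigr => k _; have kr : (k <= r)%N by rewrite -ltnS.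
have -> : (r.+1 - k.+1 = r - k)%N by lia.
rewrite mulrA -signr_odd -expr2 sqrr_sign mul1r.
by have -> : (n + (r - k) = n + r - k)%N by lia.
Qed.

(** $- j_1$ is the coefficient of $\binom{n + r - 1}{r - 1}$, to which only the
    summands with $j = r - 2$ and $j = r - 1$ of [torsion_coefE] contribute. *)
Lemma j_coef1E : (2 <= r)%N -> j_coef m V s 1 = (u r.-2)%:Z - (u r.-1)%:Z.
Proof.
move=> r2; have jP := is_j_coefs_torsion.
rewrite /j_coef; case: xgetP => [j _ jP'|/(_ _ jP)//].
rewrite (is_j_coefs_uniq jP' jP); last by lia.
rewrite /torsion_coef expr1 mulN1r opprB.
have -> : (r - 1 == r)%N = false by apply/eqP; lia.
case: r r2 => [|[|r']] // _; rewrite subSS subn0.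
Qed.

End JCoef.

(** * Torsion of the colon modules of an amenable $d$-sequence *)

Lemma seqmul_sum (A : comPzRingType) (V : lmodType A) (s : seq A) v :
  seqmul V s v -> exists w : nat -> V, v = \sum_(j < size s) s`_j *: w j.
Proof.
apply: (@idmul_gen_sub _ _ s setT
  [set v | exists w : nat -> V, v = \sum_(j < size s) s`_j *: w j]) => //.
  split=> [|a _ _ [w ->] [w' ->]].
    by exists (fun=> 0); rewrite big1 // => j _; rewrite scaler0.
  exists (fun j => a *: w j + w' j); rewrite scaler_sumr -big_split /=.
  by apply: eq_bigr => j _; rewrite scalerDr !scalerA mulrC.
move=> a {}v as_ _; exists (fun j => if j == index a s then v else 0).
have ir : (index a s < size s)%N by rewrite index_mem.
rewrite (bigD1 (Ordinal ir)) //= eqxx nth_index // big1 ?addr0 // => j.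
by rewrite -val_eqE /= => /negPf ->; rewrite scaler0.
Qed.

Lemma subsum (A : comPzRingType) (V : lmodType A) (N : set V) (J : finType)
    (P : pred J) (F : J -> V) :
  submod N -> (forall j, P j -> N (F j)) -> N (\sum_(j | P j) F j).
Proof.
move=> sN NF; apply: (big_ind N) => //; first exact: sub0.
by move=> u v; exact: subD.
Qed.

Section Koszul.
Variables (A : comPzRingType) (V : lmodType A) (r : nat) (x : r.-tuple A).

Local Notation K := (koszul V r).
Local Notation diff := (@koszul_diff A V r x).

Lemma koszul_diffZD a (f g : K) : diff (a *: f + g) = a *: diff f + diff g.
Proof.
apply/ffunP => J; rewrite !ffunE scaler_sumr -big_split /=.
apply: eq_bigr => j _; rewrite !ffunE scalerDr !scalerA.
by rewrite [a * _]mulrC.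
Qed.

Lemma submod_koszul_chains i : submod (koszul_chains i : set K).
Proof.
split=> [J _|a f g cf cg J iJ]; first by rewrite ffunE.
by rewrite !ffunE cf // cg // scaler0 addr0.
Qed.

Lemma koszul_diff0 : diff 0 = 0.
Proof.
apply/ffunP => J; rewrite !ffunE big1 // => j _.
by rewrite ffunE scaler0.
Qed.

Lemma submod_koszul_cycles i : submod (koszul_cycles x i : set K).
Proof.
split=> [|a f g [cf df] [cg dg]].
  split; [exact: (submod_koszul_chains i).1|exact: koszul_diff0].
split; first exact: (submod_koszul_chains i).2.
by rewrite koszul_diffZD df dg scaler0 addr0.
Qed.

Lemma submod_koszul_boundaries i : submod (koszul_boundaries x i : set K).
Proof.
split=> [|a _ _ [f cf <-] [g cg <-]].
  by exists 0; [exact: (submod_koszul_chains i.+1).1|exact: koszul_diff0].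
exists (a *: f + g); first exact: (submod_koszul_chains i.+1).2.
exact: koszul_diffZD.
Qed.

Lemma koszul_boundary1 (g : K) (i : 'I_r) :
  koszul_boundaries x 1 g -> seqmul V x (g [set i]%SET).
Proof.
have sQ := @submod_idmul A V (ideal_gen x) setT.
move=> [h _ <-]; rewrite ffunE; apply: subsum => // j _.
rewrite -scalerA; apply: (subZ _ sQ); apply: idmulP => //; apply: ideal_gen_mem.
exact: mem_tnth.
Qed.

Definition koszul_1chain (c : 'I_r -> V) : K :=
  [ffun J : {set 'I_r} => \sum_(j | J == [set j]%SET) c j].

Lemma koszul_1chainE c j : koszul_1chain c [set j]%SET = c j.
Proof.
rewrite ffunE (big_pred1 j) // => k.
by apply/eqP/eqP => [/set1_inj|->].
Qed.

(** The differential of a 1-chain is concentrated at the empty set. *)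
Lemma koszul_1chain_cycle c : \sum_j tnth x j *: c j = 0 ->
  koszul_cycles x 1 (koszul_1chain c).
Proof.
move=> c0.
have ch : koszul_chains 1 (koszul_1chain c : K).
  move=> J J1; rewrite ffunE big_pred0 // => j.
  by apply/eqP => JE; apply: J1; rewrite JE cards1.
split=> //; apply/ffunP => J; rewrite ffunE [RHS]ffunE.
have [->|/set0Pn[k kJ]] := eqVneq J finset.set0.
  rewrite -[RHS]c0; apply: eq_big => [j|j _]; first by rewrite finset.in_set0.
  rewrite finset.setU0 koszul_1chainE.
  rewrite (_ : [set k in _ | _]%SET = finset.set0) ?cards0 ?expr0 ?mul1r //.
  by apply/finset.setP => k; rewrite !inE.
rewrite big1 // => j jJ; rewrite ch ?scaler0 // => E.
have := cards1P (introT eqP E) => -[l lE].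
have jl : j = l by apply/eqP; rewrite -finset.in_set1 -lE !inE eqxx.
have kl : k = l by apply/eqP; rewrite -finset.in_set1 -lE !inE kJ orbT.
by move: jJ; rewrite jl -kl kJ.
Qed.

(** A relation $x_{i+1} v \in (x_1, \dots, x_i) M$ is a Koszul 1-cycle, and
    a high power of $m$ maps it to boundaries. The entry $v$ is then mapped into
    $IM$, where [dseq_colon_meet] applies. *)
Lemma amenable_colon_torsion (m : set A) :
    ideal m -> ~ m 1 -> (forall b, ~ m b -> exists c, c * b = 1) ->
    d_sequence V x -> amenable V x ->
  forall i, (i < size x)%N -> exists t,
    colon (seqmul V (take i x)) x`_i `<=` mcolon m t (seqmul V (take i x)).
Proof.
move=> mI m1 munit hs /(_ 1%N isT)[t lt] i ir.
have BZ : koszul_boundaries x 1 `<=` (koszul_cycles x 1 : set K).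
  have [[c [Cc _]] _] := lt; have [_ BL LZ] := Cc 0%N isT.
  exact: subset_trans LZ.
have Zt := has_length_nilp mI m1 munit (submod_koszul_cycles 1)
  (submod_koszul_boundaries 1) BZ lt.
exists t => v Qv; have sQ := @submod_idmul A V (ideal_gen (take i x)) setT.
apply/mcolonP => // a ta.
have ir' : (i < r)%N by rewrite -(size_tuple x).
apply: (dseq_colon_meet hs) => //.
  by rewrite scalerA mulrC -scalerA; exact: (subZ _ sQ).
have [w wE] := seqmul_sum Qv.
rewrite size_take ir in wE.
pose c (j : 'I_r) := if j == i :> nat then v else if (j < i)%N then - w j else
  0.
have cyc : koszul_cycles x 1 (koszul_1chain c).
  apply: koszul_1chain_cycle.
  rewrite (bigD1 (Ordinal ir')) //= (tnth_nth 0) /c /= eqxx wE.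
  rewrite (big_ord_widen r (fun j => (take i x)`_j *: w j)) ?(ltnW ir') //.
  rewrite big_mkcond [X in _ + X]big_mkcond -big_split /= big1 // => j _.
  rewrite -val_eqE /= (tnth_nth 0); have [ji|ij|->] := ltngtP j i.
  - by rewrite nth_take // scalerN subrr.
  - by rewrite scaler0 addr0.
  - by rewrite addr0.
have /(mcolonP _ _ _ (submod_koszul_boundaries 1))/(_ a ta) := Zt _ cyc.
by move/(@koszul_boundary1 _ (Ordinal ir'));
  rewrite ffunE koszul_1chainE /c /= eqxx.
Qed.

End Koszul.

(** * Depth *)

Section Depth.
Variables (A : comPzRingType) (m : set A) (V : lmodType A).
Implicit Types (Q : set V) (f g : seq A -> V) (l : seq A) (z : A).

(** The coboundary $(df)(b_0, \dots, b_j) = \sum_i (-1)^i b_i f(b_0, \dots, \hat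
    b_i, \dots, b_j)$ on cochains of all degrees at once. For an element $z$ of
    $m$, inserting $z$ as the first argument is a homotopy from multiplication
    by $z$ to zero; the recursion below is that homotopy formula. *)
Fixpoint cobd f l : V :=
  if l is b :: l' then b *: f l' - cobd (fun t => f (b :: t)) l' else 0.

Lemma cobdB f g l : cobd (fun t => f t - g t) l = cobd f l - cobd g l.
Proof.
elim: l f g => [|b l IHl] f g /=; first by rewrite subr0.
rewrite scalerBr (IHl (fun t => f (b :: t)) (fun t => g (b :: t))).
by rewrite !opprB addrACA [RHS]addrACA; congr (_ + _); rewrite addrC.
Qed.

Lemma cobdZ a f l : cobd (fun t => a *: f t) l = a *: cobd f l.
Proof.
elim: l f => [|b l IHl] f /=; first by rewrite scaler0.
by rewrite (IHl (fun t => f (b :: t))) scalerBr !scalerA mulrC.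
Qed.

Lemma cobd_cobd f l : cobd (cobd f) l = 0.
Proof.
elim: l f => [//|b l IHl] f /=.
by rewrite (cobdB (fun t => b *: f t)) cobdZ IHl subr0 subrr.
Qed.

Definition mlist j l : Prop := size l = j /\ [set` l] `<=` m.

Lemma mlist_cons j b l : mlist j.+1 (b :: l) <-> m b /\ mlist j l.
Proof.
split=> [[[sl] lm]|[mb [sl lm]]]; split.
- by apply: lm; rewrite /= inE eqxx.
- by split=> // a al; apply: lm; rewrite /= inE al orbT.
- by rewrite /= sl.
- by move=> a /=; rewrite inE => /orP[/eqP->//|]; exact: lm.
Qed.

Lemma cobd_sub Q f j : submod Q -> (forall l, mlist j l -> Q (f l)) ->
  forall l, mlist j.+1 l -> Q (cobd f l).
Proof.
move=> sQ; elim: j f => [|j IHj] f Qf [|b l] [] //.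
  move=> [/size0nil->] _ /=; rewrite subr0; apply: (subZ _ sQ).
  by apply: Qf; split=> // a; rewrite /= in_nil.
move=> sl lm; have /mlist_cons[mb lj] : mlist j.+2 (b :: l) by split.
apply: (subB sQ); first by apply: (subZ _ sQ); exact: Qf.
by apply: (IHj (fun t => f (b :: t))) => // t tj; apply: Qf; apply/mlist_cons.
Qed.

(** Exactness in degree [j] of this complex with coefficients in $M / Q$. *)
Definition coh_vanish Q j : Prop := forall f,
  (forall l, mlist j.+1 l -> Q (cobd f l)) ->
  exists g, forall l, mlist j l -> Q (f l - cobd g l).

Lemma coh_vanish0 Q v : coh_vanish Q 0 -> mcolon m 1 Q v -> Q v.
Proof.
move=> vQ Qv; have [|g Hg] := vQ (fun=> v).
  move=> l; case: l => [|b [|b' l]] [] //= _ lm; rewrite subr0; apply: Qv.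
  by apply: lm; rewrite /= inE eqxx.
by have := Hg [::]; rewrite /= subr0; apply; split=> // a; rewrite /= in_nil.
Qed.

Lemma dilate_choice Q z (P : set (seq A)) f :
  (forall l, P l -> (dilate z setT :+ Q) (f l)) ->
  exists w : seq A -> V, forall l, P l -> Q (f l - z *: w l).
Proof.
move=> Pf.
have [l|w Hw] := @choice _ _ (fun l w => P l -> Q (f l - z *: w)).
  have [/Pf[_ [q [[w _ ->] Qq ->]]]|nP] := pselect (P l); last by exists 0.
  by exists w => _; rewrite addrC addKr.
by exists w.
Qed.

(** Let $f$ be a cocycle modulo $Q$. The homotopy $g_0 = f(z, -)$ satisfies
    $z f \equiv d g_0$, so $g_0$ is a cocycle modulo $zM + Q$, hence
    $g_0 \equiv d g_1 + z w$ modulo $Q$. Applying $d$ and cancelling $z$ gives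
    $f \equiv d w$. *)
Lemma coh_vanish_lift Q z e : submod Q -> m z ->
  (forall v, Q (z *: v) -> Q v) ->
  (forall j, (j < e)%N -> coh_vanish (dilate z setT :+ Q) j) ->
  forall j, (j < e.+1)%N -> coh_vanish Q j.
Proof.
move=> sQ mz zQ ve j; rewrite ltnS => je f Hf.
pose g0 t := f (z :: t).
have Qg0 l : mlist j l -> Q (z *: f l - cobd g0 l).
  by move=> lj; apply: (Hf (z :: l)); apply/mlist_cons.
case: j je Hf Qg0 => [|j] je Hf Qg0.
  exists (fun=> 0) => l; case: l => [|b l] [] //= _ lm; rewrite subr0;
    apply: zQ.
  by have := Qg0 [::]; rewrite /= subr0; apply.
have [|g1 Hg1] := ve j je g0.
  move=> l lj; have -> : cobd g0 l = z *: f l - (z *: f l - cobd g0 l).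
    by rewrite subKr.
  apply: addmP; first by exists (f l).
  exact/(subN sQ)/Qg0.
have [w Hw] := dilate_choice Hg1.
exists w => l lj; apply: zQ.
have := cobd_sub sQ Hw lj.
rewrite (cobdB (fun t => g0 t - cobd g1 t)) cobdB cobd_cobd subr0 cobdZ => H.
have -> : z *: (f l - cobd w l) =
  (z *: f l - cobd g0 l) + (cobd g0 l - z *: cobd w l).
  by rewrite scalerBr addrA subrK.
by apply: (subD sQ) => //; exact: Qg0.
Qed.

(** If $d f = z b$ modulo $Q$, then $b$ is a cocycle, $b = d b'$, and $f - z b'$
    is a cocycle modulo $Q$. *)
Lemma coh_vanish_quotient Q z e : submod Q -> m z ->
  (forall v, Q (z *: v) -> Q v) ->
  (forall j, (j < e.+1)%N -> coh_vanish Q j) ->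
  forall j, (j < e)%N -> coh_vanish (dilate z setT :+ Q) j.
Proof.
move=> sQ mz zQ ve j je f Hf.
have [b Hb] := dilate_choice Hf.
have Qb l : mlist j.+2 l -> Q (cobd b l).
  move=> lj; apply: zQ; have := cobd_sub sQ Hb lj.
  rewrite cobdB cobd_cobd cobdZ sub0r => H.
  by rewrite -[_ *: _]opprK; exact: (subN sQ).
have [b' Hb'] := ve j.+1 je b Qb.
have [|g Hg] := ve j (ltnW je) (fun t => f t - z *: b' t).
  move=> l lj; rewrite cobdB cobdZ.
  have -> : cobd f l - z *: cobd b' l =
    (cobd f l - z *: b l) + z *: (b l - cobd b' l).
    by rewrite scalerBr addrA subrK.
  by apply: (subD sQ); [exact: Hb|apply: (subZ _ sQ); exact: Hb'].
exists g => l lj.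
have -> : f l - cobd g l = z *: b' l + (f l - z *: b' l - cobd g l).
  by rewrite [RHS]addrC [RHS]addrAC subrK.
by apply: addmP; [exists (b' l)|exact: Hg].
Qed.

Lemma regular_coh_vanish (s : seq A) : [set` s] `<=` m -> regular_seq V s ->
  forall j, (j < size s)%N -> coh_vanish (seqmul V (take 0 s)) j.
Proof.
move=> sm [reg _]; rewrite -(subnn (size s)).
suff H (l : nat) : (l <= size s)%N -> forall j, (j < l)%N ->
    coh_vanish (seqmul V (take (size s - l) s)) j by exact: H.
elim: l => [//|l IHl] lr.
have {}IHl := IHl (ltnW lr).
have rlE : (size s - l)%N = (size s - l.+1).+1 by lia.
have ir' : (size s - l.+1 < size s)%N by lia.
rewrite rlE seqmul_takeS // in IHl.
apply: (coh_vanish_lift _ _ _ IHl); first exact: submod_seqmul.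
  by apply: sm; apply: mem_nth.
exact: reg.
Qed.

(** Passing to the quotient by $x_1, \dots, x_i$ consumes one degree at a time,
    and vanishing in degree zero excludes torsion. *)
Lemma depth_colon (z s : seq A) :
  [set` z] `<=` m -> regular_seq V z -> [set` s] `<=` m ->
  (forall i, (i < size s)%N -> exists t,
     colon (seqmul V (take i s)) s`_i `<=` mcolon m t (seqmul V (take i s))) ->
  forall i, (i < size z)%N -> (i < size s)%N ->
    colon (seqmul V (take i s)) s`_i `<=` seqmul V (take i s).
Proof.
move=> zm zreg sm hU.
have reg i : (i < size s)%N -> coh_vanish (seqmul V (take i s)) 0 ->
    colon (seqmul V (take i s)) s`_i `<=` seqmul V (take i s).
  move=> ir v0; have [t Ut] := hU i ir; apply: subset_trans Ut _.
  elim: t => [//|t IHt]; apply: subset_trans IHt => v.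
  rewrite -addn1 mcolonD; apply: mcolonS => w; exact: coh_vanish0.
suff van i : (i <= size z)%N -> (i <= size s)%N ->
    forall j, (j < size z - i)%N -> coh_vanish (seqmul V (take i s)) j.
  by move=> i iz ir; apply: reg => //; apply: van; rewrite ?subn_gt0 // ltnW.
elim: i => [|i IHi] iz ir.
  by rewrite subn0 seqmul_take0 -(seqmul_take0 V z); exact: regular_coh_vanish.
have {}IHi := IHi (ltnW iz) (ltnW ir).
rewrite seqmul_takeS //; apply: coh_vanish_quotient; first exact: submod_seqmul.
- by apply: sm; exact: mem_nth.
- by move=> v; apply: reg => //; apply: IHi; rewrite subn_gt0.
- by rewrite -subSn // subSS.
Qed.

End Depth.

(** * Topology of a Noetherian module *)

Section ArtinRees.
Variables (A : comPzRingType) (V : lmodType A).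
Implicit Types (N C X : set V) (a : A) (s : seq A) (v w : V).

(** Every monomial of degree $i + l$ is divisible by $a^i$ or has degree at
    least $l$ in the other variables. *)
Lemma idpow_gen_rcons s a i l :
  idpow V (ideal_gen (rcons s a)) (i + l) `<=`
  dilate (a ^+ i) setT :+ idpow V (ideal_gen s) l.
Proof.
have sd j : submod (dilate (a ^+ j) [set: V]) :=
  submod_dilate (a ^+ j) (@submodT A V).
have sI j := @submod_idpow A (ideal_gen s) V j.
have [n] := ubnP (i + l); elim: n i l => // n IHn [|i] [|l] il.
- by move=> v _; apply: addml => //; exists v => //; rewrite scale1r.
- by move=> v _; apply: addml => //; exists v => //; rewrite scale1r.
- by move=> v _; apply: addmr.
have ES j : idpow V (ideal_gen (rcons s a)) j.+1 =
    dilate a (idpow V (ideal_gen (rcons s a)) j) :+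
    idmul (ideal_gen s) (idpow V (ideal_gen (rcons s a)) j).
  by apply: idmul_gen_rcons; exact: submod_idpow.
rewrite addSn ES.
apply: addm_sub; first exact: submod_addm.
  have il' : (i + l.+1 < n)%N by lia.
  move=> _ [v /(IHn i l.+1 il') [_ [w [[p _ ->] Ew ->]]] ->].
  rewrite scalerDr scalerA -exprS; apply: addmP; first by exists p.
  exact: (subZ _ (sI _)).
rewrite addnS -addSn.
apply: subset_trans (idmulS (IHn i.+1 l _)) _; first by lia.
rewrite idmul_addm //; apply: addmS => //; exact: idmul_id.
Qed.

Lemma idpow_gen_sub s X : submod X ->
  (forall a, a \in s -> exists j, forall v : V, X (a ^+ j *: v)) ->
  exists n, idpow V (ideal_gen s) n `<=` X.
Proof.
move=> sX; elim/last_ind: s => [|s a IHs] H.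
  exists 1%N; rewrite /idpow /= idmul_gen_nil // => _ ->; exact: sub0.
have [|n sn] := IHs; first by move=> b bs; apply: H;
  rewrite mem_rcons inE bs orbT.
have [|j Xj] := H a; first by rewrite mem_rcons inE eqxx.
exists (j + n)%N; apply: subset_trans (@idpow_gen_rcons _ _ _ _) _.
by apply: addm_sub => // _ [v _ ->].
Qed.

Lemma powm_exp (I : set A) N a k v : I a -> N v -> powm I k N (a ^+ k *: v).
Proof.
move=> Ia Nv; elim: k => [|k IHk]; first by rewrite scale1r.
by rewrite exprS -scalerA; exact: idmulP.
Qed.

Hypothesis hA : noetherian A.
Hypothesis hV : noeth_module V.

(** Enlarge $C$ to a submodule $X$ maximal subject to $X \cap N \subseteq C$.
    For $a \in I$ the colons $X : a^j$ stabilize, so adding a high $a^n M$ to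
    $X$ preserves this condition; thus $X$ contains some $I^n M$. *)
Lemma artin_rees (I : set A) N C k : ideal I -> submod N -> submod C ->
  powm I k N `<=` C ->
  exists n, (C :+ idpow V I n) `&` N `<=` C.
Proof.
move=> sI sN sC NC.
pose F := [set X | [/\ submod X, C `<=` X & X `&` N `<=` C]].
have [||X [sX CX XN] Xmax] := noeth_max hV (F := F).
- by move=> X [].
- by exists C; split=> // v [].
have [s sE] := hA sI.
have [a sa|n EX] := @idpow_gen_sub s X sX.
  have Ia : I a by rewrite sE; exact: ideal_gen_mem.
  have [j|j|n Hn] := noeth_stationary hV (c := fun j => colon X (a ^+ j)).
  - exact: submod_colon.
  - by move=> v Xv; rewrite /colon/= exprS -scalerA; exact: (subZ _ sX).
  have sd := submod_dilate (a ^+ n) (@submodT A V).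
  exists n => v.
  have : (X :+ dilate (a ^+ n) setT) (a ^+ n *: v) by apply: addmr => //;
    exists v.
  apply: Xmax; last exact: addml.
  split; [exact: submod_addm|apply: subset_trans CX _; exact: addml|].
  move=> w [[q [_ [Xq [p _ ->] wE]]] Nw].
  apply: XN; split=> //; rewrite wE; apply: (subD sX) => //.
  (* Multiply by $a^k$: this maps $w \in N$ into $I^k N \subseteq C \subseteq
     X$, and $X : a^{k+n} = X : a^n$. *)
  apply: (Hn (k + n)%N); rewrite /colon/= exprD -scalerA.
  have -> : a ^+ n *: p = w - q by rewrite wE addrC addKr.
  rewrite scalerBr; apply: (subB sX); last exact: (subZ _ sX).
  by apply/CX/NC/powm_exp.
exists n => v [Hv Nv]; apply: XN; split=> //.
by apply: addm_sub Hv => //; rewrite sE.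
Qed.

Section Krull.
Variable m : set A.
Hypotheses (mI : ideal m) (m1 : ~ m 1).
Hypothesis munit : forall b, ~ m b -> exists c, c * b = 1.

(** [artin_rees] applied to $C = N + m (N + A v)$ gives $v \in N + m v$. *)
Lemma krull_intersection N v : submod N ->
  (forall n, (N :+ idpow V m n) v) -> N v.
Proof.
move=> sN Hv; have sv := @submod_span A V [set` [:: v]].
have sL : submod (N :+ span [set` [:: v]]) by exact: submod_addm.
have sC : submod (N :+ idmul m (N :+ span [set` [:: v]])).
  by apply: submod_addm => //; exact: submod_idmul.
have [n Hn] := @artin_rees m _ _ 1 mI sL sC (addmr sN).
have : (N :+ idmul m (N :+ span [set` [:: v]])) v.
  apply: Hn; split.
    apply: addmS (Hv n) => //; apply: addml; exact: submod_idmul.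
  apply: addmr => //; apply: sub_span; by rewrite /= inE.
have : N :+ idmul m (N :+ span [set` [:: v]]) `<=`
    N :+ [set w | exists2 a, m a & w = a *: v].
  rewrite idmul_addm // -addmA (addm_id sN (idmul_id sN));
    last exact: submod_idmul.
  apply: addmS => //; apply: idmul_sub.
    split=> [|c _ _ [a ma ->] [b mb ->]].
      by exists 0; [exact: (@sub0 A A^o)|rewrite scale0r].
    exists (c * a + b); last by rewrite scalerDl scalerA.
    by apply: (@subD A A^o) => //; exact: (@subZ A A^o).
  move=> b w mb; rewrite span_seq1 => -[c ->]; exists (c * b).
    exact: (@subZ A A^o).
  by rewrite scalerA mulrC.
move=> /[apply] -[w [_ [Nw [a ma ->] vE]]].
have [b b1] := local_1sub mI m1 munit ma.
rewrite -[v]scale1r -b1 -scalerA scalerBl scale1r {1}vE addrK.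
exact: (subZ _ sN).
Qed.

(** [artin_rees] for $yM$, with $m^k (yM) = y m^k M$. *)
Lemma regular_idpow y k : (forall v : V, y *: v = 0 -> v = 0) ->
  exists n, forall v : V, idpow V m n (y *: v) -> idpow V m k v.
Proof.
move=> yreg; have sT := @submodT A V.
have sk := submod_idpow m V k.
have [|n Hn] := @artin_rees m _ _ k mI (submod_dilate y sT) (submod_dilate y
  sk).
  by rewrite powm_dilate.
exists n => v nv; have [|w kw /eqP] := Hn (y *: v).
  split; last by exists v.
  by apply: addmr => //; exact: submod_dilate.
by rewrite -subr_eq0 -scalerBr => /eqP/yreg/eqP; rewrite subr_eq0 => /eqP->.
Qed.

End Krull.

End ArtinRees.

(** * Associated primes of dimension one *)

Section Ideals.
Variable A : comPzRingType.
Implicit Types (J P : set A) (a b c d : A).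

Definition principal b : set A := [set a | exists c, a = c * b].

Lemma ideal_principal b : ideal (principal b).
Proof.
split=> [|c _ _ [d ->] [d' ->]]; first by exists 0; rewrite mul0r.
exists (c * d + d'); suff -> : (c * d + d') * b = c * (d * b) + d' * b by [].
by rewrite mulrDl mulrA.
Qed.

Lemma principal_sub J b : ideal J -> J b -> principal b `<=` J.
Proof. by move=> sJ Jb _ [c ->]; exact: (@subZ A A^o). Qed.

Lemma idealMl J a b : ideal J -> J b -> J (a * b).
Proof. by move=> sJ Jb; exact: (@subZ A A^o). Qed.

Lemma idealD J a b : ideal J -> J a -> J b -> J (a + b).
Proof. exact: (@subD A A^o). Qed.

Lemma idealB J a b : ideal J -> J a -> J b -> J (a - b).
Proof. exact: (@subB A A^o). Qed.

Lemma ideal_congrM J a b c d : ideal J -> J (a - b) -> J (c - d) ->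
  J (a * c - b * d).
Proof.
move=> sJ Jab Jcd.
have -> : a * c - b * d = a * (c - d) + d * (a - b).
  by rewrite !mulrBr addrA [d * a]mulrC subrK [d * b]mulrC.
by apply: idealD => //; exact: idealMl.
Qed.

Lemma ideal_congrX J a b n : ideal J -> J (a - b) -> J (a ^+ n - b ^+ n).
Proof.
move=> sJ Jab; elim: n => [|n IHn]; first by rewrite subrr;
  exact: (@sub0 A A^o).
by rewrite !exprS; exact: ideal_congrM.
Qed.

Lemma prime_exp P a n : prime_ideal P -> P (a ^+ n) -> P a.
Proof.
move=> [sP P1 Pm]; elim: n => [//|n IHn]; rewrite exprS => /Pm[//|]; exact: IHn.
Qed.

End Ideals.

Section DeterminantTrick.
Variables (A : comPzRingType) (V : lmodType A) (J : set A) (C : set V).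
Hypotheses (sJ : ideal J) (sC : submod C).

Lemma idmul_span_cons g (gs : seq V) w : idmul J (span [set` g :: gs]) w ->
  exists e h, [/\ J e, idmul J (span [set` gs]) h & w = e *: g + h].
Proof.
have si := @submod_idmul A V J (span [set` gs]).
apply: (@idmul_sub A V J _ [set w | exists e h,
    [/\ J e, idmul J (span [set` gs]) h & w = e *: g + h]]).
  split=> [|c _ _ [e [h [Je Jh ->]]] [e' [h' [Je' Jh' ->]]]].
    exists 0, 0; split; [exact: (@sub0 A A^o)|exact: sub0|].
    by rewrite scale0r addr0.
  exists (c * e + e'), (c *: h + h'); split; [exact: sJ.2|exact: si.2|].
  by rewrite scalerDr scalerDl -scalerA addrACA.
move=> a v Ja /span_cons[c [u [gu ->]]]; exists (c * a), (a *: u); split.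
- exact: idealMl.
- exact: idmulP.
- by rewrite scalerDr scalerA mulrC.
Qed.

(** The generators are eliminated one at a time: $s g \equiv e g$ modulo the
    other generators, with $e \in J$, so that $(s - e) s$ satisfies the
    hypothesis for these. The usual proof takes the determinant of the matrix of
    $s$. *)
Lemma determinant_trick (gs : seq V) s :
  (forall g, g \in gs -> (idmul J (span [set` gs]) :+ C) (s *: g)) ->
  exists p n, J (p - s ^+ n) /\ forall v, span [set` gs] v -> C (p *: v).
Proof.
elim: gs s => [|g gs IHgs] s H.
  exists 1, 0%N; rewrite subrr; split; first exact: (@sub0 A A^o).
  by move=> v; rewrite span_nil => ->; rewrite scaler0; exact: sub0.
have sI := @submod_idmul A V J (span [set` gs]).
have sIC : submod (idmul J (span [set` gs]) :+ C) by exact: submod_addm.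
have [_ [c [/idmul_span_cons[e [h [Je Jh ->]]] Cc gE]]] := H g (mem_head _ _).
have gE' : (s - e) *: g = h + c by rewrite scalerBl gE -(addrA (e *:
  g)) addrC addrK.
have [|p [n [Jp Hp]]] := IHgs ((s - e) * s).
  move=> g' gg'.
  have [|_ [c' [/idmul_span_cons[e' [h' [Je' Jh' ->]]] Cc' g'E]]] := H g'.
    by rewrite inE gg' orbT.
  rewrite -scalerA g'E -addrA scalerDr scalerA mulrC -scalerA gE'.
  apply: (subD sIC).
    rewrite scalerDr; apply: addmP; [exact: (subZ _ sI)|exact: (subZ _ sC)].
  rewrite scalerDr; apply: addmP; [exact: (subZ _ sI)|exact: (subZ _ sC)].
(* Modulo $J$ this is $s^{2n} s$. *)
exists (p * (s - e)), (n * 2 + 1)%N; split.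
  rewrite exprD; apply: ideal_congrM => //; last first.
    by rewrite expr1 addrAC subrr sub0r; exact: (@subN A A^o).
  have -> : p - s ^+ (n * 2) = (p - ((s - e) * s) ^+ n) +
      (((s - e) * s) ^+ n - (s ^+ 2) ^+ n).
    by rewrite addrA subrK mulnC exprM.
  apply: idealD => //; apply: ideal_congrX => //.
  rewrite expr2 -mulrBl addrAC subrr sub0r mulrC; apply: idealMl => //.
  exact: (@subN A A^o).
have Cp v : idmul J (span [set` gs]) v -> C (p *: v).
  by move/idmul_id => -/(_ (@submod_span _ _ _)); exact: Hp.
move=> _ /span_cons[b [u [gu ->]]]; rewrite scalerDr; apply: (subD sC).
  rewrite scalerA mulrC -scalerA; apply: (subZ _ sC).
  rewrite -scalerA gE' scalerDr; apply: (subD sC); first exact: Cp.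
  exact: (subZ _ sC).
by rewrite mulrC -scalerA; apply: (subZ _ sC); exact: Hp.
Qed.

End DeterminantTrick.

Lemma span_sum (A : comPzRingType) (V : lmodType A) (t : seq V) v :
  span [set` t] v -> exists c : nat -> A, v = \sum_(j < size t) c j *: t`_j.
Proof.
apply: (@span_sub A V _ [set v | exists c : nat -> A,
  v = \sum_(j < size t) c j *: t`_j]).
  split=> [|a _ _ [c ->] [c' ->]].
    by exists (fun=> 0); rewrite big1 // => j _; rewrite scale0r.
  exists (fun j => a * c j + c' j); rewrite scaler_sumr -big_split /=.
  by apply: eq_bigr => j _; rewrite scalerDl scalerA.
move=> {}v vt; exists (fun j => if j == index v t then 1 else 0).
have ir : (index v t < size t)%N by rewrite index_mem.
rewrite (bigD1 (Ordinal ir)) //= eqxx nth_index // scale1r big1 ?addr0 // => j.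
by rewrite -val_eqE /= => /negPf ->; rewrite scale0r.
Qed.

Section OneDimensional.
Variables (A : comPzRingType) (V : lmodType A) (x : A) (K : set V) (d : nat).
Implicit Types (B L N : set V) (J : set A).
Hypothesis sK : submod K.
Hypothesis Kreg : forall u, K u -> x *: u = 0 -> u = 0.
Hypothesis Ksep : forall u, K u -> (forall n, dilate (x ^+ n) K u) -> u = 0.
Hypothesis Acompl :
  forall a : nat -> A, exists b : nat -> A, forall k, b k = a k + x * b k.+1.

Local Notation xK := (dilate x K).

Hypothesis Kchain :
  ~ strict_chain [set B | [/\ submod B, xK `<=` B & B `<=` K]] d.

(** Successive approximation: the coefficients at each generator form a power
    series in $x$, which converges in the ring. *)
Lemma complete_nakayama N (t : seq V) : N `<=` K -> [set` t] `<=` K ->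
  N `<=` span [set` t] :+ dilate x N -> N `<=` span [set` t].
Proof.
move=> NK tK HN u0 Nu0.
have [f fP] : {f : V -> V & forall u, N u ->
  N (f u) /\ span [set` t] (u - x *: f u)}.
  apply: (choice (P := fun u w => N u -> N w /\ span [set` t] (u - x *: w))).
  move=> u; have [Nu|nNu] := pselect (N u); last by exists 0.
  have [l [_ [tl [w Nw ->] ->]]] := HN u Nu.
  by exists w => _; rewrite addrK.
pose u k := iter k f u0.
have Nu k : N (u k) by elim: k => //= k IHk; have [] := fP _ IHk.
have [c cP] : {c : nat -> nat -> A & forall k,
    u k - x *: u k.+1 = \sum_(j < size t) c k j *: t`_j}.
  apply: (choice (P := fun k (c : nat -> A) =>
    u k - x *: u k.+1 = \sum_(j < size t) c j *: t`_j)) => k.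
  by apply: span_sum; have [] := fP _ (Nu k).
have [b bP] : {b : nat -> nat -> A & forall j k, b j k = c k j + x * b j k.+1}.
  apply: (choice (P := fun j (b : nat -> A) =>
    forall k, b k = c k j + x * b k.+1)).
  by move=> j; exact: Acompl.
pose w k := \sum_(j < size t) b j k *: t`_j.
have tw k : span [set` t] (w k).
  apply: subsum => [|j _]; first exact: submod_span.
  apply: (subZ _ (@submod_span _ _ _)); apply: sub_span; exact: mem_nth.
have wP k : w k - x *: w k.+1 = u k - x *: u k.+1.
  rewrite cP scaler_sumr -sumrB; apply: eq_bigr => j _.
  by rewrite [b j k]bP scalerDl scalerA addrK.
have uw n : u 0%N - w 0%N = x ^+ n *: (u n - w n).
  elim: n => [|n IHn]; first by rewrite scale1r.
  rewrite IHn exprSr -scalerA; congr (_ *: _).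
  rewrite scalerBr -[u n](subrK (x *: u n.+1)) -wP addrAC.
  by rewrite [w n - _]addrC addrK addrC.
suff /eqP : u 0%N - w 0%N = 0 by rewrite subr_eq0 => /eqP/= ->.
have Kw n : K (u n - w n).
  apply: (subB sK); first exact: NK.
  exact: (span_sub sK tK (tw n)).
by apply: Ksep => // n; exists (u n - w n).
Qed.

Definition saturated B := forall k, K k -> B (x *: k) -> B k.

(** Generators modulo $xK$ exist by the chain condition, and generate by
    [complete_nakayama]. *)
Lemma saturated_fg B : submod B -> B `<=` K -> saturated B ->
  exists t : seq V, B = span [set` t].
Proof.
move=> sB BK satB.
have sxK := submod_dilate x sK.
have xKK : xK `<=` K by move=> _ [k Kk ->]; exact: (subZ _ sK).
pose F := [set X | exists2 t : seq V, [set` t] `<=` B & X = span [set` t] :+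
  xK].
have [||[_ [t tB ->] tmax] _] := bounded_chain_extrema Kchain (F := F).
- move=> _ [t tB ->]; split; first by apply: submod_addm; [exact: submod_span|].
    by apply: addmr; exact: submod_span.
  apply: addm_sub => //; apply: span_sub => //.
  exact: subset_trans BK.
- by exists (span [set` [::]] :+ xK); exists [::].
have st := @submod_span A V [set` t].
exists t; apply/seteqP; split; last exact: span_sub.
apply: complete_nakayama => //; first exact: subset_trans BK.
move=> b Bb.
have [] : (span [set` t] :+ xK) b.
  apply: (tmax (span [set` b :: t] :+ xK)).
  - by exists (b :: t) => // c /=; rewrite inE => /orP[/eqP->|/tB].
  - by apply: addmS => //; apply: spanS => c /= ct; rewrite inE ct orbT.
  - by apply: addml => //; apply: sub_span; rewrite /= inE eqxx.
move=> l [_ [tl [k Kk ->] bE]]; exists l, (x *: k); split=> //; exists k => //.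
apply: satB => //; have -> : x *: k = b - l by rewrite bE addrC addKr.
by apply: (subB sB) => //; exact: (span_sub sB tB).
Qed.

(** As $B$ is saturated it is finitely generated, and as $L$ is saturated
    $L \cap xK = xL$; hence [complete_nakayama] applies. *)
Lemma saturated_sub B L : submod B -> B `<=` K -> saturated B ->
  submod L -> L `<=` K -> saturated L -> B `<=` L ->
  L `<=` B :+ xK -> L `<=` B.
Proof.
move=> sB BK satB sL LK satL BL LB.
have [t tE] := saturated_fg sB BK satB; rewrite tE.
apply: complete_nakayama => //.
  by apply: subset_trans BK; rewrite tE; exact: sub_span.
rewrite -tE => u Lu; have [v [_ [Bv [k Kk ->] uE]]] := LB u Lu.
exists v, (x *: k); split=> //; exists k => //; apply: satL => //.
have -> : x *: k = u - v by rewrite uE addrC addKr.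
by apply: (subB sL) => //; exact: BL.
Qed.

Definition annih J : set V := [set u | K u /\ forall a, J a -> a *: u = 0].

Lemma submod_annih J : submod (annih J).
Proof.
split=> [|a u v [Ku Ju] [Kv Jv]].
  by split=> [|a _]; [exact: sub0|rewrite scaler0].
split=> [|b Jb]; first exact: sK.2.
by rewrite scalerDr scalerA mulrC -scalerA Ju // Jv // scaler0 addr0.
Qed.

Lemma saturated_annih J : saturated (annih J).
Proof.
move=> k Kk [_ Jxk]; split=> // a Ja; apply: Kreg; first exact: (subZ _ sK).
by rewrite scalerA mulrC -scalerA Jxk.
Qed.

(** Annihilator submodules are saturated, so the chain condition modulo $x$
    gives a minimal nonzero one. The annihilator of one of its nonzero elements
    cannot define a smaller one. This replaces the choice of a maximal
    annihilator over a Noetherian ring. *)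
Lemma minimal_annih : (exists2 u, K u & u <> 0) -> exists J,
  (exists2 u, annih J u & u <> 0) /\
  forall u a, annih J u -> u <> 0 -> a *: u = 0 ->
    forall w, annih J w -> a *: w = 0.
Proof.
move=> [u0 Ku0 u0n].
have sxK := submod_dilate x sK.
have xKK : xK `<=` K by move=> _ [k Kk ->]; exact: (subZ _ sK).
have annK J : annih J `<=` K by move=> v [].
pose F := [set X | exists2 J, exists2 u, annih J u & u <> 0 & X = annih J :+
  xK].
have [||_ [_ [J [u Ju un] ->] Jmin]] := bounded_chain_extrema Kchain (F := F).
- move=> _ [J _ ->]; have sJ := submod_annih J.
  split; [exact: submod_addm|exact: addmr|exact: addm_sub].
- exists (annih set0 :+ xK); exists set0 => //; exists u0 => //; split=> //.
exists J; split; first by exists u.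
move=> {u Ju un} u a Ju un au w Jw.
pose J' := [set b | b *: u = 0].
have JJ' : annih J' `<=` annih J.
  move=> v [Kv J'v]; split=> // b Jb; apply: J'v; exact: Ju.2.
have J'u : annih J' u by split; [exact: annK Ju|move=> b].
have LJ : annih J `<=` annih J'.
  apply: saturated_sub => //; try exact: submod_annih;
    try exact: saturated_annih.
  apply: subset_trans (Jmin (annih J' :+ xK) _ _).
  - exact: addml.
  - by exists J' => //; exists u.
  - exact: addmS.
by have [_] := LJ w Jw; apply.
Qed.

(** The annihilator of such a submodule $L$ is prime. A prime $p_1$ strictly
    above it contains $x$: otherwise, as in Krull's principal ideal theorem,
    the symbolic powers $b^n L_{p_1} \cap L$ of an element $b$ of $p_1$ become
    stationary modulo $x$, hence stationary, which forces $L_{p_1} = 0$. And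
    modulo $x$ some power of every element outside $p_1$ acts idempotently up
    to a unit, so that $p_1$ is maximal. *)
Lemma one_dimensional_prime : (exists2 u, K u & u <> 0) ->
  exists u, [/\ K u, prime_ideal [set a | a *: u = 0] &
    forall p0 p1 p2, prime_ideal p0 -> prime_ideal p1 -> prime_ideal p2 ->
      [set a | a *: u = 0] `<=` p0 -> p0 `<` p1 -> p1 `<` p2 -> False].
Proof.
move=> /minimal_annih[J [[u Ju un] Jann]].
have sL := submod_annih J; have satL := @saturated_annih J.
set L := annih J in Ju Jann sL satL.
have LK : L `<=` K by move=> v [].
have sxK := submod_dilate x sK.
have xKK : xK `<=` K by move=> _ [k Kk ->]; exact: (subZ _ sK).
pose P := [set a | a *: u = 0].
have PL a v : L v -> P a -> a *: v = 0 by move=> Lv Pa; exact: (Jann u).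
have LP a v : L v -> v <> 0 -> a *: v = 0 -> P a.
  by move=> Lv vn av; exact: (Jann v).
have primeP : prime_ideal P.
  split.
  - split=> [|a b c Pb Pc]; first by rewrite /P/= scale0r.
    by rewrite /P /= scalerDl -scalerA Pb Pc scaler0 addr0.
  - by rewrite /P /= scale1r.
  - move=> a b; rewrite /P /= -scalerA => abu.
    have [bu|bu] := pselect (b *: u = 0); first by right.
    by left; apply: LP abu => //; exact: (subZ _ sL).
have [t tE] := saturated_fg sL LK satL.
have tL g : g \in t -> L g by rewrite tE => tg; exact: sub_span.
exists u; split; [exact: LK|exact: primeP|].
move=> p0 p1 p2 [sp0 p01 p0m] [sp1 p11 p1m] [sp2 p21 p2m] Pp0.
move=> [p01s /existsNP[b /not_implyP[p1b np0b]]].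
move=> [p12 /existsNP[a /not_implyP[p2a np1a]]].
have Pp1 : P `<=` p1 by exact: subset_trans p01s.
have inj e n v : ~ P e -> L v -> e ^+ n *: v = 0 -> v = 0.
  move=> nPe; elim: n v => [|n IHn] v Lv; first by rewrite scale1r.
  rewrite exprSr -scalerA => /IHn -/(_ (subZ _ sL Lv)) ev.
  by apply: contrapT => vn; apply: nPe; exact: LP ev.
have nPb : ~ P b by move/Pp0.
(* Krull's principal ideal theorem, by symbolic powers of $b$. *)
have p1x : p1 x.
  apply: contrapT => np1x.
  pose Lb n := [set v | L v /\ exists2 s, ~ p1 s & dilate (b ^+ n) L (s *: v)].
  have np1M s s' : ~ p1 s -> ~ p1 s' -> ~ p1 (s * s') by move=> ? ? /p1m[].
  have sLb n : submod (Lb n).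
    have sd := submod_dilate (b ^+ n) sL.
    split=> [|c v w [Lv [s ns sv]] [Lw [s' ns' sw]]].
      by split; [exact: sub0|exists 1 => //; rewrite scaler0; exact: sub0].
    split; first exact: sL.2.
    exists (s * s'); first exact: np1M.
    rewrite scalerDr; apply: (subD sd).
      rewrite scalerA [s * s' * c]mulrC [s * s']mulrC mulrA -scalerA.
      exact: (subZ _ sd).
    by rewrite -scalerA; exact: (subZ _ sd).
  have satLb n : saturated (Lb n).
    move=> k Kk [Lxk [s ns sxk]]; split; first exact: satL.
    by exists (s * x); [exact: np1M|rewrite -scalerA].
  have LbK n : Lb n `<=` K by move=> v [/LK].
  have LbS n : Lb n.+1 `<=` Lb n.
    move=> v [Lv [s ns [w Lw E]]]; split=> //; exists s => //.
    by exists (b *: w); [exact: (subZ _ sL)|rewrite scalerA -exprSr].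
  pose F := [set X | exists n, X = Lb n :+ xK].
  have [||_ [_ [n ->] nmin]] := bounded_chain_extrema Kchain (F := F).
  - by move=> _ [n ->]; split; [exact: submod_addm|exact: addmr|exact:
    addm_sub].
  - by exists (Lb 0%N :+ xK); exists 0%N.
  (* Stationary modulo $x$, the saturated submodules [Lb n] are stationary. *)
  have stat : Lb n `<=` Lb n.+1.
    apply: saturated_sub => //; apply: subset_trans (nmin (Lb n.+1 :+ xK) _ _).
    - exact: addml.
    - by exists n.+1.
    - exact: addmS.
  (* Cancelling $b^n$, this says that $L = bL$ after localization at $p_1$. *)
  have sLg g : L g -> exists2 s, ~ p1 s & dilate b L (s *: g).
    move=> Lg; have [_ [s ns [w Lw E]]] : Lb n.+1 (b ^+ n *: g).
      apply: stat; split; first exact: (subZ _ sL).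
      by exists 1 => //; rewrite scale1r; exists g.
    exists s => //; exists w => //; apply/eqP; rewrite -subr_eq0; apply/eqP.
    apply: (inj b n) => //.
      by apply: (subB sL); exact: (subZ _ sL).
    rewrite scalerBr scalerA mulrC -scalerA E exprSr -scalerA.
    by rewrite subrr.
  have [s ns st] : exists2 s, ~ p1 s & forall g, g \in t -> dilate b L (s *: g).
    have sd := submod_dilate b sL.
    elim: {tE} t tL => [|g t' IHt] tL'; first by exists 1.
    have [|s ns st'] := IHt; first by move=> h ht; apply: tL';
      rewrite inE ht orbT.
    have [s' ns' sg] := sLg g (tL' g (mem_head _ _)).
    exists (s * s'); first exact: np1M.
    move=> h; rewrite inE => /orP[/eqP->|/st' H].
      by rewrite -scalerA; exact: (subZ _ sd).
    by rewrite mulrC -scalerA; exact: (subZ _ sd).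
  have [|p [k [bp Hp]]] := determinant_trick (ideal_principal b)
      (@submod_set0 A V) (gs := t) (s := s).
    move=> g /st[w Lw ->]; rewrite addm0; apply: idmulP; last by rewrite -tE.
    by exists 1; rewrite mul1r.
  apply/ns/(prime_exp (n := k)) => //.
  have -> : s ^+ k = p - (p - s ^+ k) by rewrite subKr.
  apply: idealB => //; last exact: principal_sub bp.
  by apply: Pp1; apply: Hp; rewrite -tE.
(* Modulo $x$, the powers of $a$ become stationary on $L$. *)
pose F := [set X | exists n, X = dilate (a ^+ n) L :+ xK].
have sda n := submod_dilate (a ^+ n) sL.
have [||_ [_ [n ->] nmin]] := bounded_chain_extrema Kchain (F := F).
- move=> _ [n ->]; split; [exact: submod_addm|exact: addmr|].
  by apply: addm_sub => // _ [v Lv ->]; exact/LK/(subZ _ sL).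
- by exists (dilate (a ^+ 0) L :+ xK); exists 0%N.
have sxL := submod_dilate x sL.
have an v : L v -> exists w w', [/\ L w, L w' & a ^+ n *: v = a ^+ n.+1 *:
  w + x *: w'].
  move=> Lv; have : (dilate (a ^+ n.+1) L :+ xK) (a ^+ n *: v).
    apply: (nmin (dilate (a ^+ n.+1) L :+ xK)).
    - by exists n.+1.
    - apply: addmS => // _ [w Lw ->]; exists (a *: w); first exact: (subZ _ sL).
      by rewrite scalerA -exprSr.
    - by apply: addml => //; exists v.
  move=> [_ [_ [[w Lw ->] [k Kk ->] E]]]; exists w, k; split=> //.
  apply: satL => //.
  have -> : x *: k = a ^+ n *: v - a ^+ n.+1 *: w by rewrite E addrC addKr.
  by apply: (subB sL); exact: (subZ _ sL).
have spm v : L v -> span [set` map ( *:%R (a ^+ n)) t] (a ^+ n *: v).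
  rewrite tE; have sp := @submod_span A V [set` map ( *:%R (a ^+ n)) t].
  have := submod_colon (a ^+ n) sp => /span_sub; apply => g tg.
  by apply: sub_span; apply/mapP; exists g.
have [|p [k [ap Hp]]] := determinant_trick (ideal_principal a) sxL
    (gs := map ( *:%R (a ^+ n)) t) (s := 1).
  move=> _ /mapP[g /tL Lg ->]; rewrite scale1r.
  have [w [w' [Lw Lw' ->]]] := an g Lg.
  apply: addmP; last by exists w'.
  rewrite exprS -scalerA; apply: idmulP; last exact: spm.
  by exists 1; rewrite mul1r.
rewrite expr1n in ap.
(* $p a^n$ maps $L$ into $xL$, so one of its powers lies in $(x) + P$; but
   $p \equiv 1$ modulo $a$. *)
have [|q [l [xq Hq]]] := determinant_trick (ideal_principal x)
    (@submod_set0 A V) (gs := t) (s := p * a ^+ n).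
  move=> g tg; rewrite addm0 -scalerA.
  have [w Lw ->] := Hp _ (spm _ (tL _ tg)).
  by apply: idmulP; [exists 1; rewrite mul1r|rewrite -tE].
have : p1 (p * a ^+ n).
  apply: (prime_exp (n := l)) => //.
  have -> : (p * a ^+ n) ^+ l = q - (q - (p * a ^+ n) ^+ l) by rewrite subKr.
  apply: idealB => //; last exact: principal_sub xq.
  by apply: Pp1; apply: Hq; rewrite -tE.
move=> /p1m[p1p|/prime_exp]; last by move/(_ (And3 sp1 p11 p1m)).
apply: p21; have -> : 1 = p - (p - 1) by rewrite subKr.
by apply: idealB => //; [exact: p12|exact: principal_sub ap].
Qed.

End OneDimensional.

(** * Completions *)

Section Representatives.
Variables (A : comPzRingType) (m : set A).

Section Rep.
Variable V : lmodType A.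
Local Notation Vh := (completion m V).
Local Notation E n := (idpow V m n).
Implicit Types (p q : Vh) (u v : nat -> V).

(** Every coherent sequence in the class is allowed, so that sums, products and
    limits can be computed on convenient sequences instead of the chosen one. *)
Definition rep p u : Prop := forall n, E n (val (repr p) n - u n).

Lemma rep_repr p : rep p (val (repr p)).
Proof. by move=> n; rewrite subrr; exact: idpow0. Qed.

Lemma rep_close p u v : (forall n, E n (u n - v n)) -> rep p u -> rep p v.
Proof.
move=> uv pu n; rewrite -(subrK (u n) (_ n)) -addrA.
by apply: idpowD; [exact: pu|exact: uv].
Qed.

Lemma rep_uniq p u v : rep p u -> rep p v -> forall n, E n (u n - v n).
Proof.
move=> pu pv n; rewrite -[u n](subKr (val (repr p) n)) addrAC.
by apply: idpowD; [exact: pv|apply: idpowN; exact: pu].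
Qed.

Lemma rep_inj p q u : rep p u -> rep q u -> p = q.
Proof.
move=> pu qu; rewrite -[p]reprK -[q]reprK; apply/pi_coh_eq => n.
rewrite -(subrK (u n) (val (repr p) n)) -addrA; apply: idpowD; first exact: pu.
by rewrite -opprB; apply: idpowN; exact: qu.
Qed.

Lemma rep_eq p q u v : rep p u -> rep q v ->
  p = q <-> forall n, E n (u n - v n).
Proof.
move=> pu qv; split=> [pq|uv]; first by apply: rep_uniq qv; rewrite -pq.
by apply: rep_inj qv; exact: rep_close pu.
Qed.

Lemma rep_coherent p u n : rep p u -> E n (u n.+1 - u n).
Proof.
move=> pu; have /asboolP/(_ n) cp := valP (repr p).
have pn1 : E n (val (repr p) n.+1 - u n.+1).
  by apply: (idpow_decr (leqnSn n)); exact: pu.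
rewrite -[u n.+1](subKr (val (repr p) n.+1)) addrAC.
apply: idpowD; last exact: idpowN.
rewrite -(subrK (val (repr p) n) (val _ n.+1)) -addrA.
by apply: idpowD => //; exact: pu.
Qed.

Lemma rep_ex u : (forall n, E n (u n.+1 - u n)) -> exists p, rep p u.
Proof.
move=> cu; have cu' : coherent m u by apply/asboolP.
exists (\pi_(completion m V) (exist _ u cu')) => n.
exact: (repr_pi_coh (exist _ u cu') n).
Qed.

Lemma rep_shift p u k : rep p u -> rep p (fun n => u (k + n)%N).
Proof.
move=> pu; apply: (rep_close (u := u)) => // n; elim: k => [|k IHk].
  by rewrite add0n subrr; exact: idpow0.
rewrite addSn -(subrK (u (k + n)%N) (u n)) -addrA; apply: idpowD => //.
rewrite -opprB; apply: idpowN; apply: (idpow_decr (leq_addl k n)).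
exact: rep_coherent pu.
Qed.

Lemma repD p q u v : rep p u -> rep q v -> rep (p + q) (fun n => u n + v n).
Proof.
move=> pu qv.
have : rep (p + q) (fun n => val (repr p) n + val (repr q) n).
  move=> n; rewrite -{1}[p]reprK -{1}[q]reprK pi_cohD.
  by have := repr_pi_coh (repr p + repr q) n; rewrite val_cohD.
apply: rep_close => n; rewrite opprD addrACA.
by apply: idpowD; [exact: pu|exact: qv].
Qed.

Lemma rep0 : rep 0 (fun=> 0).
Proof.
have r0 := rep_repr (0 : Vh); have := repD r0 r0; rewrite addr0 => r00.
apply: (rep_close _ r0) => n; rewrite subr0.
by have := rep_uniq r00 r0 n; rewrite addrK.
Qed.

Lemma repN p u : rep p u -> rep (- p) (fun n => - u n).
Proof.
move=> pu; have rN := rep_repr (- p); apply: (rep_close _ rN) => n.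
have r0 : rep (- p + p) (fun=> 0) by rewrite addNr; exact: rep0.
by have := rep_uniq (repD rN pu) r0 n; rewrite subr0 opprK.
Qed.

End Rep.

Section Scale.
Variable V : lmodType A.

Lemma repZ (a : completion_ring m) (p : completion m V)
    (c : nat -> A^o) (u : nat -> V) :
  rep (a : completion m A^o) c -> rep p u ->
    rep (a *: p) (fun n => (c n : A) *: u n).
Proof.
move=> ac pu.
have : rep (a *: p) (fun n => (val (repr (a : completion m A^o)) n : A) *:
  val (repr p) n).
  by move=> n; exact: (repr_pi_coh (coh_scale (repr (a :
    completion m A^o)) (repr p)) n).
apply: rep_close => n.
rewrite -(subrKA ((c n : A) *: val (repr p) n)) -scalerBl -scalerBr.
by apply: idpowD; [apply: idpow_scale; exact: ac|apply: idpowZ; exact: pu].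
Qed.

Fact const_coherent (v : V) : coherent m (fun=> v).
Proof. by apply/asboolP => n; rewrite subrr; exact: idpow0. Qed.

Definition to_compl (v : V) : completion m V :=
  \pi_(completion m V) (exist _ (fun=> v) (const_coherent v)).

Lemma rep_to_compl v : rep (to_compl v) (fun=> v).
Proof.
by move=> n; exact: (repr_pi_coh (exist _ (fun=> v) (const_coherent v)) n).
Qed.

Lemma to_complD v w : to_compl (v + w) = to_compl v + to_compl w.
Proof.
exact: rep_inj (rep_to_compl _) (repD (rep_to_compl v) (rep_to_compl w)).
Qed.

Lemma to_complN v : to_compl (- v) = - to_compl v.
Proof. exact: rep_inj (rep_to_compl _) (repN (rep_to_compl v)). Qed.

Lemma to_compl0 : to_compl 0 = 0.
Proof. exact: rep_inj (rep_to_compl _) (@rep0 _). Qed.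

End Scale.

Definition to_complR (a : A) : completion_ring m := @to_compl A^o a.

Lemma to_complZ (V : lmodType A) (a : A) (v : V) : to_compl (a *:
  v) = to_complR a *: to_compl v.
Proof.
apply: rep_inj (rep_to_compl _) _.
exact: (repZ (rep_to_compl (a : A^o)) (rep_to_compl v)).
Qed.

Lemma to_complRM (a b : A) : to_complR (a * b) = to_complR a * to_complR b.
Proof. exact: (@to_complZ A^o a b). Qed.

Lemma to_complR1 : to_complR 1 = 1.
Proof.
exact: rep_inj (rep_to_compl _) (fun n => repr_pi_coh (coh_one m) n).
Qed.

Lemma to_complRX (a : A) n : to_complR (a ^+ n) = to_complR a ^+ n.
Proof.
by elim: n => [|n IHn]; [exact: to_complR1 | rewrite !exprS to_complRM IHn].
Qed.

Lemma repXZ (V : lmodType A) x n (p : completion m V) u :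
  rep p u -> rep (to_complR x ^+ n *: p) (fun k => x ^+ n *: u k).
Proof. by rewrite -to_complRX; exact: (repZ (rep_to_compl (x ^+ n : A^o))). Qed.

(** Power series in an element of $m$ converge. *)
Lemma completion_series (V : lmodType A) x (v : nat -> completion m V) : m x ->
  exists s : nat -> completion m V, forall k, s k = v k + to_complR x *: s k.+1.
Proof.
move=> mx; pose w k n := val (repr (v k)) n.
pose S k n := \sum_(i < n) x ^+ i *: w (k + i)%N n.
have xE n (y : V) : idpow V m n (x ^+ n *: y) by exact: powm_exp.
have cS k n : idpow V m n (S k n.+1 - S k n).
  rewrite /S big_ord_recr /= addrAC -sumrB; apply: idpowD => //.
  apply: subsum => [|i _]; first exact: submod_idpow.
  rewrite -scalerBr; apply: idpowZ; apply: rep_coherent; exact: rep_repr.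
have [s sP] : {s : nat -> completion m V & forall k, rep (s k) (S k)}.
  by apply: (choice (P := fun k p => rep p (S k))) => k; exact: rep_ex.
exists s => k; have := repD (rep_repr (v k)) (repXZ x 1 (sP k.+1));
  rewrite expr1.
move/(rep_eq (sP k)) => H; apply/H => n.
have -> : val (repr (v k)) n + x ^+ 1 *: S k.+1 n = S k n + x ^+ n *:
  w (k + n)%N n.
  rewrite /S -(big_ord_recr n (fun i => x ^+ i *:
    w (k + i)%N n)) big_ord_recl /=.
  rewrite scale1r addn0 scaler_sumr; congr (_ + _); apply: eq_bigr => i _.
  by rewrite /bump /= add1n scalerA expr1 -exprS addSnnS.
by rewrite opprD addrA subrr sub0r; apply: idpowN.
Qed.

(** The hypothesis puts $p$ into $m^n$ times the completion for all $n$. *)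
Lemma completion_sep (V : lmodType A) x (p : completion m V) : m x ->
  (forall n, exists q, p = to_complR x ^+ n *: q) -> p = 0.
Proof.
move=> mx px; apply/(rep_eq (rep_repr p) (@rep0 V)) => n; rewrite subr0.
have [q pE] := px n; have rp := repXZ x n (rep_repr q); rewrite -pE in rp.
rewrite -(subrK (x ^+ n *: val (repr q) n) (val (repr p) n)).
by apply: idpowD; [exact: (rep_uniq (rep_repr p) rp)|exact: powm_exp].
Qed.

End Representatives.

(** * Divisible local cohomology and associated primes of the completion *)

Section DivisibleTorsion.
Variables (A : comPzRingType) (m : set A) (V : lmodType A) (x : A).
Hypotheses (hA : noetherian A) (hV : noeth_module V).
Hypotheses (mI : ideal m) (m1 : ~ m 1).
Hypothesis munit : forall b, ~ m b -> exists c, c * b = 1.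
Hypotheses (mx : m x) (xreg : forall v : V, x *: v = 0 -> v = 0).

Local Notation Vh := (completion m V).
Local Notation xh := (to_complR m x).
Local Notation X n := (dilate (x ^+ n) [set: V]).
Local Notation sat := (sat m).
Local Notation io := (@to_compl A m V).

Let sX n : submod (X n). Proof. exact/submod_dilate/submodT. Qed.
Let sE n : submod (idpow V m n). Proof. exact: submod_idpow. Qed.

Lemma xregB (v w : V) : x *: v = x *: w -> v = w.
Proof.
by move/eqP; rewrite -subr_eq0 -scalerBr => /eqP/xreg/eqP;
  rewrite subr_eq0 => /eqP.
Qed.

(** By [regular_idpow], a sequence $u$ with $x u_n \in m^n M$ for all $n$ tends
    to zero. *)
Lemma completion_regular (p : Vh) : xh *: p = 0 -> p = 0.
Proof.
move=> xp; apply/(rep_eq (rep_repr p) (@rep0 _ m V)) => k; rewrite subr0.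
have [n Hn] := regular_idpow hA hV mI k xreg.
pose l := maxn n k.
have rp := repXZ x 1 (rep_repr p); rewrite !expr1 xp in rp.
have /= := rep_uniq rp (@rep0 _ m V) l; rewrite subr0 => xl.
have kl : idpow V m k (val (repr p) l).
  by apply: Hn; apply: idpow_decr xl; exact: leq_maxl.
have rl : idpow V m k (val (repr p) k - val (repr p) l).
  have := rep_uniq (rep_repr p) (rep_shift (l - k) (rep_repr p)) k.
  by rewrite subnK // leq_maxr.
by rewrite -(subrK (val (repr p) l) (val (repr p) k)); exact: (subD (sE _)).
Qed.

Lemma to_compl_dilate w (p : Vh) : io w = xh *: p -> dilate x setT w.
Proof.
move=> wE; apply: (krull_intersection hA hV mI m1 munit).
  exact/submod_dilate/submodT.
move=> n; have rp := repXZ x 1 (rep_repr p); rewrite !expr1 -wE in rp.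
have H := rep_uniq (rep_to_compl m w) rp n.
rewrite -(subrK (x *: val (repr p) n) w) addmC.
by apply: addmP => //; exists (val (repr p) n).
Qed.

Lemma to_compl_inj w : io w = 0 -> w = 0.
Proof.
move=> w0; have : ([set 0] : set V) w; last by [].
apply: (krull_intersection hA hV mI m1 munit); first exact: submod_set0.
move=> n; rewrite add0m -[w]subr0.
by have := rep_uniq (rep_to_compl m w) _ n; apply; rewrite w0; exact: rep0.
Qed.

Lemma powm_idpow (N : set V) n (c : A) v : submod N ->
  idpow A^o m n c -> N v -> powm m n N (c *: v).
Proof.
move=> sN; elim: n c => [|n IHn] c nc Nv; first exact: (subZ _ sN).
apply: (@idmul_sub A A^o m _ [set c | powm m n.+1 N (c *: v)]) nc.
  have sP := submod_powm m n.+1 sN.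
  split=> [|a b b' Nb Nb']; first by rewrite /= scale0r; exact: sub0.
  by rewrite /= scalerDl -scalerA; exact: sP.2.
move=> a b ma nb; suff : powm m n.+1 N ((a * b) *: v) by [].
rewrite -scalerA.
by apply: idmulP => //; exact: IHn.
Qed.

(** Modulo $x^n$, an element killed by $m^t$ only sees the class of a scalar
    modulo $m^t$. *)
Lemma scale_torsion n t w (a : completion_ring m) : mcolon m t (X n) w ->
  exists c (p : Vh), a *: io w = io (c *: w) + xh ^+ n *: p.
Proof.
move=> tw; pose al k : A := val (repr (a : completion m A^o)) k.
have ra : rep (a : completion m A^o) (al : nat -> A^o) by exact: rep_repr.
have [z zP] : {z : nat -> V & forall k, idpow V m k (z k) /\
    (al (t + k.+1)%N - al (t + k)%N) *: w = x ^+ n *: z k}.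
  apply: (choice (P := fun k z => idpow V m k z /\
    (al (t + k.+1)%N - al (t + k)%N) *: w = x ^+ n *: z)) => k.
  have ck := rep_coherent (t + k) ra.
  have sw := @submod_span A V [set` [:: w]].
  have : powm m (k + t) (span [set` [:: w]]) ((al (t + k.+1)%N - al (t + k)%N)
    *: w).
    apply: powm_idpow => //; first by rewrite addnC addnS.
    by apply: sub_span; rewrite /= inE.
  rewrite /powm iterD => H.
  have : powm m k (X n) ((al (t + k.+1)%N - al (t + k)%N) *: w).
    apply: (powmS (N := powm m t (span [set` [:: w]]))) => //.
    apply: (@mcolon_powm A m V t (X n) _ (sX n)).1; apply: span_sub;
      first exact: submod_mcolon.
    by move=> v /=; rewrite inE => /eqP->.
  by rewrite powm_dilate // => -[z kz ->]; exists z.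
(* $x^n y_k = (a_{t+k} - a_t) w$, and the sequence $y$ is coherent because
   $z_k \in m^k M$. *)
pose y k := \sum_(j < k) z j.
have yE k : (al (t + k)%N - al t) *: w = x ^+ n *: y k.
  elim: k => [|k IHk]; first by rewrite addn0 subrr scale0r /y big_ord0 scaler0.
  rewrite /y big_ord_recr /= scalerDr -/(y k) -IHk -(zP k).2 -scalerDl.
  by congr (_ *: _); rewrite [RHS]addrC addrA subrK.
have [|p py] := @rep_ex _ m V y.
  by move=> k; rewrite /y big_ord_recr /= [_ + z k]addrC addrK; exact: (zP k).1.
exists (al t), p.
have r1 := rep_shift t (repZ ra (rep_to_compl m w)).
apply: (rep_inj r1).
have := repD (rep_to_compl m (al t *: w)) (repXZ x n py).
have -> : (fun k => al t *: w + x ^+ n *: y k) = (fun k => (al (t + k)%N) *: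
  w) by
  apply: funext => k; rewrite -yE -scalerDl addrC subrK.
by [].
Qed.

(** These are the elements that become divisible by every power of $x$ in the
    ideal transform of the completion with respect to $m$. *)
Definition divK : set Vh :=
  [set p | forall n, exists w q, sat (X n) w /\ p = io w + xh ^+ n *: q].

Lemma submod_divK : submod (divK : set (Vh : lmodType (completion_ring m))).
Proof.
apply: submod_intro.
- move=> a p Kp n; have [w [q [[t tw] ->]]] := Kp n.
  have [c [q' E]] := scale_torsion a tw.
  exists (c *: w), (q' + a *: q); split.
    by exists t; apply: (subZ _ (submod_mcolon m t (sX n))).
  rewrite scalerDr E -addrA; congr (_ + _).
  by rewrite scalerDr !scalerA mulrC.
- move=> p p' Kp Kp' n; have [w [q [sw ->]]] := Kp n.
  have [w' [q' [sw' ->]]] := Kp' n; exists (w + w'), (q + q'); split.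
    exact: (subD (submod_sat m (sX n))).
  by rewrite to_complD scalerDr addrACA.
- exists 0 => n; exists 0, 0; split; first by apply: sub_sat; exact: sub0.
  by rewrite to_compl0 scaler0 addr0.
Qed.

Lemma saturated_divK (p : Vh) : divK (xh *: p) -> divK p.
Proof.
move=> Kxp n; have [w [q [sw E]]] := Kxp n.+1.
have wE : io w = xh *: (p - xh ^+ n *: q).
  by rewrite scalerBr scalerA -exprS E addrK.
have [w' _ w'E] := to_compl_dilate wE.
exists w', q; split.
  rewrite w'E in sw; have [t tw'] := sat_colon sw; exists t.
  apply: mcolonS tw' => v [v' _]; rewrite exprS -scalerA => /xregB ->.
  by exists v'.
have : xh *: (p - xh ^+ n *: q - io w') = 0.
  by rewrite scalerBr -wE w'E to_complZ subrr.
move/completion_regular/eqP; rewrite subr_eq0 => /eqP <-.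
by rewrite subrK.
Qed.

(** Sending $B$ to the torsion classes $w$ modulo $x$ that are represented in
    $B$ is strictly monotone, since two elements of [divK] with the same class
    differ by an element of $x$ [divK]. Thus [divK] modulo $x$ is bounded by
    $H^0_m(M / xM)$. *)
Lemma divK_chain l :
  has_length (sat (X 1)) (X 1) l ->
  ~ strict_chain [set B : set Vh |
      [/\ submod (B : set (Vh : lmodType (completion_ring m))),
          dilate xh divK `<=` B & B `<=` divK]] l.+1.
Proof.
move=> [_ nl]; apply: contra_not nl.
pose f (B : set Vh) : set V :=
  [set w | sat (X 1) w /\ exists b q, B b /\ b = io w + xh *: q].
apply: (@strict_chain_map _ _ _ _ f).
  move=> B [sB KB BK]; split.
  - split=> [|a v w [sv [b [q [Bb bE]]]] [sw [b' [q' [Bb' bE']]]]].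
      split; first by apply: sub0; exact: submod_sat.
      by exists 0, 0; split; [exact: sub0|rewrite to_compl0 scaler0 addr0].
    split; first exact: (submod_sat m (sX 1)).2.
    exists (to_complR m a *: b + b'), (to_complR m a *: q + q'); split;
      first exact: sB.2.
    rewrite bE bE' to_complD to_complZ !scalerDr addrACA; congr (_ + (_ + _)).
    by rewrite !scalerA mulrC.
  - move=> _ [v _ ->]; split; first by apply: sub_sat; exists v.
    exists 0, (- io v); split; first exact: sub0.
    by rewrite expr1 to_complZ scalerN subrr.
  - by move=> v [].
move=> B B' [sB KB BK] [sB' KB' BK'] [BB' nBB']; split.
  by move=> w [sw [b [q [Bb bE]]]]; split=> //; exists b, q; split=> //;
    exact: BB'.
move=> fB'; apply: nBB' => b' Bb'.
have [w [q [sw]]] := BK' _ Bb' 1%N; rewrite expr1 => b'E.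
have [_ [b [q' [Bb bE]]]] : f B w by apply: fB'; split=> //; exists b', q.
have dE : b' - b = xh *: (q - q').
  by rewrite b'E bE opprD addrACA subrr add0r scalerBr.
rewrite -(subrK b b'); apply: (subD sB) => //; apply: KB.
exists (q - q') => //; apply: saturated_divK; rewrite -dE.
by apply: (subB submod_divK); [exact: BK'|exact: BK].
Qed.

(** The last hypothesis says that $x$ is surjective on $H^1_m(M)$. Lifting a
    nonzero torsion class modulo $x$ to all powers of $x$ gives a nonzero
    element of [divK], to which [one_dimensional_prime] applies. *)
Lemma divisible_torsion_ass l w0 :
  has_length (sat (X 1)) (X 1) l -> sat (X 1) w0 -> ~ X 1 w0 ->
  (forall n w, (0 < n)%N -> sat (X n) w ->
     exists v, sat (X n.+1) (w - x ^+ n *: v)) ->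
  exists P : set (completion_ring m),
    ass_prime (Vh : lmodType (completion_ring m)) P /\
    forall p0 p1 p2, prime_ideal p0 -> prime_ideal p1 -> prime_ideal p2 ->
      P `<=` p0 -> p0 `<` p1 -> p1 `<` p2 -> False.
Proof.
move=> lW sw0 nw0 lift.
have [f fP] : {f : nat * V -> V & forall nw, (0 < nw.1)%N ->
  sat (X nw.1) nw.2 ->
    sat (X nw.1.+1) (nw.2 - x ^+ nw.1 *: f nw)}.
  apply: (choice (P := fun (nw : nat * V) v => (0 < nw.1)%N ->
    sat (X nw.1) nw.2 ->
    sat (X nw.1.+1) (nw.2 - x ^+ nw.1 *: v))) => -[n w] /=.
  have [H|nH] := pselect ((0 < n)%N /\ sat (X n) w).
    by have [v Hv] := lift n w H.1 H.2; exists v.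
  by exists 0 => n0 sw; exfalso; apply: nH.
(* Lift the torsion class successively to all powers of $x$; the corrections
   add up to a power series, and its limit is the element [p]. *)
pose w := fix w k := if k is k'.+1 then w k' - x ^+ k *: f (k, w k') else w0.
have sw k : sat (X k.+1) (w k).
  elim: k => [//|k IHk] /=; exact: (fP (k.+1, w k)).
have [s sP] := completion_series (fun k => io (f (k.+1, w k))) mx.
pose p := io w0 - xh *: s 0%N.
have pE k : p = io (w k) - xh ^+ k.+1 *: s k.
  elim: k => [|k IHk]; first by rewrite expr1.
  rewrite IHk [s k]sP /= to_complD to_complN to_complZ to_complRX scalerDr
    scalerA -exprSr.
  by rewrite opprD addrA.
have Kp : divK p.
  move=> [|k]; last by exists (w k), (- s k); rewrite scalerN -pE.
  exists 0, p; rewrite to_compl0 add0r scale1r; split=> //.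
  by apply: sub_sat; exact: sub0.
have pn : p <> 0.
  move/eqP; rewrite subr_eq0 => /eqP /to_compl_dilate [v _ w0E].
  by apply: nw0; exists v.
have [||||||u [Ku uP uchain]] := @one_dimensional_prime _
    (Vh : lmodType (completion_ring m)) xh divK l.+1.
- exact: submod_divK.
- by move=> q _; exact: completion_regular.
- by move=> q _ Hq; apply: (completion_sep mx) => n; have [q' _ ->] := Hq n;
  exists q'.
- by move=> a; exact: (@completion_series _ m A^o x a mx).
- exact: divK_chain.
- by exists p.
exists [set a | a *: u = 0]; split; last exact: uchain.
by split=> //; exists u.
Qed.

(** The scalars of the completion act on such an element through $A / m$, so
    that its annihilator is the maximal ideal of the completion. *)
Lemma socle_ass (v : V) : v <> 0 -> (forall a, m a -> a *: v = 0) ->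
  exists P : set (completion_ring m),
    ass_prime (Vh : lmodType (completion_ring m)) P /\
    forall p0 p1, prime_ideal p0 -> prime_ideal p1 ->
      P `<=` p0 -> p0 `<` p1 -> False.
Proof.
move=> vn mv.
have aE (a : completion_ring m) : exists c, a *: io v = io (c *: v).
  pose al k : A := val (repr (a : completion m A^o)) k.
  have ra : rep (a : completion m A^o) (al : nat -> A^o) by exact: rep_repr.
  exists (al 1%N); apply: (rep_inj (rep_shift 1 (repZ ra (rep_to_compl m v)))).
  apply: (rep_close _ (rep_to_compl m (al 1%N *: v))) => n.
  rewrite -scalerBl mv; first exact: idpow0.
  elim: n => [|n IHn]; first by rewrite subrr; exact: (@sub0 A A^o).
  have -> : al 1%N - al (1 + n.+1)%N =
    (al 1%N - al (1 + n)%N) - (al (n.+2) - al n.+1).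
    by rewrite opprB addrA subrK.
  apply: idealB => //.
  have := idpow_decr (isT : (1 <= n.+1)%N) (rep_coherent n.+1 ra).
  by apply: idmul_sub => // b c' mb _; rewrite [_ *: _]mulrC; exact: idealMl.
have inv (a : completion_ring m) : a *: io v <> 0 ->
    exists b : completion_ring m, (b * a) *: io v = io v.
  have [c ac] := aE a; rewrite ac => an.
  have [mc|/munit[b bc]] := pselect (m c).
    by exfalso; apply: an; rewrite mv // to_compl0.
  by exists (to_complR m b); rewrite -scalerA ac -to_complZ scalerA bc scale1r.
pose P := [set a : completion_ring m | a *: io v = 0].
have ivn : io v <> 0 by move/to_compl_inj.
exists P; split; [split; [split|by exists (io v)]|].
- split=> [|a b c Pb Pc]; first by rewrite /P/= scale0r.
  by rewrite /P /= scalerDl -scalerA Pb Pc scaler0 addr0.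
- by rewrite /P /= scale1r.
- move=> a b; rewrite /P /= => abv.
  have [bv|/inv[c cb]] := pselect (b *: io v = 0); first by right.
  left; rewrite -cb scalerA mulrCA -scalerA abv scaler0 //.
- move=> p0 p1 _ [sp1 p11 _] Pp0 [p01 /existsNP[a /not_implyP[p1a np0a]]].
  have [av|/inv[b ba]] := pselect (a *: io v = 0); first by apply/np0a/Pp0.
  apply: p11; have -> : 1 = (1 - b * a) + b * a by rewrite subrK.
  apply: idealD => //; last exact: idealMl.
  by apply/p01/Pp0; rewrite /P /= scalerBl scale1r ba subrr.
Qed.

End DivisibleTorsion.

(** * Unmixed modules *)

Section TorsionLift.
Variables (A : comPzRingType) (m : set A) (V : lmodType A) (x y : A) (t0 : nat).

Local Notation X n := (dilate (x ^+ n) [set: V]).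
Local Notation Y := (dilate y [set: V]).
Local Notation sat := (sat m).
Local Notation mcolon := (mcolon m).

Lemma mcolonI t (N L : set V) : mcolon t N `&` mcolon t L `<=` mcolon t (N `&`
  L).
Proof.
by elim: t => //= t IHt v [Nv Lv] a ma; apply: IHt; split;
  [exact: Nv|exact: Lv].
Qed.

Lemma satI (N L : set V) : submod N -> submod L ->
  sat N `&` sat L `<=` sat (N `&` L).
Proof.
move=> sN sL v [[s Ns] [t Lt]]; exists (maxn s t); apply: mcolonI; split.
  by apply: mcolon_le Ns => //; exact: leq_maxl.
by apply: mcolon_le Lt => //; exact: leq_maxr.
Qed.

(** A power of $y$ maps a torsion class into $N$, and powers of $y$ can be
    lowered to $y$ itself. *)
Lemma sat_sub_colon (N : set V) : submod N -> m y ->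
  (forall v, N (y *: (y *: v)) -> N (y *: v)) -> sat N `<=` colon N y.
Proof.
move=> sN my Ny v [t]; elim: t v => [|t IHt] v; first exact: (subZ _ sN).
by move=> /(_ y my)/IHt; exact: Ny.
Qed.

Lemma sat_scale (N L : set V) a v : (forall w, N w -> L (a *: w)) ->
  sat N v -> sat L (a *: v).
Proof.
move=> NL [t Nv]; exists t; have : mcolon t (colon L a) v by apply: mcolonS Nv.
by rewrite mcolon_colon.
Qed.

Hypothesis my : m y.
Hypothesis xreg : forall v : V, x *: v = 0 -> v = 0.
Hypothesis ysq : forall v : V, X 1 (y *: (y *: v)) -> X 1 (y *: v).
Hypothesis W_tors : colon (X 1) y `<=` mcolon t0 (X 1).
Hypothesis sat_xy : sat (X 1 :+ Y) `<=` colon (X 1) y :+ Y.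

Let sX n : submod (X n). Proof. exact/submod_dilate/submodT. Qed.
Let sY : submod Y. Proof. exact/submod_dilate/submodT. Qed.

Let xregBX n (v w : V) : x ^+ n *: v = x ^+ n *: w -> v = w.
Proof.
move/eqP; rewrite -subr_eq0 -scalerBr => /eqP H.
apply/eqP; rewrite -subr_eq0; apply/eqP; elim: n H => [|n IHn];
  first by rewrite scale1r.
by rewrite exprS -scalerA => /xreg.
Qed.

Let satW k w : colon (X 1) y w -> sat (X k.+1) (x ^+ k *: w).
Proof.
move=> /W_tors Ww; apply: (@sat_scale (X 1)); last by exists t0.
by move=> _ [v _ ->]; exists v => //; rewrite scalerA -exprD addn1.
Qed.

(** The two statements are proved by a simultaneous induction: the relation
    $y w = x p$ turns a torsion class $w$ modulo $x^{k+1}$ into a torsion class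
    $p$ modulo $y x^k$, and [sat_xy] corrects the latter. *)
Let cofactor_lift k : Prop := forall p, sat (dilate (y * x ^+ k) setT) p ->
  exists v, sat (X k.+1) (p - (y * x ^+ k) *: v).

Let torsion_lift k : Prop := forall w, sat (X k.+1) w ->
  exists v, sat (X k.+2) (w - x ^+ k.+1 *: v).

Let torsion_liftP k : cofactor_lift k -> torsion_lift k.
Proof.
move=> Ck w sw.
have [p _ pE] : X 1 (y *: w).
  apply: (sat_sub_colon (sX 1) my ysq); apply: satS sw => _ [v _ ->].
  by exists (x ^+ k *: v) => //; rewrite scalerA -exprD add1n.
rewrite expr1 in pE.
have [|v sv] := Ck p.
  have : sat (dilate (y * x ^+ k.+1) setT) (x *: p).
    rewrite -pE; apply: sat_scale sw => _ [v _ ->].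
    by exists v => //; rewrite scalerA.
  move/sat_colon; apply: satS => q [v _]; rewrite exprS mulrCA -scalerA => H.
  by exists v => //; apply: (xregBX (n := 1)); rewrite expr1.
exists v.
have syw : sat (X k.+2) (y *: (w - x ^+ k.+1 *: v)).
  have -> : y *: (w - x ^+ k.+1 *: v) = x *: (p - (y * x ^+ k) *: v).
    by rewrite !scalerBr pE !scalerA mulrCA -exprS.
  by apply: sat_scale sv => _ [u _ ->]; exists u => //; rewrite scalerA -exprS.
have sw' : sat (X k.+1) (w - x ^+ k.+1 *: v).
  apply: (subB (submod_sat m (sX _))) => //; apply: sub_sat; by exists v.
have /(satI (submod_colon y (sX k.+2)) (sX k.+1)) :=
  conj (sat_colon syw) sw'.
apply: (@sat_mcolon _ _ _ t0) => u [[q _ uE] [b _ bE]].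
have /W_tors Wb : colon (X 1) y b.
  exists q => //; apply: (xregBX (n := k.+1)).
  by rewrite !scalerA -exprD addn1 -uE bE scalerA mulrC.
rewrite bE; have : mcolon t0 (colon (X k.+2) (x ^+ k.+1)) b.
  by apply: mcolonS Wb => _ [c _ ->]; exists c => //;
    rewrite scalerA -exprD addn1.
by rewrite mcolon_colon.
Qed.

Let cofactor_lift0 : cofactor_lift 0.
Proof.
move=> p sp; have /sat_xy[w [_ [Ww [v _ ->] ->]]] : sat (X 1 :+ Y) p.
  by apply: satS sp => _ [v _ ->]; rewrite mulr1; apply: addmr => //; exists v.
exists v; rewrite mulr1 addrK.
by have := satW 0 Ww; rewrite scale1r.
Qed.

Let cofactor_liftS k : torsion_lift k -> cofactor_lift k.+1.
Proof.
move=> Lk p sp; have [|v1 sv1] := Lk p.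
  by apply: satS sp => _ [v _ ->]; exists (y *: v) => //; rewrite scalerA mulrC.
have sS n := submod_sat m (sX n).
have /sat_xy[w [_ [Ww [v _ ->] v1E]]] : sat (X 1 :+ Y) v1.
  have sd := submod_dilate (y * x ^+ k.+1) (@submodT A V).
  have sDX : submod (dilate (y * x ^+ k.+1) [set: V] :+ X k.+2) by exact:
    submod_addm.
  have : sat (dilate (y * x ^+ k.+1) setT :+ X k.+2) (x ^+ k.+1 *: v1).
    have -> : x ^+ k.+1 *: v1 = p - (p - x ^+ k.+1 *: v1) by rewrite subKr.
    apply: (subB (submod_sat m sDX)); first by apply: satS sp; exact: addml.
    by apply: satS sv1; exact: addmr.
  move/sat_colon; apply: satS => u [_ [_ [[b _ ->] [c _ ->] uE]]].
  exists (x *: c), (y *: b); split; [by exists c|by exists b|].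
  apply: (xregBX (n := k.+1)); rewrite uE scalerDr !scalerA addrC.
  by rewrite -exprSr mulrC.
exists v.
have -> : p - (y * x ^+ k.+1) *: v = (p - x ^+ k.+1 *: v1) + x ^+ k.+1 *: w.
  by rewrite v1E scalerDr opprD addrA addrAC subrK scalerA mulrC.
by apply: (subD (sS _)) => //; exact: satW.
Qed.

Lemma torsion_class_lift n w : (0 < n)%N -> sat (X n) w ->
  exists v, sat (X n.+1) (w - x ^+ n *: v).
Proof.
have Ck k : cofactor_lift k.
  elim: k => [|k /torsion_liftP IHk]; first exact: cofactor_lift0.
  exact: cofactor_liftS.
by case: n => // k _; apply: torsion_liftP.
Qed.

End TorsionLift.

Section Unmixed.
Variables (A : comPzRingType) (m : set A) (V : lmodType A) (s : seq A).
Hypotheses (hA : noetherian A) (hV : noeth_module V).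
Hypotheses (mI : ideal m) (m1 : ~ m 1).
Hypothesis munit : forall b, ~ m b -> exists c, c * b = 1.
Hypotheses (hs : d_sequence V s) (sm : [set` s] `<=` m).

Local Notation r := (size s).
Local Notation Q i := (seqmul V (take i s)).
Local Notation U i := (colon (Q i) s`_i).

Hypothesis hU : forall i, (i < r)%N -> exists t, U i `<=` mcolon m t (Q i).

Lemma unmixed_ass_chain d (P : set (completion_ring m)) :
  unmixed m V -> has_dim V d -> (2 <= d)%N ->
  ass_prime (completion m V : lmodType (completion_ring m)) P ->
  exists p0 p1 p2 : set (completion_ring m),
    [/\ prime_ideal p0, prime_ideal p1, prime_ideal p2 &
      [/\ P `<=` p0, p0 `<` p1 & p1 `<` p2]].
Proof.
move=> hum hd d2 assP; have [e [[dimP _] hde]] := hum P assP.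
rewrite (chain_length_uniq hde hd) in dimP.
have [c [Cc lc]] := strict_chain_le d2 dimP.
have [pr0 P0] := Cc 0%N isT; have [pr1 _] := Cc 1%N isT;
  have [pr2 _] := Cc 2%N isT.
exists (c 0%N), (c 1%N), (c 2%N); split=> //; split; [|exact: lc|exact: lc].
apply: subset_trans P0 => a Pa v.
have [[sP _ _] _] := assP.
suff : P (a * v) by []. rewrite mulrC; exact: idealMl.
Qed.

(** A torsion element would give a zero-dimensional associated prime. *)
Lemma unmixed_no_torsion d (v : V) : unmixed m V -> has_dim V d -> (2 <= d)%N ->
  sat m [set 0] v -> v = 0.
Proof.
move=> hum hd d2 [t]; elim: t v => [//|t IHt] v tv.
apply: contrapT => vn.
have [P [assP chainP]] := socle_ass hA hV mI m1 munit vn (fun a ma =>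
  IHt _ (tv a ma)).
have [p0 [p1 [p2 [pr0 pr1 _ [P0 p01 _]]]]] := unmixed_ass_chain hum hd d2 assP.
exact: (chainP p0 p1).
Qed.

(** Equality of the last two lengths means that every torsion class modulo
    $(x_1, x_2)$ lifts to one modulo $x_1$. Then $x_1$ is surjective on
    $H^1_m(M)$, and [divisible_torsion_ass] excludes torsion modulo $x_1$. *)
Lemma unmixed_colon d u : unmixed m V -> has_dim V d -> (2 <= d)%N ->
  r = 3%N -> has_length (U 1) (Q 1) u -> has_length (U 2) (Q 2) u ->
  forall i, (i < r)%N -> U i `<=` Q i.
Proof.
move=> hum hd d2 r3 l1 l2; have sQ i : submod (Q i) :=
  submod_seqmul V (take i s).
have sU i : submod (U i) := submod_colon s`_i (sQ i).
have ltr i : (i < 3)%N -> (i < r)%N by rewrite r3.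
have mi i : (i < 3)%N -> m s`_i by move=> ir; apply: sm; apply: mem_nth;
  exact: ltr.
have QU i : Q i `<=` U i by move=> v; exact: (subZ _ (sQ i)).
have U0 : U 0 `<=` Q 0.
  move=> v Uv; have [t Ht] := hU (ltr 0%N isT).
  suff -> : v = 0 by exact: (sub0 (sQ 0%N)).
  apply: (unmixed_no_torsion hum hd d2); exists t.
  by rewrite -(seqmul_take0 V s); exact: Ht.
have xreg (v : V) : s`_0 *: v = 0 -> v = 0.
  move=> xv; have := U0 v; rewrite seqmul_take0; apply; exact: xv.
have Q1E : Q 1 = dilate (s`_0 ^+ 1) setT.
  by rewrite seqmul_takeS ?ltr // seqmul_take0 addm0 expr1.
have sY := submod_dilate s`_1 (@submodT A V).
have Q2E : Q 2 = dilate (s`_0 ^+ 1) setT :+ dilate s`_1 setT.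
  by rewrite seqmul_takeS ?ltr // Q1E addmC.
have Q2I : Q 2 `<=` idpow V (ideal_gen s) 1.
  by rewrite -seqmul_take_size; apply: seqmul_take_le; rewrite r3.
have sUQ : submod (U 1 :+ Q 2) by exact: submod_addm.
have UQ2 : U 1 :+ Q 2 `<=` U 2.
  apply: addm_sub => // v Uv; apply: (seqmul_take_le (s := s) (leqnSn 1)).
  by apply: (dseq_colon hs) Uv; rewrite r3.
(* $U_1 \cap Q_2 = Q_1$ by [dseq_colon_meet]. *)
have lUQ : has_length (U 1 :+ Q 2) (Q 2) u.
  apply: (@has_length_iso _ _ 1 _ _ _ _ _ _ _ _ _ _ _ _ _ _).1 l1 => //.
  - exact: addmr.
  - by move=> v Uv; rewrite scale1r; exact: addml.
  - by move=> _ [v [q [Uv Qq ->]]]; exists v => //; rewrite scale1r addrC addKr.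
  - move=> v Uv; rewrite scale1r; split=> [/Q2I|];
    first exact: (dseq_colon_meet hs (ltr 1%N isT)).
    exact: (seqmul_take_le (leqnSn 1)).
have U2E : U 2 `<=` U 1 :+ Q 2.
  have [|a [b [la lb E]]] := has_length_split (sQ 2) sUQ (sU 2) _ UQ2 l2.
    exact: addmr.
  have b0 : b = 0%N by have := chain_length_uniq la lUQ; lia.
  by move: lb; rewrite b0 => /(has_length0 (sU 2) sUQ UQ2).
have [t0 Ht0] := hU (ltr 1%N isT).
(* By the $d$-sequence property, all torsion modulo $Q_2$ lies in $U_2$. *)
have sat_xy : sat m (dilate (s`_0 ^+ 1) setT :+ dilate s`_1 setT) `<=`
    colon (dilate (s`_0 ^+ 1) [set: V]) s`_1 :+ dilate s`_1 setT.
  rewrite -Q2E -Q1E => v sv.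
  have : (U 1 :+ Q 2) v.
    apply: U2E; apply: (sat_sub_colon (sQ 2) (mi 2%N isT)) sv => w.
    exact: (dseq_colon_sq hs (ltr 2%N isT)).
  rewrite Q2E -Q1E -addmA; apply: addmS => //.
  by rewrite addm_id.
have U1 : U 1 `<=` Q 1.
  move=> w Uw; apply: contrapT => nQw.
  have lW : has_length (sat m (dilate (s`_0 ^+ 1) [set:
    V])) (dilate (s`_0 ^+ 1) setT) u.
    rewrite -Q1E; have -> // : sat m (Q 1) = U 1.
    apply/seteqP; split; last by move=> v /Ht0 Uv; exists t0.
    apply: (sat_sub_colon (sQ 1) (mi 1%N isT)) => v.
    exact: (dseq_colon_sq hs (ltr 1%N isT)).
  have [||n v n0|P [assP chainP]] := divisible_torsion_ass hA hV mI m1 munit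
      (mi 0%N isT) xreg lW (w0 := w).
  - by rewrite -Q1E; exists t0; exact: Ht0.
  - by rewrite -Q1E.
  - apply: (@torsion_class_lift _ m _ _ s`_1 t0) => //.
    + exact: mi.
    + by move=> v'; rewrite -Q1E; exact: (dseq_colon_sq hs (ltr 1%N isT)).
    + by rewrite -Q1E.
  have [p0 [p1 [p2 [pr0 pr1 pr2 [P0 p01 p12]]]]] :=
    unmixed_ass_chain hum hd d2 assP.
  exact: (chainP p0 p1 p2).
move=> [//|[//|[|i]]]; last by rewrite r3.
move=> _; apply: subset_trans U2E _; apply: addm_sub => //.
by apply: subset_trans U1 _; exact: (seqmul_take_le (leqnSn 1)).
Qed.

End Unmixed.

(** * The vanishing of $j_1$ *)

Section Vanishing.
Variables (A : comPzRingType) (m : set A) (V : lmodType A) (s : seq A).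
Hypotheses (hA : noetherian A) (hV : noeth_module V).
Hypotheses (mI : ideal m) (m1 : ~ m 1).
Hypothesis munit : forall b, ~ m b -> exists c, c * b = 1.
Hypotheses (hs : d_sequence V s) (sm : [set` s] `<=` m).

Local Notation r := (size s).
Local Notation Q i := (seqmul V (take i s)).
Local Notation U i := (colon (Q i) s`_i).

Hypothesis hU : forall i, (i < r)%N -> exists t, U i `<=` mcolon m t (Q i).

(** Otherwise $M = m^n M$ for all $n$, so $M = 0$ by [krull_intersection]. *)
Lemma seqmul_proper d : has_dim V d -> seqmul V s <> setT.
Proof.
move=> [[c [Cc _]] _] sT.
have mT n : idpow V m n = setT.
  elim: n => // n IHn; rewrite [LHS](_ : _ = idmul m (idpow V m n)) // IHn.
  apply/seteqP; split=> // v _.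
  have : seqmul V s v by rewrite sT.
  apply: idmul_gen_sub => //; first exact: submod_idmul.
  by move=> a w /sm ma _; exact: idmulP.
have v0 (v : V) : v = 0.
  suff : [set 0] v by [].
  apply: (krull_intersection hA hV mI m1 munit); first exact: submod_set0.
  by move=> n; rewrite add0m mT.
have [[_ c1 _] annc] := Cc 0%N isT; apply: c1; apply: annc => v.
by rewrite [_ *: _]v0.
Qed.

Lemma colon_regular_seq d : has_dim V d ->
  (forall i, (i < r)%N -> U i `<=` Q i) -> regular_seq V s.
Proof.
by move=> hd UQ; split=> [i ir v Uv|]; [exact: UQ|exact: seqmul_proper hd].
Qed.

Lemma colon_length_ex : exists u : nat -> nat,
  forall i, (i < r)%N -> has_length (U i) (Q i) (u i).
Proof.
suff H i : exists u, (i < r)%N -> has_length (U i) (Q i) u.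
  by have [u uP] := choice H; exists u.
have [ir|ri] := leqP r i; first by exists 0%N.
have sQ := submod_seqmul V (take i s); have [t Ut] := hU ri.
have [|u lu] := has_length_mcolon munit hV (submod_colon s`_i sQ) sQ _ Ut.
  by move=> v; exact: (subZ _ sQ).
by exists u.
Qed.

Lemma j_coef1_lengths (u : nat -> nat) : (2 <= r)%N ->
  (forall i, (i < r)%N -> has_length (U i) (Q i) (u i)) ->
  j_coef m V s 1 = (u r.-2)%:Z - (u r.-1)%:Z.
Proof.
move=> r2 hu; have sE := submod_idpow (ideal_gen s) V 1.
have [t Ht] := sat_uniform m hV sE.
have [c hc] := has_length_mcolon munit hV (submod_sat m sE) sE (@sub_sat _ m _
  _) Ht.
exact: j_coef1E hu hc r2.
Qed.

Lemma regular_j_coef1 : (2 <= r)%N -> regular_seq V s -> j_coef m V s 1 = 0.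
Proof.
move=> r2 [reg _]; have l0 i : (i < r)%N -> has_length (U i) (Q i) 0.
  move=> ir; have sQ := submod_seqmul V (take i s).
  apply/has_length0 => //; first exact: submod_colon.
    by move=> v; exact: (subZ _ sQ).
  by move=> v; exact: reg.
by rewrite (j_coef1_lengths r2 l0) subrr.
Qed.

(** The depth makes the lengths $u_0, \dots, u_{r-2}$ vanish; so does
    $u_{r-1} = u_{r-2} - j_1$. *)
Lemma j_coef1_depth (z : seq A) :
  [set` z] `<=` m -> regular_seq V z -> (r.-1 <= size z)%N -> (2 <= r)%N ->
  j_coef m V s 1 = 0 -> forall i, (i < r)%N -> U i `<=` Q i.
Proof.
move=> zm zreg rz r2 j0.
have sQ i := submod_seqmul V (take i s).
have QU i : Q i `<=` U i by move=> v; exact: (subZ _ (sQ i)).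
have Ui i : (i < r.-1)%N -> U i `<=` Q i.
  by move=> ir; apply: (depth_colon zm zreg sm hU); lia.
have [u hu] := colon_length_ex; move: j0; rewrite (j_coef1_lengths r2 hu).
have r2' : (r.-2 < r.-1)%N by lia.
have r2r : (r.-2 < r)%N by lia.
have r1r : (r.-1 < r)%N by lia.
have l2 : has_length (U r.-2) (Q r.-2) 0.
  apply/has_length0 => //; [exact: submod_colon|exact: Ui].
rewrite (chain_length_uniq (hu _ r2r) l2) => u1.
have := hu _ r1r; have -> : u r.-1 = 0%N by lia.
move=> /(has_length0 (submod_colon _ (sQ _)) (sQ _) (QU _)) U1 i ir.
have [ir1|ri] := ltnP i r.-1; first exact: Ui.
by have -> : i = r.-1 by lia.
Qed.

Lemma j_coef1_unmixed d : unmixed m V -> has_dim V d -> (2 <= d)%N -> r = 3%N ->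
  j_coef m V s 1 = 0 -> forall i, (i < r)%N -> U i `<=` Q i.
Proof.
move=> hum hd d2 r3; have [u hu] := colon_length_ex.
have r2 : (2 <= r)%N by rewrite r3.
rewrite (j_coef1_lengths r2 hu) r3 /= => u12.
have [h1 h2] : has_length (U 1) (Q 1) (u 1%N) /\ has_length (U 2) (Q 2) (u 2%N).
  by split; apply: hu; rewrite r3.
have uE : u 2%N = u 1%N by lia.
rewrite uE in h2; rewrite -r3.
exact: (unmixed_colon hA hV mI m1 munit hs sm hU hum hd d2 r3 h1 h2).
Qed.

End Vanishing.

Theorem theorem4p10 (R : comNzRingType) (m : set R) (M : lmodType R)
    (d r : nat) (x : r.-tuple R)
    (hlocal : local_ring m) (hnoeth : noetherian R)
    (hfin : finite_module M) (hdim : has_dim M d) (hd : (0 < d)%N)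
    (hsop : partial_sop m M x) (hamen : amenable M x) (hdseq : d_sequence M x)
    (hab : ((2 <= r)%N /\ exists e, has_depth m M e /\ (r.-1 <= e)%N) \/
           (r = 3%N /\ unmixed m M)) :
  j_coef m M x 1 = 0 <-> regular_seq M x.
Proof.
have hV := noeth_finite hnoeth hfin.
have [[mI m1 _] _] := hlocal.
have munit := local_unit hnoeth hlocal.
have [xm [e [hde _]]] := hsop.
have hU := amenable_colon_torsion mI m1 munit hdseq hamen.
have sx := size_tuple x.
have r2 : (2 <= size x)%N by rewrite sx; case: hab => [[]|[->]].
split; last exact: regular_j_coef1.
move=> j0; apply: (colon_regular_seq hnoeth hV mI m1 munit xm hdim).
case: hab => [[_ [e' [[[z [zm zreg ze]] _] re]]]|[r3 hum]].
  by apply: (j_coef1_depth hV munit hdseq xm hU zm zreg) => //; rewrite ze sx.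
have x3 : size x = 3%N by rewrite sx.
apply: (j_coef1_unmixed hnoeth hV mI m1 munit hdseq xm hU hum hde) => //.
by rewrite x3.
Qed.
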